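(* Let $f\colon[0,L]\times\mathbb{R}^+\to\mathbb{R}$ be an $L^1$-Carathéodory function satisfying: - $(f^* )$ $f(x,0)=0$ for a.e. $x\in I$; - $(f_0^-)$ there is $q_-\in L^1(I,\mathbb{R}^+)$ with $\liminf_{s\to0^+}f(x,s)/s\ge-q_-(x)$ uniformly a.e. $x\in I$; - $(f_0^+)$ there is $q_0\in L^1(I,\mathbb{R}^+)$, $q_0\not\equiv0$, with $\limsup_{s\to0^+}f(x,s)/s\le q_0(x)$ uniformly a.e. $x\in I$ and $\mu_1(q_0)>1$. Let $J\subseteq I$ be a closed subinterval such that $f(x,s)\ge0$ for a.e. $x\in J$ and all $s\ge0$. Assume moreover: - $(f_\infty^J)$ there is $q_\infty\in L^1(J,\mathbb{R}^+)$, $q_\infty\not\equiv0$, with $\liminf_{s\to+\infty}f(x,s)/s\ge q_\infty(x)$ uniformly a.e. $x\in J$ and $\mu_1^J(q_\infty)<1$; - $(G)$ there exist $a,b\in L^1(I\setminus J,\mathbb{R}^+)$ and $C>0$ such that $|f(x,s)|\le a(x)+b(x)s$ for a.e. $x\in I\setminus J$ and all $s\ge C$. Then there exists at least one positive solution of $$u''+f(x,u)=0,\qquad u(0)=u(L)=0.$$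
   Context: $\mathbb{R}^+=[0,+\infty)$, $I=[0,L]$ with $L>0$. $f$ is $L^1$-Carathéodory if $x\mapsto f(x,s)$ is measurable for each $s\in\mathbb{R}^+$, $s\mapsto f(x,s)$ is continuous for a.e. $x\in I$, and for each $\rho>0$ there is $\gamma_\rho\in L^1(I,\mathbb{R}^+)$ with $|f(x,s)|\le\gamma_\rho(x)$ for a.e. $x\in I$ and all $0\le s\le\rho$. A solution is an absolutely continuous $u\colon I\to\mathbb{R}^+$ with $u'$ absolutely continuous satisfying the equation a.e. and the boundary conditions; it is positive if $u>0$ on $(0,L)$. For a compact interval $J\subseteq I$ and $q\in L^1(J,\mathbb{R}^+)$, $q\not\equiv0$ (i.e. $q>0$ on a set of positive measure), $\mu_1^J(q)>0$ is the first eigenvalue of $\varphi''+\mu q(x)\varphi=0$, $\varphi|_{\partial J}=0$; $\mu_1(q):=\mu_1^I(q)$. ''$\liminf_{s\to s_0}f(x,s)/s\ge q(x)$ uniformly a.e. $x\in J$'' means: for each $\varepsilon>0$, $f(x,s)/s\ge q(x)-\varepsilon$ for a.e. $x\in J$ and all $s>0$ sufficiently close to $s_0$, uniformly in $x$ (sufficiently large if $s_0=+\infty$); similarly for $\limsup$. *)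

(* Defs.v *)
From HB Require Import structures.
From mathcomp Require Import all_boot all_order all_algebra.
From mathcomp Require Import all_classical all_reals all_analysis.

Set Implicit Arguments.
Unset Strict Implicit.
Unset Printing Implicit Defensive.

Import Order.TTheory GRing.Theory Num.Theory.
Import numFieldNormedType.Exports.

Local Open Scope classical_set_scope.
Local Open Scope ring_scope.

(* Functions on A `<=` R are total functions R -> R whose values outside A are
   irrelevant; likewise f : R -> R -> R stands for f : A * R^+ -> R. *)

(* R with the Lebesgue (not merely Borel) sigma-algebra, i.e. the domain of
   [completed_lebesgue_measure]. *)
Definition lebesgueType (R : realType) : measurableType _ :=
  caratheodory_type ((@wlength R idfun)^*)%mu.

Definition leb (R : realType) : {measure set (lebesgueType R) -> \bar R} :=
  @completed_lebesgue_measure R.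

Definition ae_in (R : realType) (A : set R) (P : R -> Prop) : Prop :=
  {ae leb R, forall x, A x -> P x}.

(* q \in L^1(A, R^+) *)
Definition L1_nonneg (R : realType) (A : set R) (q : R -> R) : Prop :=
  (leb R).-integrable A (EFin \o q) /\ forall x, A x -> 0 <= q x.

(* q =/= 0 on A, for q >= 0 *)
Definition not_null (R : realType) (A : set R) (q : R -> R) : Prop :=
  (0 < leb R (A `&` [set x | (0 < q x)%R]))%E.

Record L1_caratheodory (R : realType) (A : set R) (f : R -> R -> R) : Prop :=
  { caratheodory_measurable : forall s, 0 <= s ->
      measurable_fun (A : set (lebesgueType R)) (f ^~ s) ;
    caratheodory_continuous :
      ae_in A (fun x => {within `[0, +oo[, continuous (f x)}) ;
    caratheodory_bounded : forall rho, 0 < rho ->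
      exists2 gamma, L1_nonneg A gamma &
        ae_in A (fun x => forall s, 0 <= s <= rho -> `|f x s| <= gamma x) }.

(* liminf_(s -> s0) f(x,s)/s >= q(x), resp. limsup_(s -> s0) f(x,s)/s <= q(x),
   uniformly for a.e. x in A, where F is the filter of s -> s0: [0^'+] for
   s -> 0^+ and [pinfty_nbhs R] for s -> +oo. The neighbourhood U does not depend on x. *)
Definition unif_liminf_ge (R : realType) (F : set_system R) (A : set R)
    (f : R -> R -> R) (q : R -> R) : Prop :=
  forall e, 0 < e -> exists2 U, F U &
    ae_in A (fun x => forall s, 0 < s -> U s -> q x - e <= f x s / s).

Definition unif_limsup_le (R : realType) (F : set_system R) (A : set R)
    (f : R -> R -> R) (q : R -> R) : Prop :=
  forall e, 0 < e -> exists2 U, F U &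
    ae_in A (fun x => forall s, 0 < s -> U s -> f x s / s <= q x + e).

Definition abs_continuous (R : realType) (c d : R) (u : R -> R) : Prop :=
  forall e, 0 < e -> exists2 delta, 0 < delta &
    forall (n : nat) (a b : 'I_n -> R),
      (forall i, c <= a i /\ a i <= b i /\ b i <= d) ->
      trivIset [set: 'I_n] (fun i => `]a i, b i[%classic) ->
      \sum_(i < n) (b i - a i) < delta ->
      \sum_(i < n) `|u (b i) - u (a i)| < e.

(* u is a (Caratheodory) solution of u'' + g(x, u) = 0, u(c) = u(d) = 0.
   Here v is u'; at the endpoints of [c, d] it is the one-sided derivative,
   because u and v are continuous on [c, d]. *)
Definition dirichlet_solution (R : realType) (c d : R) (g : R -> R -> R)
    (u : R -> R) : Prop :=
  abs_continuous c d u /\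
  (exists v, [/\ abs_continuous c d v,
                 forall x, x \in `]c, d[ -> is_derive x 1 u (v x) &
                 ae_in `[c, d] (fun x => exists2 w,
                   is_derive x 1 v w & w + g x (u x) = 0)]) /\
  u c = 0 /\ u d = 0.

(* eigenvalues of phi'' + mu q(x) phi = 0, phi(c) = phi(d) = 0 *)
Definition dirichlet_eigenvalue (R : realType) (c d : R) (q : R -> R) (mu : R) : Prop :=
  exists2 phi, dirichlet_solution c d (fun x s => mu * q x * s) phi &
               exists2 x, x \in `[c, d] & phi x != 0.

Definition first_eigenvalue (R : realType) (c d : R) (q : R -> R) (mu : R) :
    Prop :=
  dirichlet_eigenvalue c d q mu /\ forall nu, dirichlet_eigenvalue c d q nu -> mu <= nu.

(* Main.v *)
(** Shooting from the left end point. Solutions of the initial value problem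
    [u(0) = 0], [u'(0) = al] need not be unique, so the intermediate value theorem is
    applied to an Euler scheme, which depends continuously on [al]; compactness and
    dominated convergence turn discrete solutions vanishing at [L] into a genuine one.
    For small [al], comparison (through the Wronskian) with a positive solution of
    [z'' + (q_0 + e) z <= 0] gives [u(L) > 0]. For large [al], assume [u >= 0]. Testing
    the equation on [J] with an eigenfunction of [q_inf] bounds a mean of [u],
    hence, [u] being concave on [J], the Cauchy data of [u] at the left end of [J]; a
    backward Gronwall estimate then bounds [al], a contradiction. So [u] becomes
    negative, and it stays so because the nonlinearity is extended by [0] to [u <= 0].
    The upper bound on [u] only uses that [u] is concave on [J], so that truncating
    the nonlinearity at a large height is harmless. *)
Require Import Defs.
From mathcomp Require Import all_boot all_order all_algebra.
From mathcomp Require Import all_classical all_reals all_analysis.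
From mathcomp Require Import measurable_realfun.
From mathcomp Require Import ring lra.
Set Implicit Arguments.
Unset Strict Implicit.
Unset Printing Implicit Defensive.

Import Order.TTheory GRing.Theory Num.Theory.
Import numFieldNormedType.Exports.

Local Open Scope classical_set_scope.
Local Open Scope ring_scope.

(** * Integrals over intervals *)

(** What shapes the proof is that (G) bounds [f] linearly only off [J], while on [J] upper bounds
    are only local in [s]; so no two-sided Gronwall estimate crosses [J]. One-sided facts replace
    it: as [f >= 0] on [J], [-f] grows at most linearly on all of [0, L], which bounds [u] from
    above; and a two-sided bound holds to the left of [J], where the Cauchy data are carried back to
    0. The constants are not circular: the bound [M] at the left end of [J] and the Gronwall factors
    do not involve the truncation; the large slope is chosen from them, and the truncation height
    last. The bound on [-f] survives truncation because it is stated for every [s1 <= s]. The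
    condition on [q_0] enters as absence of eigenvalues [<= 1]; the one on [q_inf] through a single
    eigenfunction, restricted to an interval where it has a sign. The gap [1 - mu] is the
    coefficient that makes the tested inequality a bound. Equations are kept in the integrated form
    [W21]. Translating between it and solutions in the absolutely continuous sense needs Lebesgue
    differentiation one way, and the other way that a zero derivative a.e. forces constancy. *)

Section integral.
Context {R : realType}.
Implicit Types (x y z a b c : R) (f g h : R -> R).

(** Half-open, so that adjacent cells are disjoint and [itg_cat] needs no null-set argument. For
    [y <= x] the cell is empty and [itg x y g] is 0, whence the ordering hypotheses throughout. *)
Definition seg x y : set (lebesgueType R) := `]x, y]%classic.
Definition itg x y g : R := \int[leb R]_(t in seg x y) g t.
Definition itgble x y g := (leb R).-integrable (seg x y) (EFin \o g).

Lemma borel_leb (A : set R) :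
  measurable A -> measurable (A : set (lebesgueType R)).
Proof. exact: sub_caratheodory. Qed.

Lemma measurable_seg x y : measurable (seg x y).
Proof. by apply: borel_leb; exact: measurable_itv. Qed.
Hint Resolve measurable_seg : core.

Lemma leb_borel (A : set R) : leb R A = lebesgue_measure A.
Proof. by []. Qed.

Lemma leb_seg x y : x <= y -> leb R (seg x y) = (y - x)%:E.
Proof.
move=> xy; rewrite leb_borel lebesgue_measure_itv/= lte_fin.
have [->|neq] := eqVneq x y; first by rewrite ltxx subrr.
by rewrite lt_neqAle neq xy/= EFinB.
Qed.

Lemma leb_seg_fin x y : (leb R (seg x y) < +oo)%E.
Proof.
rewrite leb_borel lebesgue_measure_itv/=; case: ifP => // _.
by rewrite -EFinB ltry.
Qed.

Lemma measurable_leb_borel (A : set R) f :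
  measurable A -> measurable_fun A f ->
  measurable_fun (A : set (lebesgueType R)) f.
Proof. by move=> mA mf _ B mB; apply: borel_leb; exact: mf. Qed.

Lemma ae_in_sub (A B : set R) (P Q : R -> Prop) : B `<=` A ->
  (forall x, B x -> P x -> Q x) -> ae_in A P -> ae_in B Q.
Proof.
move=> BA PQ; apply: (@filterS _ _ (ae_filter_ringOfSetsType (leb R))) => x AP Bx.
by apply: PQ => //; exact/AP/BA.
Qed.

Lemma ae_inW (A : set R) (P : R -> Prop) : (forall x, A x -> P x) -> ae_in A P.
Proof. by move=> AP; apply: aeW. Qed.

Lemma ae_in2 (A : set R) (P Q S : R -> Prop) :
  (forall x, A x -> P x -> Q x -> S x) -> ae_in A P -> ae_in A Q -> ae_in A S.
Proof.
move=> PQS; apply: (@filterS2 _ _ (ae_filter_ringOfSetsType (leb R))) => x AP AQ Ax.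
by apply: PQS; auto.
Qed.

(** Here the bound variable of the conclusion has type [lebesgueType R], the form in which general
    lemmas on a.e. properties for [leb R] can be applied. *)
Lemma ae_inS (A : set R) (P Q : R -> Prop) :
  (forall x, A x -> P x -> Q x) -> ae_in A P ->
  {ae leb R, forall x : lebesgueType R, A x -> Q x}.
Proof. exact: ae_in_sub. Qed.

Lemma itgbleS a b c d g : a <= c -> d <= b -> itgble a b g -> itgble c d g.
Proof.
move=> ac db; apply: integrableS => // t; rewrite /seg/= !in_itv/=.
by move=> /andP[ct td]; rewrite (le_lt_trans ac ct) (le_trans td db).
Qed.

Lemma itg_cat a b c g : a <= b -> b <= c -> itgble a c g ->
  itg a c g = itg a b g + itg b c g.
Proof.
move=> ab bc ig; have segU : seg a c = seg a b `|` seg b c.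
  by rewrite /seg -itv_bndbnd_setU.
rewrite /itg segU Rintegral_setU//; first by rewrite -segU.
apply/disj_set2P; rewrite -subset0 => t []; rewrite /seg/= !in_itv/=.
by move=> /andP[_ tb] /andP[bt _]; move: (lt_le_trans bt tb); rewrite ltxx.
Qed.

Lemma itgg a g : itg a a g = 0.
Proof. by rewrite /itg /seg set_itv_ge ?bnd_simp ?ltxx// Rintegral_set0. Qed.

Lemma itgbleg a g : itgble a a g.
Proof.
by rewrite /itgble /seg set_itv_ge ?bnd_simp ?ltxx//; exact: integrable_set0.
Qed.

Lemma itgbleD a b f g : itgble a b f -> itgble a b g ->
  itgble a b (fun t => f t + g t).
Proof. by move=> fi gi; exact: (integrableD _ fi gi). Qed.

Lemma itgbleB a b f g : itgble a b f -> itgble a b g ->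
  itgble a b (fun t => f t - g t).
Proof. by move=> fi gi; exact: (integrableB _ fi gi). Qed.

Lemma itgbleZ a b k g : itgble a b g -> itgble a b (fun t => k * g t).
Proof. by move=> gi; exact: (integrableZl _ k gi). Qed.

Lemma itgbleN a b g : itgble a b g -> itgble a b (fun t => - g t).
Proof. by move=> gi; exact: (integrableN gi). Qed.

Lemma itgble_norm a b g : itgble a b g -> itgble a b (fun t => `|g t|).
Proof. exact: integrable_norm. Qed.

Lemma itgble_cst a b k : itgble a b (fun=> k).
Proof.
apply: (@measurable_bounded_integrable _ _ _ (leb R)).
- exact: measurable_seg.
- exact: leb_seg_fin.
- exact: measurable_cst.
- exact: bounded_cst.
Qed.

Lemma itgD a b f g : itgble a b f -> itgble a b g ->
  itg a b (fun t => f t + g t) = itg a b f + itg a b g.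
Proof. by move=> fi gi; rewrite /itg RintegralD. Qed.

Lemma itgB a b f g : itgble a b f -> itgble a b g ->
  itg a b (fun t => f t - g t) = itg a b f - itg a b g.
Proof. by move=> fi gi; rewrite /itg RintegralB. Qed.

Lemma itgZ a b k g : itgble a b g -> itg a b (fun t => k * g t) = k * itg a b g.
Proof. by move=> gi; rewrite /itg RintegralZl. Qed.

Lemma itgN a b g : itgble a b g -> itg a b (fun t => - g t) = - itg a b g.
Proof.
by move=> gi; rewrite -[RHS]mulN1r -itgZ//; apply: eq_Rintegral => t _; rewrite mulN1r.
Qed.

Lemma itg_cst a b k : a <= b -> itg a b (fun=> k) = k * (b - a).
Proof. by move=> ab; rewrite /itg Rintegral_cst// leb_seg. Qed.

Lemma itgble_measurable a b g : itgble a b g -> measurable_fun (seg a b) g.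
Proof. by move=> /(measurable_int (leb R)) /measurable_EFinP. Qed.

Lemma eq_itg_ae a b f g : itgble a b f -> itgble a b g ->
  ae_in (seg a b) (fun t => f t = g t) -> itg a b f = itg a b g.
Proof.
move=> fi gi fg; rewrite /itg /Rintegral; congr fine.
apply: ae_eq_integral.
- exact: measurable_seg.
- by case/integrableP : fi.
- by case/integrableP : gi.
- by apply: ae_inS fg => x Dx ->.
Qed.

(** Completeness of the measure gives the measurability of [g]; with the Borel sigma-algebra it
    could fail. *)
Lemma itgble_ae a b f g : itgble a b f ->
  ae_in (seg a b) (fun t => f t = g t) -> itgble a b g.
Proof.
move=> fi fg; have mg : measurable_fun (seg a b) (EFin \o g).
  apply: (@ae_measurable_fun _ _ _ (leb R) _ _ (EFin \o f)).
  - exact: completed_lebesgue_measure_is_complete.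
  - by apply: ae_inS fg => x Dx /= ->.
  - by case/integrableP : fi.
apply/integrableP; split => //.
rewrite -(@ae_eq_integral _ _ _ (leb R) (seg a b) (abse \o (EFin \o g)) (abse \o (EFin \o f))).
- by case/integrableP : fi.
- exact: measurable_seg.
- by apply: measurableT_comp; [exact: abse_measurable|case/integrableP : fi].
- by apply: measurableT_comp; [exact: abse_measurable|].
- by apply: ae_inS fg => x Dx /= ->.
Qed.

Lemma itgble_le a b f g : measurable_fun (seg a b) f -> itgble a b g ->
  ae_in (seg a b) (fun t => `|f t| <= g t) -> itgble a b f.
Proof.
move=> mf gi fg; apply/integrableP; split; first exact/measurable_EFinP.
have /integrableP[mg] := integrable_norm gi; apply: le_lt_trans.
apply: ae_ge0_le_integral.
- exact: measurable_seg.
- by move=> x _; exact: abse_ge0.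
- by apply: measurableT_comp; [exact: abse_measurable|exact/measurable_EFinP].
- by move=> x _; exact: abse_ge0.
- by apply: measurableT_comp; [exact: abse_measurable|].
- apply: ae_inS fg => x Dx fg.
  by rewrite /= normr_id lee_fin (le_trans fg)// ler_norm.
Qed.

(** The a.e. inequality becomes an everywhere one after replacing [f] by the a.e. equal function
    [min f g]. *)
Lemma le_itg a b f g : itgble a b f -> itgble a b g ->
  ae_in (seg a b) (fun t => f t <= g t) -> itg a b f <= itg a b g.
Proof.
move=> fi gi fg.
have mi : itgble a b (fun t => Num.min (f t) (g t)).
  apply: itgble_ae fi _; apply: ae_inS fg => x Dx.
  by rewrite minEle => ->.
rewrite (@eq_itg_ae _ _ f (fun t => Num.min (f t) (g t)))//; last first.
  by apply: ae_inS fg => x Dx; rewrite minEle => ->.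
by apply: le_Rintegral => // x _; rewrite ge_min lexx orbT.
Qed.

Lemma itg_ge0 a b g : itgble a b g -> ae_in (seg a b) (fun t => 0 <= g t) ->
  0 <= itg a b g.
Proof.
move=> gi g0; rewrite -[leLHS](_ : itg a b (fun=> 0) = 0).
  by apply: le_itg => //; exact: itgble_cst.
have [ab|ba] := leP a b; first by rewrite itg_cst// mul0r.
by rewrite /itg /seg set_itv_ge ?bnd_simp -?leNgt ?ltW// Rintegral_set0.
Qed.

Lemma norm_itg a b g : itgble a b g -> `|itg a b g| <= itg a b (fun t => `|g t|).
Proof. by move=> gi; exact: le_normr_Rintegral. Qed.

Lemma itg_mono a b c d g : a <= c -> c <= d -> d <= b -> itgble a b g ->
  ae_in (seg a b) (fun t => 0 <= g t) -> itg c d g <= itg a b g.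
Proof.
move=> ac cd db gi g0.
have ad := le_trans ac cd; have cb := le_trans cd db.
rewrite (@itg_cat a c b)//= (@itg_cat c d b)//; last exact: itgbleS gi.
have sub x y : a <= x -> y <= b -> 0 <= itg x y g.
  move=> ax yb; apply: itg_ge0; first exact: itgbleS gi.
  apply: ae_in_sub g0 => // t; rewrite /seg/= !in_itv/= => /andP[xt ty].
  by rewrite (le_lt_trans ax xt) (le_trans ty yb).
by rewrite -lerBlDr; have := sub _ _ (lexx a) cb; have := sub _ _ ad (lexx b);
   have := sub _ _ (lexx a) (le_trans cd db); have := sub a c (lexx _) cb; lra.
Qed.

Lemma itgbleM a b f g : measurable_fun (seg a b) f -> itgble a b g ->
  (exists M, forall t, seg a b t -> `|f t| <= M) -> itgble a b (fun t => f t * g t).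
Proof.
move=> mf gi [M fM].
apply: (@itgble_le _ _ _ (fun t => M * `|g t|)).
- by apply: measurable_funM => //; exact: itgble_measurable gi.
- exact/itgbleZ/itgble_norm.
- by apply: ae_inW => t Dt; rewrite normrM ler_wpM2r// fM.
Qed.

(** Measurability of the limit is obtained, not assumed: off the exceptional null set it is a
    pointwise limit of measurable functions, and completeness takes care of the null set. *)
Lemma itg_dct a b (f_ : nat -> R -> R) f g :
  (forall n, measurable_fun (seg a b) (f_ n)) -> itgble a b g ->
  ae_in (seg a b) (fun t => f_ ^~ t @ \oo --> f t) ->
  ae_in (seg a b) (fun t => forall n, `|f_ n t| <= g t) ->
  itgble a b f /\ itg a b (f_ n) @[n --> \oo] --> itg a b f.
Proof.
move=> mf gi ff fg.
have [N [mN N0 subN]] := ff.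
have ff' t : (seg a b `\` N) t -> f_ ^~ t @ \oo --> f t.
  move=> [Dt Nt]; apply: contrapT => h; apply: Nt; apply: subN => /=.
  by move=> /(_ Dt).
have mf0 : measurable_fun (seg a b) (EFin \o (f \_ (~` N))).
  apply/measurable_EFinP.
  apply: (@measurable_fun_cvg _ _ _ _ (fun n => (f_ n) \_ (~` N))) => //.
    move=> n; apply/measurable_restrict => //; first exact: measurableC.
    by apply: measurable_funS (mf n) => // t [].
  move=> t Dt; rewrite /patch; case: ifPn => [|_]; last exact: cvg_cst.
  by rewrite inE => Nt; exact: ff'.
have mf' : measurable_fun (seg a b) (EFin \o f).
  apply: (@ae_measurable_fun _ _ _ (leb R) _ _ (EFin \o (f \_ (~` N)))) => //.
  - exact: completed_lebesgue_measure_is_complete.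
  - exists N; split => // t /=; apply: contra_notP => Nt Dt.
    by rewrite /patch mem_set.
have mf_ n : measurable_fun (seg a b) (EFin \o f_ n) by exact/measurable_EFinP.
have [] := @dominated_convergence _ _ _ (leb R) _ (measurable_seg a b)
  (fun n => EFin \o f_ n) (EFin \o f) (EFin \o g) mf_ mf'.
- apply: ae_inS ff => t Dt h; apply/cvg_EFin => //.
  by apply: nearW.
- exact: gi.
- apply: (@filterS _ _ (ae_filter_ringOfSetsType (leb R)) _ _ _ fg) => t h n Dt.
  by rewrite lee_fin; exact: h.
- move=> fi _ h; split => //.
  apply: fine_cvg; rewrite fineK//.
  exact: integrable_fin_num.
Qed.

End integral.
#[global] Hint Resolve measurable_seg : core.

(** * Absolutely continuous functions *)

Section absolute_continuity.
Context {R : realType}.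
Implicit Types (x y z a b c e r : R) (f g h : R -> R).

Lemma itg_small a b g e : itgble a b g -> 0 < e ->
  exists2 d, 0 < d & forall A : set (lebesgueType R), measurable A ->
    A `<=` seg a b -> (leb R A < d%:E)%E -> \int[leb R]_(t in A) `|g t| < e.
Proof.
move=> gi e0.
have gi' : (leb R).-integrable setT (EFin \o (g \_ (seg a b))).
  by rewrite -restrict_EFin; exact: (integrable_mkcond _ _).1.
have [d [d0 H]] := integral_normr_continuous gi' e0.
exists d => // A mA Aab Ad; have := H A mA Ad.
by under eq_Rintegral => t /set_mem/Aab/mem_set tab do rewrite patchE tab.
Qed.

Lemma EFin_itg a b g : itgble a b g ->
  (itg a b g)%:E = (\int[leb R]_(t in seg a b) (g t)%:E)%E.
Proof. by move=> gi; rewrite /itg fineK//; exact: integrable_fin_num. Qed.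

Lemma itg_cont a b g e : itgble a b g -> 0 < e ->
  exists2 d, 0 < d & forall x y, a <= x -> x <= y -> y <= b -> y - x < d ->
    itg x y (fun t => `|g t|) < e.
Proof.
move=> gi e0; have [d d0 H] := itg_small gi e0; exists d => // x y ax xy yb yx.
apply: H => //.
  move=> t; rewrite /seg/= !in_itv/= => /andP[xt ty].
  by rewrite (le_lt_trans ax xt) (le_trans ty yb).
by rewrite leb_seg// lte_fin.
Qed.

Lemma abs_continuous_itg a b g v : itgble a b g ->
  (forall x y, a <= x -> x <= y -> y <= b -> v y - v x = itg x y g) ->
  abs_continuous a b v.
Proof.
move=> gi vg e e0; have [d d0 H] := itg_small gi e0; exists d => // n A B AB tAB sAB.
have tseg : trivIset [set` index_enum 'I_n] (fun i => seg (A i) (B i)).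
  move=> i j _ _ [t] [] /=; rewrite /seg/= !in_itv/= => /andP[ait tbi] /andP[ajt tbj].
  (* A common point [t] of two half-open cells may be a right end point, which the open intervals
     omit; the midpoint between [t] and the larger left end lies in both open intervals. *)
  apply: tAB => //; exists ((Num.max (A i) (A j) + t) / 2).
  have mt : Num.max (A i) (A j) < t by rewrite gt_max ait.
  have := le_max (A i) (A i) (A j); rewrite lexx /= => mi.
  have := le_max (A j) (A i) (A j); rewrite lexx orbT /= => mj.
  by split => /=; rewrite in_itv/=; apply/andP; split; lra.
have sub i : seg (A i) (B i) `<=` seg a b.
  have [ai [_ bi]] := AB i; move=> t; rewrite /seg/= !in_itv/= => /andP[xt ty].
  by rewrite (le_lt_trans ai xt) (le_trans ty bi).
pose U := \big[setU/set0]_(i <- index_enum 'I_n) seg (A i) (B i).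
have mU : measurable U by apply: bigsetU_measurable => i _.
have Uab : U `<=` seg a b.
  rewrite /U; elim/big_ind : _ => //; first by move=> X Y hX hY t [/hX|/hY].
have gii i : itgble (A i) (B i) (fun t => `|g t|).
  have [ai [_ bi]] := AB i; apply: itgbleS ai bi _; exact: itgble_norm.
have -> : \sum_(i < n) `|v (B i) - v (A i)| = \sum_(i < n) `|itg (A i) (B i) g|.
  by apply: eq_bigr => i _; have [? [? ?]] := AB i; rewrite vg.
apply: (@le_lt_trans _ _ (\int[leb R]_(t in U) `|g t|)).
  rewrite -lee_fin -sumEFin [leRHS]fineK; last first.
    apply: (@integrable_fin_num _ _ _ (leb R) U mU (EFin \o (fun t => `|g t|))).
    exact: (integrableS _ mU Uab (itgble_norm gi)).
  rewrite ge0_integral_bigsetU//.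
  - apply: lee_sum => i _; rewrite -EFin_itg// lee_fin.
    apply: norm_itg; have [ai [_ bi]] := AB i; exact: itgbleS ai bi gi.
  - exact: index_enum_uniq.
  - have : measurable_fun (seg a b) (EFin \o (fun t => `|g t|)).
      exact: (measurable_int _ (itgble_norm gi)).
    by apply: measurable_funS.
apply: H => //.
rewrite /U measure_bigsetU_ord//; last first.
  by apply: sub_trivIset tseg => i _ /=; rewrite mem_index_enum.
rewrite (eq_bigr (fun i => (B i - A i)%:E)).
  by rewrite sumEFin lte_fin.
by move=> i _; have [? [? ?]] := AB i; exact: leb_seg.
Qed.

Lemma leb_borel_core (A : set (lebesgueType R)) : measurable A ->
  exists B N : set R, [/\ measurable B, measurable N, lebesgue_measure N = 0 &
    forall x, ~ N x -> (A x <-> B x)].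
Proof.
move=> mA; have : (completed_algebra_gen (@lebesgue_measure R)).-sigma.-measurable A.
  by rewrite completed_caratheodory_measurable.
rewrite g_sigma_completed_algebra_genE => -[B mB [M [N [mN N0 MN]] <-]].
exists B, N; split => // x Nx; split; last by left.
by case => // /MN.
Qed.

(** The differentiation theorem applied in [itg_derivable] concerns the Borel measure, hence this
    modification. Superlevel sets at rational heights determine the function; each is Borel up to a
    null set, and [g] is set to 0 on the union of these countably many null sets. *)
Lemma borel_version g : measurable_fun setT (g : lebesgueType R -> R) ->
  exists2 g' : R -> R, measurable_fun setT g' & ae_in setT (fun x => g x = g' x).
Proof.
move=> mg.
have mA (q : rat) : measurable ([set x | ratr q < g x] : set (lebesgueType R)).
  have := mg measurableT _ (measurable_itv `]ratr q, +oo[).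
  rewrite setTI; congr measurable; apply/seteqP.
  by split => x /=; rewrite in_itv/= andbT.
have /choice[BN HBN] : forall q : rat, exists BN : set R * set R,
    [/\ measurable BN.1, measurable BN.2, lebesgue_measure BN.2 = 0 &
    forall x, ~ BN.2 x -> (ratr q < g x <-> BN.1 x)].
  move=> q; have [B [N H]] := leb_borel_core (mA q); by exists (B, N).
(* An enumeration of the rationals; integers that code none are sent to 0, which merely repeats a
   set. *)
pose e n : rat := odflt 0 (unpickle n).
pose N := \bigcup_n (BN (e n)).2.
have mN : measurable N by apply: bigcupT_measurable => n; case: (HBN (e n)).
have N0 : lebesgue_measure N = 0.
  apply: measure_negligible => //; apply: negligible_bigcup => n.
  by case: (HBN (e n)) => _ mn n0 _; exists (BN (e n)).2; split.
have NP x : ~ N x -> forall q : rat, (ratr q < g x <-> (BN q).1 x).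
  move=> Nx q; case: (HBN q) => _ _ _; apply => BNq; apply: Nx.
  by exists (pickle q) => //; rewrite /e pickleK.
exists (g \_ (~` N)).
  move=> _; apply: (measurability _ (RGenOInfty.measurableE R)) => // _ [_ [r ->] <-].
  rewrite setTI.
  have -> : g \_ (~` N) @^-1` `]r, +oo[ =
      (~` N `&` \bigcup_n (if (r < ratr (e n)) then (BN (e n)).1 else set0))
      `|` (N `&` [set _ | r < 0]).
    apply/seteqP; split => x /=; rewrite in_itv/= andbT patchE.
      case: ifPn => [|].
        rewrite inE => Nx rg; left; split => //.
        have [q] := rat_in_itvoo rg; rewrite in_itv/= => /andP[rq qg].
        by exists (pickle q) => //; rewrite /e pickleK/= rq; apply/NP.
      by rewrite notin_setE/= => /contrapT Nx r0; right.
    case=> [[Nx [n _]]|[Nx r0]]; last by rewrite memNset//; exact.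
    rewrite mem_set//; case: ifPn => // rn BNn.
    by apply: lt_trans rn _; apply/NP.
  apply: measurableU.
    apply: measurableI; first exact: measurableC.
    by apply: bigcupT_measurable => n; case: ifPn => _ //; case: (HBN (e n)).
  have [r0|r0] := pselect (r < 0).
    by rewrite (_ : [set _ | _] = setT) ?setIT//; apply/seteqP; split.
  by rewrite (_ : [set _ | _] = set0) ?setI0//; apply/seteqP; split.
exists N; split; [exact: borel_leb|by []|].
move=> x /= /not_implyP[_]; apply: contra_notP => Nx.
by rewrite patchE mem_set.
Qed.

(** The identity is measurable from the Lebesgue to the Borel sigma-algebra, and the Borel measure
    is the image of [leb R] under it. *)
Lemma itg_borel x y g : measurable_fun setT g -> itgble x y g ->
  lebesgue_measure.-integrable `]x, y] (EFin \o g) /\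
  itg x y g = \int[lebesgue_measure]_(t in `]x, y]) g t.
Proof.
move=> mg gi.
pose phi : lebesgueType R -> measurableTypeR R := id.
have mphi : measurable_fun setT phi.
  by move=> _ B mB; rewrite setTI; exact: borel_leb.
have mg' : measurable_fun setT (EFin \o g) by exact/measurable_EFinP.
have [e1 e2] : lebesgue_measure.-integrable `]x, y] (EFin \o g) /\
  (\int[lebesgue_measure]_(t in `]x, y]) (EFin \o g) t =
   \int[leb R]_(t in seg x y) (g t)%:E)%E.
  have mes : forall A, measurable A ->
    A `<=` `]x, y]%classic -> lebesgue_measure A = pushforward (leb R) phi A by [].
  have e3 := @integral_pushforward _ _ _ _ _ phi mphi (leb R)
    `]x, y]%classic (EFin \o g) mg' gi (measurable_itv _).
  have e4 := @integrable_pushforward _ _ _ _ _ phi mphi (leb R)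
    `]x, y]%classic (EFin \o g) mg' gi (measurable_itv _).
  split; last by rewrite -e3; exact: eq_measure_integral.
  by case/integrableP : e4 => m4 i4; apply/integrableP; split.
by split => //; rewrite /itg /Rintegral; congr fine; rewrite -e2.
Qed.

(** Lebesgue differentiation for a Borel version of [g], whose primitive agrees with that of [g]
    near every interior point. *)
Lemma itg_derivable a b g : itgble a b g ->
  ae_in `]a, b[ (fun x => is_derive x 1 (fun z => itg a z g) (g x)).
Proof.
move=> gi.
have [ba|ab] := leP b a.
  by apply: ae_inW => x; rewrite /= in_itv/= => /andP[/lt_trans h /h]; rewrite ltNge ba.
pose g0 : lebesgueType R -> R := g \_ (seg a b).
have mg0 : measurable_fun setT g0.
  apply/(measurable_restrictT _ _).1 => //; exact: itgble_measurable.
have [g' mg' gg'] := borel_version mg0.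
pose g1 := g' \_ `]a, b].
have gg1 : ae_in (seg a b) (fun x => g x = g1 x).
  apply: ae_in_sub gg' => // x abx; rewrite /g0 /g1 !patchE.
  by rewrite !mem_set.
have mg1 : measurable_fun setT g1.
  apply/(measurable_restrictT _ _).1; first exact: measurable_itv.
  exact: measurable_funS mg'.
have gi1 : itgble a b g1 by exact: itgble_ae gi gg1.
have [li _] := itg_borel mg1 gi1.
have li1 : lebesgue_measure.-integrable setT (EFin \o g1).
  rewrite /g1 -restrict_EFin; apply: (integrable_mkcond _ _).1; first exact: measurable_itv.
  apply: eq_integrable li; first exact: measurable_itv.
  by move=> x xab; rewrite /= /g1 patchE xab.
have loc : locally_integrable setT g1.
  apply: open_integrable_locally => //; exact: openT.
have := @FTC1 R g1 (BRight a) _ loc.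
have H : forall y, lebesgue_measure.-integrable [set` Interval (BRight a) (BRight y)] (EFin \o g1).
  by move=> y; apply: integrableS li1 => //; exact: measurable_itv.
move=> /(_ H) [N [mN N0 NH]].
have [N1 [mN1 N10 NH1]] := gg1.
exists (N `|` N1); split.
- by apply: measurableU => //; exact: borel_leb.
- by rewrite null_set_setU//; exact: borel_leb.
move=> x /= /not_implyP[]; rewrite in_itv/= => /andP[ax xb] nd.
apply: contrapT => /not_orP[Nx N1x]; apply: nd.
have gx : g x = g1 x.
  apply: contrapT => h; apply: N1x; apply: NH1 => /= K; apply: h; apply: K.
  by rewrite /seg/= in_itv/= ax ltW.
have [D1 D2] : derivable (fun z => \int[lebesgue_measure]_(t in `]a, z]) g1 t) x 1 /\
   derive1 (fun z => \int[lebesgue_measure]_(t in `]a, z]) g1 t) x = g1 x.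
  by apply: contrapT => h; apply: Nx; apply: NH => /= K; apply: h; apply: K; exact: ax.
have D : is_derive x 1 (fun z => \int[lebesgue_measure]_(t in `]a, z]) g1 t) (g x).
  by apply: DeriveDef => //; rewrite gx -D2 derive1E.
apply: near_eq_is_derive D.
near=> z.
have az : a <= z by apply: ltW; near: z; exact: lt_nbhsr.
have zb : z <= b by apply: ltW; near: z; exact: lt_nbhsl.
have [_ <-] := itg_borel mg1 (itgbleS (lexx a) zb gi1).
apply: eq_itg_ae; [exact: itgbleS (lexx a) zb gi1|exact: itgbleS (lexx a) zb gi|].
apply: ae_in_sub gg1; last by move=> t _ h; exact: esym.
move=> t; rewrite /seg/= !in_itv/= => /andP[-> tz].
exact: le_trans zb.
Unshelve. all: by end_near. Qed.

End absolute_continuity.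

(** * Differentiability, and recovering a function from its a.e. derivative *)

Section derivatives.
Context {R : realType}.
Implicit Types (x y z a b c e r : R) (f g h u v D : R -> R).

(** Free of quotients, so that [y = x] is included and estimates can simply be added. *)
Lemma is_derive_epsP f x l : is_derive x 1 f l <->
  forall e, 0 < e -> exists2 r, 0 < r &
    forall y, `|y - x| < r -> `|f y - f x - l * (y - x)| <= e * `|y - x|.
Proof.
pose q (h : R) : R := h^-1 *: (f (h *: 1 + x) - f x).
have qE y : y != x -> q (y - x) = (y - x)^-1 * (f y - f x).
  by move=> yx; rewrite /q scaler1 subrK.
have key e y : y != x -> (`|l - q (y - x)| <= e) = (`|f y - f x - l * (y - x)| <= e * `|y - x|).
  move=> yx; have yx0 : 0 < `|y - x| by rewrite normr_gt0 subr_eq0.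
  rewrite -(ler_pM2r yx0) -normrM qE//.
  rewrite (_ : (l - _) * _ = - (f y - f x - l * (y - x))) ?normrN//.
  by field; rewrite subr_eq0.
split=> [[D1 D2]|H].
- move=> e e0.
  have : q h @[h --> 0^'] --> l by rewrite -D2; exact: D1.
  move=> /cvgrPdist_le/(_ _ e0)/nbhs_ballP[r /= r0 Hr]; exists r => // y yr.
  have [->|yx] := eqVneq y x; first by rewrite !subrr mulr0 subrr normr0 mulr0.
  rewrite -key//; apply: Hr; last by rewrite subr_eq0.
  by rewrite /ball/= sub0r normrN.
- have Q : q h @[h --> 0^'] --> l.
    apply/cvgrPdist_le => e e0; have [r r0 Hr] := H _ e0.
    apply/nbhs_ballP; exists r => //= h; rewrite /ball/= sub0r normrN => hr h0.
    have := key e (h + x); rewrite addrK => -> //.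
      by have := Hr (h + x); rewrite addrK; apply.
    by rewrite -subr_eq0 addrK.
  apply: DeriveDef.
  - by apply/cvg_ex; exists l.
  - exact/cvg_lim.
Qed.

(** Outer regularity is applied to a Borel null set containing [N], supplied by [leb_borel_core]. *)
Lemma leb_null_cover (N : set (lebesgueType R)) e : measurable N -> leb R N = 0 ->
  0 < e -> exists U : set R, [/\ open U, N `<=` U & (leb R U < e%:E)%E].
Proof.
move=> mN N0 e0; have [B [M [mB mM M0 NB]]] := leb_borel_core mN.
have mBM : measurable (B `|` M) by exact: measurableU.
have BM0 : lebesgue_measure (B `|` M) = 0.
  rewrite -leb_borel; apply: (@subset_measure0 _ _ _ (leb R) _ (N `|` M)).
  - exact: borel_leb.
  - by apply: measurableU => //; exact: borel_leb.
  - move=> x [Bx|]; last by right.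
    by have [|Mx] := pselect (M x); [right|left; apply/NB].
  - apply: (@measure_negligible _ _ _ (leb R)).
      by apply: measurableU => //; exact: borel_leb.
    apply: negligibleU; first by exists N; split.
    by exists M; split => //; exact: borel_leb.
have [|U [oU BU Ue]] := lebesgue_regularity_outer mBM _ e0.
  have fin : (lebesgue_measure (B `|` M) < +oo)%E by rewrite BM0.
  exact: fin.
exists U; split => //.
  move=> x Nx; apply: BU; have [|Mx] := pselect (M x); first by right.
  by left; apply/NB.
rewrite leb_borel -(setDUK BU).
rewrite measureU//; last by apply/seteqP; split => // x [? []].
  by rewrite [X in (X + _)%E]BM0 add0e.
by apply: measurableD => //; exact: open_measurable.
Qed.

(** The total length of the intervals is controlled by the open set [U] containing them. The list
    runs from right to left because the Cousin argument puts each new interval in front. *)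
Lemma abs_continuous_seq a b D e d (U : set R) (s : seq (R * R)) : 0 < e ->
  (forall (n : nat) (A B : 'I_n -> R),
      (forall i, a <= A i /\ A i <= B i /\ B i <= b) ->
      trivIset [set: 'I_n] (fun i => `]A i, B i[%classic) ->
      \sum_(i < n) (B i - A i) < d ->
      \sum_(i < n) `|D (B i) - D (A i)| < e) ->
  open U -> (leb R U < d%:E)%E ->
  (forall p, p \in s -> [/\ a <= p.1, p.1 <= p.2, p.2 <= b & `]p.1, p.2[ `<=` U]) ->
  pairwise (fun p q => q.2 <= p.1) s ->
  \sum_(p <- s) `|D p.2 - D p.1| < e.
Proof.
move=> e0 acD oU Ud Hs prw.
pose A (i : 'I_(size s)) := (nth (0, 0) s i).1.
pose B (i : 'I_(size s)) := (nth (0, 0) s i).2.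
have AB i : [/\ a <= A i, A i <= B i, B i <= b & `]A i, B i[ `<=` U].
  by apply: Hs; exact: mem_nth.
have tr : trivIset [set: 'I_(size s)] (fun i => `]A i, B i[%classic).
  have lt_disj (i j : 'I_(size s)) : (i < j)%N -> B j <= A i.
    by move=> ij; have /(pairwiseP (0,0)) := prw; apply => //; rewrite inE.
  move=> i j _ _ [t] [] /=; rewrite !in_itv/= => /andP[ait tbi] /andP[ajt tbj].
  apply/val_inj => /=; case: (ltngtP i j) => // /lt_disj h.
    by move: (lt_trans (lt_le_trans tbj h) ait); rewrite ltxx.
  by move: (lt_trans (lt_le_trans tbi h) ajt); rewrite ltxx.
rewrite (big_nth (0, 0)) big_mkord; apply: acD => //.
  by move=> i; have [] := AB i.
rewrite -lte_fin -sumEFin; apply: le_lt_trans Ud.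
rewrite (eq_bigr (fun i => leb R `]A i, B i[%classic)); last first.
  move=> i _; rewrite -[LHS]/((B i - A i)%:E) leb_borel lebesgue_measure_itv/= lte_fin.
  have [_ AiBi _ _] := AB i.
  have [<-|neq] := eqVneq (A i) (B i); first by rewrite ltxx subrr.
  by rewrite lt_neqAle neq AiBi EFinB.
rewrite -measure_bigsetU_ord//; last by move=> i; apply: borel_leb; exact: measurable_itv.
rewrite le_measure// ?inE.
- by apply: bigsetU_measurable => i _; apply: borel_leb; exact: measurable_itv.
- by apply: borel_leb; exact: open_measurable.
- elim/big_ind : _ => //; first by move=> X Y hX hY t [/hX|/hY].
  by move=> i _; case: (AB i).
Qed.

(* Cousin-type argument: intervals around points of differentiability contribute
   at most [e * (b - a)], and the others lie in an open set of small measure. *)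
Lemma abs_continuous_deriv0 a b D : a <= b -> abs_continuous a b D ->
  ae_in `]a, b[ (fun x => is_derive x 1 D 0) -> D b = D a.
Proof.
rewrite le_eqVlt => /predU1P[->//|ab] acD aeD.
suff H e : 0 < e -> `|D b - D a| <= e * (b - a) + e.
  apply/eqP; rewrite -subr_eq0 -normr_le0.
  apply/ler_addgt0Pl => e e0; rewrite addr0.
  have ba : 0 < b - a + 1 by lra.
  have := H (e / (b - a + 1)) (divr_gt0 e0 ba).
  by rewrite (_ : e / _ * (b - a) + _ = e)//; field; exact: lt0r_neq0.
move=> e0; have [d d0 acd] := acD e e0.
have [N [mN N0 aeN]] := aeD.
(* The end points count as exceptional, since differentiability is assumed only inside. *)
pose N' : set (lebesgueType R) := N `|` [set a; b].
have mab : measurable ([set a; b] : set (lebesgueType R)).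
  by apply: borel_leb; apply: measurableU; exact: measurable_set1.
have [|||U [oU N'U Ud]] := @leb_null_cover N' d.
- exact: measurableU.
- rewrite null_set_setU// leb_borel measureU0//; try exact: measurable_set1.
  + exact: lebesgue_measure_set1.
  + exact: lebesgue_measure_set1.
- by [].
pose ok (x : R) (s : seq (R * R)) :=
  (forall p, p \in s -> [/\ a <= p.1, p.1 <= p.2, p.2 <= x & `]p.1, p.2[ `<=` U]) /\
  pairwise (fun p q => q.2 <= p.1) s.
pose P x := exists2 s, ok x s &
  `|D x - D a| <= e * (x - a) + \sum_(p <- s) `|D p.2 - D p.1|.
suff Pb : P b.
  have [s [s1 s2] s3] := Pb; apply: le_trans s3 _; rewrite lerD2l ltW//.
  exact: (abs_continuous_seq e0 acd oU Ud s1 s2).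
pose S := [set x | [/\ a <= x, x <= b & P x]].
have Sa : S a.
  split => //; first exact: ltW.
  by exists [::] => //; rewrite !subrr normr0 mulr0 big_nil addr0.
have supS : has_sup S by split; [exists a|exists b => x []].
pose s := sup S.
have as' : a <= s by apply: ub_le_sup => //; exact: supS.2.
have sb : s <= b by apply: ge_sup; [exists a|move=> x []].
have step : exists2 r, 0 < r & forall x y, a <= x -> x <= s -> s <= y -> y <= b ->
    s - r < x -> y < s + r -> P x -> P y.
  (* If the supremum [s] lies in [U], a short interval around it joins the list; otherwise the
     derivative at [s] is 0, and slope [e] pays for the increment on both sides of [s]. *)
  have [Us|nUs] := pselect (U s).
    have /nbhs_ballP[r /= r0 rU] := open_nbhs_nbhs (conj oU Us).
    exists r => // x y ax xs sy yb srx ysr [l [l1 l2] l3].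
    exists ((x, y) :: l); first split.
    - move=> p; rewrite inE => /predU1P[->/=|pl].
        split => //; first exact: le_trans sy.
        move=> t; rewrite /= in_itv/= => /andP[xt ty]; apply: rU.
        by rewrite /ball/= ltr_distlC; apply/andP; split; lra.
      have [p1 p2 p3 p4] := l1 p pl; split => //.
      by apply: le_trans p3 _; exact: le_trans sy.
    - rewrite pairwise_cons l2 andbT; apply/allP => p pl /=.
      by have [] := l1 p pl.
    - rewrite big_cons/=; have := ler_normD (D y - D x) (D x - D a).
      rewrite (_ : D y - D x + _ = D y - D a); last by ring.
      have : e * (x - a) <= e * (y - a) by rewrite ler_pM2l//; lra.
      by move: l3; lra.
  have sab : s \in `]a, b[.
    rewrite in_itv/=; apply/andP; split; rewrite lt_neqAle ?as' ?sb andbT;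
      apply/eqP => h; apply: nUs; apply: N'U; right => /=; [left|right] => //.
  have Ds : is_derive s 1 D 0.
    apply: contrapT => h; apply: nUs; apply: N'U; left; apply: aeN => /=.
    by move=> K; apply: h; exact: K.
  have [r r0 Hr] := (is_derive_epsP D s 0).1 Ds e e0.
  exists r => // x y ax xs sy yb srx ysr [l [l1 l2] l3].
  exists l; first split => //.
    move=> p pl; have [p1 p2 p3 p4] := l1 p pl; split => //.
    by apply: le_trans p3 _; exact: le_trans sy.
  have hy : `|D y - D s| <= e * (y - s).
    have := Hr y; rewrite mul0r subr0 (ger0_norm (_ : 0 <= y - s)) ?subr_ge0//.
    by apply; lra.
  have hx : `|D x - D s| <= e * (s - x).
    have := Hr x; rewrite mul0r subr0 distrC (ger0_norm (_ : 0 <= s - x)) ?subr_ge0// distrC.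
    by apply; lra.
  have := ler_normD (D y - D s) (D s - D x).
  have := ler_normD (D y - D x) (D x - D a).
  rewrite (_ : D y - D x + _ = D y - D a); last by ring.
  rewrite (_ : D y - D s + _ = D y - D x); last by ring.
  rewrite (distrC (D s)).
  have -> : e * (y - a) = e * (y - s) + e * (s - x) + e * (x - a) by ring.
  by move: l3 hx hy; lra.
have [r r0 Hr] := step.
have [x Sx sx] := sup_adherent r0 supS.
have xs : x <= s by apply: ub_le_sup => //; exact: supS.2.
have Ps : P s by apply: (Hr x s) => //; [by case: Sx|lra|by case: Sx].
move: sb; rewrite le_eqVlt => /predU1P[<-//|sltb]; exfalso.
pose y := Num.min b (s + r / 2).
have sy : s < y by rewrite /y lt_min sltb/= ltrDl divr_gt0.
have yb : y <= b by rewrite /y ge_min lexx.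
have yr : y < s + r by apply: (@le_lt_trans _ _ (s + r / 2)); [rewrite /y ge_min lexx orbT|lra].
have Sy : S y.
  split => //; first lra.
  by apply: (Hr s y) => //; [exact: ltW|lra].
have : y <= s by apply: ub_le_sup => //; exact: supS.2.
by rewrite leNgt sy.
Qed.

Lemma abs_continuousB a b u v : abs_continuous a b u -> abs_continuous a b v ->
  abs_continuous a b (fun x => u x - v x).
Proof.
move=> acu acv e e0; have e2 : 0 < e / 2 by rewrite divr_gt0.
have [d1 d10 H1] := acu _ e2; have [d2 d20 H2] := acv _ e2.
exists (Num.min d1 d2); first by rewrite lt_min d10.
move=> n A B AB tAB; rewrite lt_min => /andP[s1 s2].
have := H1 n A B AB tAB s1; have := H2 n A B AB tAB s2 => h2 h1.
apply: (@le_lt_trans _ _ (\sum_(i < n) (`|u (B i) - u (A i)| + `|v (B i) - v (A i)|))).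
  apply: ler_sum => i _; rewrite -(normrN (v _ - _)).
  rewrite (_ : u (B i) - _ - _ = u (B i) - u (A i) + - (v (B i) - v (A i))) ?ler_normD//.
  by ring.
by rewrite big_split/=; lra.
Qed.

Lemma abs_continuousS a b c d u : a <= c -> d <= b -> abs_continuous a b u ->
  abs_continuous c d u.
Proof.
move=> ac db acu e e0; have [r r0 H] := acu e e0; exists r => // n A B AB.
apply: H => i; have [cA [ABi Bd]] := AB i.
by split; [exact: le_trans cA|split => //; exact: le_trans db].
Qed.

(** After subtracting the primitive of [w], an absolutely continuous function with derivative 0 a.e.
    remains. *)
Lemma abs_continuous_itg_deriv a b v w : abs_continuous a b v -> itgble a b w ->
  ae_in `]a, b[ (fun x => is_derive x 1 v (w x)) ->
  forall x y, a <= x -> x <= y -> y <= b -> v y - v x = itg x y w.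
Proof.
move=> acv wi dv x y ax xy yb.
have wi' : itgble x y w by exact: itgbleS wi.
pose W z := itg x z w.
have WE p q : x <= p -> p <= q -> q <= y -> W q - W p = itg p q w.
  move=> xp pq qy; rewrite /W (@itg_cat _ x p q)//; first by ring.
  exact: itgbleS wi'.
have acW : abs_continuous x y W by exact: abs_continuous_itg WE.
have : (fun z => v z - W z) y = (fun z => v z - W z) x.
  apply: (@abs_continuous_deriv0 x y (fun z => v z - W z)) => //.
    by apply: abs_continuousB => //; exact: abs_continuousS acv.
  apply: (@ae_in2 _ _ (fun t => is_derive t 1 v (w t)) (fun t => is_derive t 1 W (w t))).
  - move=> t _ h1 h2; rewrite -[X in is_derive _ _ _ X](subrr (w t)).
    exact: is_deriveB.
  - apply: ae_in_sub dv => // t; rewrite /= !in_itv/= => /andP[xt ty].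
    by rewrite (le_lt_trans ax xt) (lt_le_trans ty yb).
  - exact: itg_derivable.
by rewrite /= {2}/W itgg /W; lra.
Qed.

End derivatives.

(** * Integrated equations, limits and step functions *)

Section W21.
Context {R : realType}.
Implicit Types (x y z a b c d e r s t L : R) (f g h u v D : R -> R).

(* The equation u'' = g with u' = v, in integrated form. *)
Definition W21 a b u v g := [/\ itgble a b g,
  forall x y, a <= x -> x <= y -> y <= b -> v y - v x = itg x y g &
  forall x y, a <= x -> x <= y -> y <= b -> u y - u x = itg x y v].

Lemma eq_itg a b f g : (forall t, a < t -> t <= b -> f t = g t) ->
  itg a b f = itg a b g.
Proof.
move=> fg; apply: eq_Rintegral => t /set_mem; rewrite /seg/= in_itv/= => /andP[].
exact: fg.
Qed.

Lemma itgble_cat a b c g : a <= b -> b <= c -> itgble a b g -> itgble b c g ->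
  itgble a c g.
Proof.
move=> ab bc g1 g2.
have segU : seg a c = seg a b `|` seg b c by rewrite /seg -itv_bndbnd_setU.
have restr (D : set (lebesgueType R)) : D `<=` seg a c -> measurable D ->
    (leb R).-integrable D (EFin \o g) -> itgble a c (g \_ D).
  move=> Dac mD gD; have h := (@integrable_mkcond _ _ _ (leb R) D (EFin \o g) mD).1 gD.
  rewrite restrict_EFin in h; exact: (integrableS _ _ _ h).
pose g' t := (g \_ (seg a b)) t + (g \_ (seg b c)) t.
apply: (@itgble_ae _ _ _ g').
  apply: itgbleD; apply: restr => //.
  - by rewrite segU; exact: subsetUl.
  - by rewrite segU; exact: subsetUr.
apply: ae_inW => t; rewrite /g' !patchE segU => -[] /[dup] h /mem_set ->.
  rewrite memNset ?addr0// /seg/= in_itv/= => /andP[bt _].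
  by move: h; rewrite /seg/= in_itv/= => /andP[_]; rewrite leNgt bt.
rewrite memNset ?add0r// /seg/= in_itv/= => /andP[_ tb].
by move: h; rewrite /seg/= in_itv/= => /andP[]; rewrite ltNge tb.
Qed.

Lemma cvgn_dist (u : nat -> R) (l : R) : (forall e, 0 < e -> exists N, forall n, (N <= n)%N ->
  `|u n - l| <= e) -> u @ \oo --> l.
Proof.
move=> H; apply/cvgrPdist_le => e e0; have [N HN] := H e e0.
by exists N => // n /= Nn; rewrite distrC; exact: HN.
Qed.

Lemma dist_cvgn (u : nat -> R) (l : R) e : u @ \oo --> l -> 0 < e ->
  exists N, forall n, (N <= n)%N -> `|u n - l| <= e.
Proof.
move=> /cvgrPdist_le ul e0; have [N _ HN] := ul e e0.
by exists N => n Nn; rewrite distrC; exact: HN.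
Qed.

Lemma cvgn_div (u : nat -> R) (l C : R) : (forall n, `|u n - l| <= C / n.+1%:R) ->
  u @ \oo --> l.
Proof.
move=> H; apply: cvgn_dist => e e0.
have C0 : 0 <= C by have := le_trans (normr_ge0 _) (H 0%N); rewrite divr1.
exists (Num.bound (C / e)) => n Nn; apply: le_trans (H n) _.
rewrite ler_pdivrMr// mulrC -ler_pdivrMr//.
apply: (le_trans (ltW (archi_boundP (divr_ge0 C0 (ltW e0))))).
by rewrite ler_nat; exact: leq_trans (leqnSn _).
Qed.

Lemma continuous_seq f x (s : nat -> R) : {for x, continuous f} ->
  s @ \oo --> x -> f (s n) @[n --> \oo] --> f x.
Proof. by move=> fx sx; apply: cvg_comp sx fx. Qed.

Lemma cvgn_le (u : nat -> R) (l b : R) : u @ \oo --> l -> (forall n, u n <= b) -> l <= b.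
Proof. by move=> ul ub; apply: (cvgr_to_le ul); exact: nearW. Qed.

Lemma cvgn_ge (u : nat -> R) (l b : R) : u @ \oo --> l -> (forall n, b <= u n) -> b <= l.
Proof. by move=> ul ub; apply: (cvgr_to_ge ul); exact: nearW. Qed.

(** Along an ultrafilter every bounded family converges, so limits at all points exist at once,
    without Ascoli's theorem or a diagonal sequence. *)
Lemma ultra_lim (T : Type) (G : set_system T) (f : T -> R) (M : R) : UltraFilter G ->
  (forall j, `|f j| <= M) -> exists2 l, `|l| <= M & f j @[j --> G] --> l.
Proof.
move=> GU fM.
have GP : ProperFilter (f @ G) by apply: fmap_proper_filter; exact: ultra_proper.
have [|l [lM lcl]] := @segment_compact R (- M) M (f @ G) GP.
  rewrite /fmap/=; apply: (@filterS _ G _ setT); last exact: filterT.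
  by move=> j _ /=; rewrite in_itv/= -ler_norml.
exists l; first by move: lM; rewrite /= in_itv/= ler_norml.
move=> B Bl; rewrite /fmap/=.
have [//|GnB] := in_ultra_setVsetC (f @^-1` B) GU.
have [||z [zB]] := lcl (~` B) B => //.
Qed.

(** The value is [U i] between [i * h] and [i.+1 * h], with the right end included as in [seg]; the
    base value 0 is reached for [t <= 0]. *)
Fixpoint stepf (U : nat -> R) (h : R) (k : nat) t : R :=
  if k is k'.+1 then (if t <= k'%:R * h then stepf U h k' t else U k') else 0.

Lemma stepfE U (h : R) k i t : 0 < h -> (i < k)%N -> i%:R * h < t -> t <= i.+1%:R * h ->
  stepf U h k t = U i.
Proof.
move=> h0; elim: k => // k IH ik it ti /=.
case: ifPn => tk.
  apply: IH => //; have := lt_le_trans it tk.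
  by rewrite ltr_pM2r// ltr_nat.
have : k%:R * h < i.+1%:R * h by rewrite -ltNge in tk; exact: lt_le_trans ti.
rewrite ltr_pM2r// ltr_nat ltnS => ki; congr U; apply/eqP.
by rewrite eqn_leq ki -ltnS.
Qed.

Lemma cell_ex (h : R) (k : nat) t : 0 < h -> 0 < t -> t <= k%:R * h ->
  exists i, [/\ (i < k)%N, i%:R * h < t & t <= i.+1%:R * h].
Proof.
move=> h0 t0; elim: k => [|k IH] tk.
  by move: (lt_le_trans t0 tk); rewrite mul0r ltxx.
have [/IH[i [ik i1 i2]]|kt] := leP t (k%:R * h); first by exists i; split => //; exact: ltnW.
by exists k.
Qed.

Lemma stepf_le U (h : R) k t (M : R) : 0 <= M -> (forall i, (i < k)%N -> `|U i| <= M) ->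
  `|stepf U h k t| <= M.
Proof.
move=> M0; elim: k => [|k IH] H /=; first by rewrite normr0.
case: ifPn => _; last exact: H.
by apply: IH => i ik; apply: H; exact: ltnW.
Qed.

End W21.

(** * A Kneser-type theorem *)

Section kneser.
Context {R : realType}.
(** The parameter enters both the nonlinearity [F] and the initial slope [A]: the linear problem
    below varies the former, the final shooting the latter. *)
Variables (L : R) (F : R -> R -> R -> R) (gamma A : R -> R).
Hypothesis L0 : 0 < L.
Hypothesis gi : itgble 0 L gamma.
Hypothesis Fm : forall la s, measurable_fun (seg 0 L) (F la ^~ s).
Hypothesis Fb : ae_in (seg 0 L) (fun t => forall la s, `|F la t s| <= gamma t).
Hypothesis Fc : ae_in (seg 0 L) (fun t =>
  forall (la s : nat -> R) (la' s' : R), la @ \oo --> la' -> s @ \oo --> s' ->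
    F (la n) t (s n) @[n --> \oo] --> F la' t s').
Hypothesis Ac : continuous A.

Let Gam := itg 0 L gamma.
Let h (n : nat) : R := L / n.+1%:R.

Local Lemma h0 n : 0 < h n. Proof. by rewrite divr_gt0. Qed.

Local Lemma hn n : n.+1%:R * h n = L.
Proof. by rewrite mulrC divfK. Qed.

Local Lemma khL n k : (k <= n.+1)%N -> k%:R * h n <= L.
Proof. by move=> kn; rewrite -[leRHS](hn n) ler_pM2r ?h0// ler_nat. Qed.

Local Lemma khS n k : k%:R * h n <= k.+1%:R * h n.
Proof. by rewrite ler_pM2r ?h0// ler_nat. Qed.

Local Lemma kh0 n k : 0 <= k%:R * h n.
Proof. by rewrite mulr_ge0// ltW// h0. Qed.

(* Euler scheme for u' = v, v' = - F la t u; the second equation is integrated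
   exactly over each step because F is only integrable in t. *)
Fixpoint euler n (la : R) k : R * R :=
  if k is k'.+1 then
    let: (u, v) := euler n la k' in
    (u + h n * v, v - itg (k'%:R * h n) (k'.+1%:R * h n) (fun t => F la t u))
  else (0, A la).

Let U n (la : R) k := (euler n la k).1.
Let V n (la : R) k := (euler n la k).2.

Local Lemma US n (la : R) k : U n la k.+1 = U n la k + h n * V n la k.
Proof. by rewrite /U /V /=; case: (euler n la k). Qed.

Local Lemma VS n (la : R) k : V n la k.+1 =
  V n la k - itg (k%:R * h n) (k.+1%:R * h n) (fun t => F la t (U n la k)).
Proof. by rewrite /U /V /=; case: (euler n la k). Qed.

(** Interpolants frozen at the left node of each cell. With them the scheme is exact: [UE] and [VE]
    express the node values through integrals of [z] and [g]. *)
Let w n la t := stepf (U n la) (h n) n.+1 t.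
Let z n la t := stepf (V n la) (h n) n.+1 t.
Let g n la t := F la t (w n la t).

Local Lemma gamma_ge0 : ae_in (seg 0 L) (fun t => 0 <= gamma t).
Proof. by apply: ae_inS Fb => t _ /(_ 0 0); exact: le_trans. Qed.

Local Lemma Fi (la s : R) : itgble 0 L (F la ^~ s).
Proof. by apply: itgble_le (Fm la s) gi _; apply: ae_inS Fb => t _; exact. Qed.

Local Lemma gcell n (la : R) k : (k < n.+1)%N ->
  itgble (k%:R * h n) (k.+1%:R * h n) (g n la).
Proof.
move=> kn; apply: (@itgble_ae _ _ _ (F la ^~ (U n la k))).
  by apply: itgbleS (Fi la _); [exact: kh0|exact: khL].
apply: ae_inW => t; rewrite /seg/= in_itv/= => /andP[kt tk].
by rewrite /g /w (stepfE _ _ kn kt tk)// h0.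
Qed.

Local Lemma g_itgble n la : itgble 0 L (g n la).
Proof.
have : forall k, (k <= n.+1)%N -> itgble 0 (k%:R * h n) (g n la).
  elim=> [_|k IH kn]; first by rewrite mul0r; exact: itgbleg.
  by apply: itgble_cat (IH (ltnW kn)) (gcell _ kn); [exact: kh0|exact: khS].
by move=> /(_ n.+1 (leqnn _)); rewrite hn.
Qed.

Local Lemma VE n (la : R) k : (k <= n.+1)%N -> V n la k = A la - itg 0 (k%:R * h n) (g n la).
Proof.
elim: k => [_|k IH kn]; first by rewrite mul0r itgg subr0.
rewrite VS (IH (ltnW kn)) (@itg_cat _ 0 (k%:R * h n) (k.+1%:R * h n)) ?kh0 ?khS//.
  rewrite opprD addrA; congr (_ - _); apply: eq_itg => t kt tk.
  by rewrite /g /w (stepfE _ _ kn kt tk)// h0.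
by apply: itgbleS (g_itgble n la) => //; exact: khL.
Qed.

Local Lemma z_itgble n la : itgble 0 L (z n la).
Proof.
have : forall k, (k <= n.+1)%N -> itgble 0 (k%:R * h n) (z n la).
  elim=> [_|k IH kn]; first by rewrite mul0r; exact: itgbleg.
  apply: itgble_cat (IH (ltnW kn)) _; [exact: kh0|exact: khS|].
  apply: (@itgble_ae _ _ _ (fun=> V n la k)); first exact: itgble_cst.
  apply: ae_inW => t; rewrite /seg/= in_itv/= => /andP[kt tk].
  by rewrite /z (stepfE _ _ kn kt tk)// h0.
by move=> /(_ n.+1 (leqnn _)); rewrite hn.
Qed.

Local Lemma UE n (la : R) k : (k <= n.+1)%N -> U n la k = itg 0 (k%:R * h n) (z n la).
Proof.
elim: k => [_|k IH kn]; first by rewrite mul0r itgg.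
rewrite US (IH (ltnW kn)) (@itg_cat _ 0 (k%:R * h n) (k.+1%:R * h n)) ?kh0 ?khS//.
  congr (_ + _); rewrite (@eq_itg _ _ _ _ (fun=> V n la k)).
    by rewrite itg_cst ?khS// -mulrBl -natrB// subSnn mul1r mulrC.
  move=> t kt tk.
  by rewrite /z (stepfE _ _ kn kt tk)// h0.
by apply: itgbleS (z_itgble n la) => //; exact: khL.
Qed.

Local Lemma itg_g_le n (la x y : R) : 0 <= x -> x <= y -> y <= L ->
  `|itg x y (g n la)| <= itg x y gamma.
Proof.
move=> x0 xy yL; have gxy := itgbleS x0 yL (g_itgble n la).
apply: le_trans (norm_itg gxy) _; apply: le_itg; first exact: itgble_norm.
  exact: itgbleS gi.
apply: ae_in_sub Fb => t; last by move=> _; exact.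
by rewrite /seg/= !in_itv/= => /andP[xt ty]; rewrite (le_lt_trans x0 xt) (le_trans ty).
Qed.

Local Lemma V_le n (la : R) k : (k <= n.+1)%N -> `|V n la k| <= `|A la| + Gam.
Proof.
move=> kn; rewrite VE//; apply: le_trans (ler_normB _ _) _; rewrite lerD2l.
apply: le_trans (itg_g_le _ _ _ _ _) _ => //; [exact: kh0|exact: khL|].
by apply: itg_mono => //; [exact: kh0|exact: khL|exact: gamma_ge0].
Qed.

Local Lemma z_le n (la t M : R) : `|A la| <= M -> `|z n la t| <= M + Gam.
Proof.
move=> AM; apply: stepf_le.
  by rewrite addr_ge0//; [exact: le_trans AM|exact: itg_ge0 gi gamma_ge0].
by move=> i ik; apply: le_trans (V_le _ (ltnW ik)) _; rewrite lerD2r.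
Qed.

Local Lemma zi_le n (la M x y : R) : `|A la| <= M -> 0 <= x -> x <= y -> y <= L ->
  `|itg x y (z n la)| <= (M + Gam) * (y - x).
Proof.
move=> AM x0 xy yL; have zxy := itgbleS x0 yL (z_itgble n la).
apply: le_trans (norm_itg zxy) _; rewrite -itg_cst//; apply: le_itg.
- exact: itgble_norm.
- exact: itgble_cst.
- by apply: ae_inW => t _; exact: z_le.
Qed.

(** The two differ by what accumulates within a single cell, where [z] is bounded by [M + Gam]. *)
Local Lemma wcell n (la x M : R) : `|A la| <= M -> 0 < x -> x <= L ->
  `|w n la x - itg 0 x (z n la)| <= (M + Gam) * h n.
Proof.
move=> AM x0; rewrite -[X in _ <= X](hn n) => xL.
have [i [ik i1 i2]] := cell_ex (h0 n) x0 xL.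
rewrite /w (stepfE _ (h0 n) ik i1 i2) (UE _ (ltnW ik)).
rewrite hn in xL.
rewrite (@itg_cat _ 0 (i%:R * h n) x) ?kh0 ?(ltW i1)//; last first.
  by apply: itgbleS (z_itgble n la).
rewrite opprD addrA subrr add0r normrN.
have MG : 0 <= M + Gam by apply: le_trans (normr_ge0 _) (z_le n 0 AM).
apply: le_trans (zi_le _ AM _ _ _) _ => //; [exact: kh0|exact: ltW|].
rewrite ler_wpM2l// lerBlDl; apply: le_trans i2 _.
by rewrite -natr1 mulrDl mul1r.
Qed.

(** As in [wcell], but within a cell the slope changes by an integral of [gamma], which is small by
    absolute continuity rather than of order [h n]. *)
Local Lemma zcell n (la x e d : R) : 0 < x -> x <= L -> 
  (forall x y, 0 <= x -> x <= y -> y <= L -> y - x < d -> itg x y (fun t => `|gamma t|) < e) ->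
  h n < d ->
  `|z n la x - (A la - itg 0 x (g n la))| <= e.
Proof.
move=> x0; rewrite -[X in _ <= X](hn n) => xL H hd.
have [i [ik i1 i2]] := cell_ex (h0 n) x0 xL.
rewrite /z (stepfE _ (h0 n) ik i1 i2) (VE _ (ltnW ik)).
rewrite hn in xL.
rewrite (@itg_cat _ 0 (i%:R * h n) x) ?kh0 ?(ltW i1)//; last first.
  by apply: itgbleS (g_itgble n la).
rewrite (_ : _ - _ = itg (i%:R * h n) x (g n la)); last by ring.
apply: le_trans (itg_g_le _ _ _ _ _) _ => //; [exact: kh0|exact: ltW|].
have gix : itgble (i%:R * h n) x gamma by apply: itgbleS gi => //; exact: kh0.
apply: (@le_trans _ _ (itg (i%:R * h n) x (fun t => `|gamma t|))).
  by apply: le_itg => //; [exact: itgble_norm|apply: ae_inW => t _; exact: ler_norm].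
apply/ltW/H => //; [exact: kh0|exact: ltW|].
apply: le_lt_trans hd; rewrite lerBlDl; apply: le_trans i2 _.
by rewrite -natr1 mulrDl mul1r.
Qed.

Local Lemma h_cvg (ns : nat -> nat) (d : R) : (forall j, (j <= ns j)%N) -> 0 < d ->
  exists N, forall j, (N <= j)%N -> h (ns j) < d.
Proof.
move=> nsj d0; exists (Num.bound (L / d)) => j Nj.
rewrite /h ltr_pdivrMr// mulrC -ltr_pdivrMr//.
apply: lt_le_trans (archi_boundP (ltW (divr_gt0 L0 d0))) _.
by rewrite ler_nat; apply: leq_trans (leqnSn _); exact: leq_trans (nsj j).
Qed.

(** For fixed [n] there are finitely many steps, and dominated convergence passes to the limit in
    each. This continuity in [la] is what the true initial value problem may lack. *)
Local Lemma euler_cont n k : (k <= n.+1)%N -> forall (las : nat -> R) (la : R),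
  las @ \oo --> la ->
  U n (las j) k @[j --> \oo] --> U n la k /\ V n (las j) k @[j --> \oo] --> V n la k.
Proof.
elim: k => [_ las la lasl|k IH kn las la lasl].
  split; first exact: cvg_cst.
  by apply: (@continuous_seq _ A) => //; exact: Ac.
have [IU IV] := IH (ltnW kn) _ _ lasl; split.
  rewrite US; under eq_fun do rewrite US.
  by apply: cvgD => //; apply: cvgMr.
rewrite VS; under eq_fun do rewrite VS.
apply: cvgB => //.
have sub : seg (k%:R * h n) (k.+1%:R * h n) `<=` seg 0 L.
  move=> t; rewrite /seg/= !in_itv/= => /andP[xt ty].
  by rewrite (le_lt_trans (kh0 n k) xt) (le_trans ty)// khL.
apply: (@itg_dct _ _ _ (fun j t => F (las j) t (U n (las j) k)) _ gamma _ _ _ _).2.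
- by move=> j; apply: measurable_funS (Fm _ _).
- by apply: itgbleS gi; [exact: kh0|exact: khL].
- by apply: ae_in_sub Fc => // t _; apply.
- by apply: ae_in_sub Fb => // t _ Ht j; exact: Ht.
Qed.

Local Lemma w_le n (la t M : R) : `|A la| <= M -> `|w n la t| <= (M + Gam) * L.
Proof.
move=> AM.
have MG : 0 <= M + Gam by apply: le_trans (normr_ge0 _) (z_le n 0 AM).
apply: stepf_le => [|i ik]; first by rewrite mulr_ge0// ltW.
rewrite (UE _ (ltnW ik)); apply: le_trans (zi_le _ AM _ _ _) _ => //.
- exact: kh0.
- exact: (khL (ltnW ik)).
- by rewrite subr0 ler_wpM2l// (khL (ltnW ik)).
Qed.

(** The defect [2 * ((M + Gam) * h n)] disappears as the mesh is refined, so limits of interpolants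
    are Lipschitz. *)
Local Lemma w_lip n (la x y M : R) : `|A la| <= M -> 0 < x -> x <= L -> 0 < y -> y <= L ->
  `|w n la x - w n la y| <= (M + Gam) * `|x - y| + 2 * ((M + Gam) * h n).
Proof.
move=> AM; wlog xy : x y / x <= y.
  move=> W x0 xL y0 yL; have [|/ltW yx] := leP x y; first by move=> ?; apply: W.
  by rewrite distrC (distrC x); apply: W.
move=> x0 xL y0 yL.
have h1 := wcell n AM x0 xL; have h2 := wcell n AM y0 yL.
have h3 := zi_le n AM (ltW x0) xy yL.
have e : itg 0 y (z n la) = itg 0 x (z n la) + itg x y (z n la).
  apply: itg_cat => //; first exact: ltW.
  by apply: itgbleS (z_itgble n la).
rewrite e in h2.
rewrite (distrC x) (ger0_norm (_ : 0 <= y - x)) ?subr_ge0//.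
set a := w n la x in h1 *; set b := w n la y in h2 *.
set p := itg 0 x _ in h1 h2; set q := itg x y _ in h2 h3.
rewrite (_ : a - b = (a - p) - (b - (p + q)) - q); last by ring.
apply: le_trans (ler_normB _ _) _; have := ler_normB (a - p) (b - (p + q)).
by move: h1 h2 h3; set X := (M + Gam) * h n; lra.
Qed.

Definition kneser_sol la (u v : R -> R) :=
  [/\ W21 0 L u v (fun t => - F la t (u t)), u 0 = 0 & v 0 = A la].

(** An ultrafilter limit of the interpolants exists at every point and is Lipschitz. Dominated
    convergence needs a sequence: [phi i] is chosen close to the limit at the nodes of mesh [h i],
    and the Lipschitz bounds extend this to all points. *)
Local Lemma euler_compact (ns : nat -> nat) (las : nat -> R) :
  (forall j, (j <= ns j)%N) -> (forall j, 0 <= las j <= 1) ->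
  exists la u v, [/\ 0 <= la <= 1, kneser_sol la u v &
    exists2 phi : nat -> nat, las (phi i) @[i --> \oo] --> la &
    U (ns (phi i)) (las (phi i)) (ns (phi i)).+1 @[i --> \oo] --> u L].
Proof.
move=> nsj las01.
have [M AM] : exists M, forall j, `|A (las j)| <= M.
  have [||c _ Hc] := @EVT_max R (fun x => `|A x|) 0 1; first exact: ler01.
    by apply: continuous_subspaceT => x; apply: cvg_norm; exact: Ac.
  by exists `|A c| => j; apply: Hc; rewrite in_itv/=; exact: las01.
pose B := M + Gam.
have B0 : 0 <= B by apply: le_trans (normr_ge0 _) (z_le 0%N 0 (AM 0%N)).
have [G [GU sG]] := @ultraFilterLemma nat \oo _.
have GF : ProperFilter G by exact: ultra_proper.
have /choice[u0 Hu0] : forall x, exists l : R, w (ns j) (las j) x @[j --> G] --> l.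
  move=> x; have [|l _ Hl] := @ultra_lim _ _ G (fun j => w (ns j) (las j) x) (B * L) GU.
    by move=> j; exact: w_le.
  by exists l.
have [la _ Hla] : exists2 la, `|la| <= 1 & las j @[j --> G] --> la.
  apply: ultra_lim => j; have /andP[l1 l2] := las01 j.
  by rewrite ger0_norm.
have Gge i : \forall j \near G, (i <= j)%N.
  by apply: sG; exists i.
have u0_lip x y : 0 < x -> x <= L -> 0 < y -> y <= L -> `|u0 x - u0 y| <= B * `|x - y|.
  move=> x0 xL y0 yL; apply/ler_addgt0Pl => e e0.
  have e4 : 0 < e / 4 by rewrite divr_gt0.
  (* [B + 1] in place of [B], which may be 0. *)
  have [N HN] := @h_cvg ns (e / 4 / (B + 1)) nsj (divr_gt0 e4 (ltr_wpDl B0 ltr01)).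
  have hx : \forall j \near G, `|u0 x - w (ns j) (las j) x| <= e / 4.
    by have /cvgrPdist_le := Hu0 x; apply.
  have hy : \forall j \near G, `|u0 y - w (ns j) (las j) y| <= e / 4.
    by have /cvgrPdist_le := Hu0 y; apply.
  have [j [[jx jy] jN]] := filter_ex (filterI (filterI hx hy) (Gge N)).
  have hl := w_lip (ns j) (AM j) x0 xL y0 yL; rewrite -/B in hl.
  have hh : B * h (ns j) <= e / 4.
    have := ltW (HN j jN); rewrite ler_pdivlMr ?ltr_wpDl//.
    have := ltW (h0 (ns j)); set q := h _; nra.
  set a := w _ _ x in jx hl; set b := w _ _ y in jy hl.
  rewrite (_ : u0 x - u0 y = (u0 x - a) - (u0 y - b) + (a - b)); last by ring.
  apply: le_trans (ler_normD _ _) _; have := ler_normB (u0 x - a) (u0 y - b).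
  by move: jx jy hl hh; set X := B * h _; set Y := B * `| _ |; lra.
have /choice[phi Hphi] : forall i, exists j, [/\ (i <= j)%N, `|las j - la| <= 1 / i.+1%:R &
    forall m : 'I_i.+1, `|w (ns j) (las j) (m.+1%:R * h i) - u0 (m.+1%:R * h i)| <= 1 / i.+1%:R].
  move=> i; have i0 : 0 < 1 / i.+1%:R :> R by rewrite divr_gt0.
  have h1 : \forall j \near G, `|la - las j| <= 1 / i.+1%:R.
    by have /cvgrPdist_le := Hla; apply.
  have h2 : \forall j \near G, forall m : 'I_i.+1,
     `|u0 (m.+1%:R * h i) - w (ns j) (las j) (m.+1%:R * h i)| <= 1 / i.+1%:R.
    by apply: filter_forall => m; have /cvgrPdist_le := Hu0 (m.+1%:R * h i); apply.
  have [j [[j1 j2] j3]] := filter_ex (filterI (filterI h1 h2) (Gge i)).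
  by exists j; split => // [|m]; rewrite distrC.
pose n i := ns (phi i); pose lb i := las (phi i).
have ni i : (i <= n i)%N by apply: leq_trans (nsj _); case: (Hphi i).
have hni i : h (n i) <= h i.
  by rewrite /h ler_pM2l// lef_pV2 ?posrE// ler_nat ltnS.
have lbla : lb @ \oo --> la by apply: (@cvgn_div _ _ _ 1) => i; case: (Hphi i).
have la01 : 0 <= la <= 1.
  apply/andP; split.
    by apply: (cvgn_ge lbla) => i; case/andP: (las01 (phi i)).
  by apply: (cvgn_le lbla) => i; case/andP: (las01 (phi i)).
have wu x : 0 < x -> x <= L -> w (n i) (lb i) x @[i --> \oo] --> u0 x.
  (* Moving from [x] to the next node costs [B * h i + 2 * B * h (n i)] for the interpolant and
     [B * h i] for the limit; the summand 1 is the error at the node. *)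
  move=> x0 xL; apply: (@cvgn_div _ _ _ (4 * B * L + 1)) => i.
  have [_ _ Hm] := Hphi i.
  have [|m [mi m1 m2]] := @cell_ex _ (h i) i.+1 x (h0 i) x0; first by rewrite hn.
  have xm0 : 0 < m.+1%:R * h i by rewrite mulr_gt0// h0.
  have xmL : m.+1%:R * h i <= L by exact: khL.
  have := Hm (Ordinal mi); rewrite /= -/(n i) -/(lb i) => h1.
  have h2 := w_lip (n i) (AM (phi i)) x0 xL xm0 xmL.
  have h3 := u0_lip _ _ x0 xL xm0 xmL.
  have xm : `|x - m.+1%:R * h i| <= h i.
    rewrite distrC ger0_norm ?subr_ge0// -natr1 mulrDl mul1r.
    by rewrite lerBlDr addrC lerD2l ltW.
  have bx : B * `|x - m.+1%:R * h i| <= B * h i by rewrite ler_wpM2l.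
  have bn : B * h (n i) <= B * h i by rewrite ler_wpM2l.
  rewrite (_ : (4 * B * L + 1) / _ = 4 * (B * h i) + 1 / i.+1%:R); last first.
    by rewrite /h mulrDl !mulrA.
  rewrite -/B -/(lb i) in h2.
  set a := w _ _ x in h2 *; set b := w _ _ _ in h1 h2; set c := u0 _ in h1 h3.
  rewrite (_ : a - u0 x = (a - b) + (b - c) - (u0 x - c)); last by ring.
  apply: le_trans (ler_normB _ _) _; have := ler_normD (a - b) (b - c).
  move: h1 h2 h3 bx bn; set X := B * `| _ |; set Y := B * h i; set Z := B * h (n i);
    set W := 1 / _ => h1 h2 h3 bx bn h4.
  by lra.
have seg0L t : seg 0 L t -> 0 < t /\ t <= L by rewrite /seg/= in_itv/= => /andP.
have gdct x : 0 <= x -> x <= L -> itgble 0 x (fun t => F la t (u0 t)) /\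
    itg 0 x (g (n i) (lb i)) @[i --> \oo] --> itg 0 x (fun t => F la t (u0 t)).
  move=> x0 xL.
  have sub : seg 0 x `<=` seg 0 L.
    by move=> t; rewrite /seg/= !in_itv/= => /andP[-> tx]; exact: le_trans xL.
  apply: (@itg_dct _ _ _ _ _ gamma).
  - by move=> i; apply: itgble_measurable; apply: itgbleS (g_itgble _ _).
  - exact: itgbleS gi.
  - apply: ae_in_sub Fc => // t /sub/seg0L[t0 tL]; apply => //; exact: wu.
  - by apply: ae_in_sub Fb => // t _ Ht i; exact: Ht.
pose v x := A la - itg 0 x (fun t => F la t (u0 t)).
have zv x : 0 < x -> x <= L -> z (n i) (lb i) x @[i --> \oo] --> v x.
  move=> x0 xL.
  have lim1 : A (lb i) - itg 0 x (g (n i) (lb i)) @[i --> \oo] --> v x.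
    apply: cvgB; last exact: (gdct x (ltW x0) xL).2.
    by apply: (@continuous_seq _ A) => //; exact: Ac.
  apply: cvgn_dist => e e0; have e2 : 0 < e / 2 by rewrite divr_gt0.
  have [N1 HN1] := dist_cvgn lim1 e2.
  have [d d0 Hd] := itg_cont gi e2.
  have [N2 HN2] := @h_cvg n d ni d0.
  exists (maxn N1 N2) => i; rewrite geq_max => /andP[i1 i2].
  have := zcell (lb i) x0 xL Hd (HN2 i i2); have := HN1 i i1.
  set a := z _ _ _; set b := _ - itg _ _ _; set c := v x => q1 q2.
  rewrite (_ : a - c = (a - b) + (b - c)); last by ring.
  by apply: le_trans (ler_normD _ _) _; lra.
have zdct x : 0 <= x -> x <= L -> itgble 0 x v /\
    itg 0 x (z (n i) (lb i)) @[i --> \oo] --> itg 0 x v.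
  move=> x0 xL.
  have sub : seg 0 x `<=` seg 0 L.
    by move=> t; rewrite /seg/= !in_itv/= => /andP[-> tx]; exact: le_trans xL.
  apply: (@itg_dct _ _ _ _ _ (fun=> B)).
  - by move=> i; apply: itgble_measurable; apply: itgbleS (z_itgble _ _).
  - exact: itgble_cst.
  - by apply: ae_inW => t /sub/seg0L[t0 tL]; exact: zv.
  - by apply: ae_inW => t _ i; apply: z_le; exact: AM.
(* [u0] is only a pointwise limit; [u] is the same function for [0 < x <= L], written as a
   primitive. *)
pose u x := itg 0 x v.
have uu0 x : 0 < x -> x <= L -> u x = u0 x.
  move=> x0 xL; have l1 := (zdct x (ltW x0) xL).2; have l2 := wu x x0 xL.
  have l3 : itg 0 x (z (n i) (lb i)) @[i --> \oo] --> u0 x.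
    have : w (n i) (lb i) x - (w (n i) (lb i) x - itg 0 x (z (n i) (lb i))) @[i --> \oo]
        --> u0 x - 0.
      apply: cvgB => //; apply: (@cvgn_div _ _ _ (B * L)) => i.
      rewrite subr0; apply: le_trans (wcell _ (AM (phi i)) x0 xL) _.
      by rewrite -mulrA ler_wpM2l.
    by rewrite subr0; under eq_fun do rewrite opprB addrC subrK.
  by have := cvg_unique _ l1 l3; apply; exact: Rhausdorff.
have gub x y : 0 <= x -> y <= L -> itgble x y (fun t => F la t (u t)).
  move=> x0 yL; apply: (@itgble_ae _ _ _ (fun t => F la t (u0 t))).
    by apply: itgbleS (gdct L (ltW L0) (lexx L)).1.
  apply: ae_inW => t; rewrite /seg/= in_itv/= => /andP[xt ty].
  by rewrite uu0//; [exact: le_lt_trans xt|exact: le_trans yL].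
have gu0 x y : 0 <= x -> y <= L -> itg x y (fun t => F la t (u0 t)) =
    itg x y (fun t => F la t (u t)).
  move=> x0 yL; apply: eq_itg => t xt ty.
  by rewrite uu0//; [exact: le_lt_trans xt|exact: le_trans yL].
exists la, u, v; split => //; first split.
- split.
  + exact/itgbleN/gub.
  + move=> x y x0 xy yL; rewrite itgN; last exact: gub.
    rewrite /v (@itg_cat _ 0 x y)//; last by apply: itgbleS (gdct L (ltW L0) (lexx L)).1.
    by rewrite (gu0 x y x0 yL); ring.
  + move=> x y x0 xy yL; rewrite /u (@itg_cat _ 0 x y)//; first by ring.
    by apply: itgbleS (zdct L (ltW L0) (lexx L)).1.
- by rewrite /u itgg.
- by rewrite /v itgg subr0.
exists phi; first exact: lbla.
have := (zdct L (ltW L0) (lexx L)).2; rewrite -/(u L).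
suff -> : (fun i => itg 0 L (z (n i) (lb i))) =
    (fun i => U (ns (phi i)) (las (phi i)) (ns (phi i)).+1) by [].
by apply/funext => i; rewrite UE// hn.
Qed.

(** Strict signs are required of all solutions at the end parameters because the limits of Euler
    schemes cannot be chosen. Arbitrarily fine schemes with the wrong sign would converge to a
    solution violating the strict one; so for large [n] the intermediate value theorem applies to
    the scheme, and [euler_compact] to the parameters it finds. *)
Lemma kneser : (forall u v, kneser_sol 0 u v -> 0 < u L) ->
  (forall u v, kneser_sol 1 u v -> u L < 0) ->
  exists la u v, [/\ 0 <= la <= 1, kneser_sol la u v & u L = 0].
Proof.
move=> H0 H1.
have [n0 Hn0] : exists n0, forall n, (n0 <= n)%N -> 0 <= U n 0 n.+1.
  apply: contrapT => /forallNP nH.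
  have /choice[ns Hns] : forall j, exists m : nat, (j <= m)%N /\ U m 0 m.+1 < 0.
    move=> j; apply: contrapT => /forallNP jH; apply: (nH j) => m jm.
    by have := jH m; case: leP => // um []; split.
  have [|_|la [u [v [_ sol [phi la0 ul]]]]] := @euler_compact ns (fun=> 0).
  - by move=> j; case: (Hns j).
  - by rewrite lexx ler01.
  have la_eq : la = 0 by apply: (cvg_unique _ la0 (cvg_cst _)); exact: Rhausdorff.
  rewrite la_eq in sol; have := H0 _ _ sol; rewrite ltNge => /negP; apply.
  apply: (cvgn_le ul) => i.
  by case: (Hns (phi i)) => _ /ltW.
have [n1 Hn1] : exists n1, forall n, (n1 <= n)%N -> U n 1 n.+1 <= 0.
  apply: contrapT => /forallNP nH.
  have /choice[ns Hns] : forall j, exists m : nat, (j <= m)%N /\ 0 < U m 1 m.+1.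
    move=> j; apply: contrapT => /forallNP jH; apply: (nH j) => m jm.
    by have := jH m; case: leP => // um []; split.
  have [|_|la [u [v [_ sol [phi la1 ul]]]]] := @euler_compact ns (fun=> 1).
  - by move=> j; case: (Hns j).
  - by rewrite lexx ler01.
  have la_eq : la = 1 by apply: (cvg_unique _ la1 (cvg_cst _)); exact: Rhausdorff.
  rewrite la_eq in sol; have := H1 _ _ sol; rewrite ltNge => /negP; apply.
  apply: (cvgn_ge ul) => i.
  by case: (Hns (phi i)) => _ /ltW.
pose ns j := maxn j (maxn n0 n1).
have /choice[las Hlas] : forall j, exists la : R, 0 <= la <= 1 /\ U (ns j) la (ns j).+1 = 0.
  move=> j.
  have [|||la la01 Ula] := @IVT R (fun la => U (ns j) la (ns j).+1) 0 1 0.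
  - exact: ler01.
  - apply: continuous_subspaceT => x; apply/(@cvg_nbhsP _ R^o) => las lasx.
    exact: (euler_cont (leqnn _) lasx).1.
  - rewrite ge_min le_max; apply/andP; split; apply/orP; [right|left].
      by apply: Hn1; rewrite /ns !leq_max leqnn !orbT.
    by apply: Hn0; rewrite /ns !leq_max leqnn !orbT.
  - by exists la; split => //; move: la01; rewrite in_itv.
have [||la [u [v [la01 sol [phi _ ul]]]]] := @euler_compact ns las.
- by move=> j; rewrite /ns leq_max leqnn.
- by move=> j; case: (Hlas j).
exists la, u, v; split => //; apply/eqP; rewrite eq_le; apply/andP; split.
  apply: (cvgn_le ul) => i.
  by case: (Hlas (phi i)) => _ ->.
apply: (cvgn_ge ul) => i.
by case: (Hlas (phi i)) => _ ->.
Qed.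

End kneser.

(** * Gronwall estimates and comparison *)

Section cont_on.
Context {R : realType}.
Implicit Types (x y z a b c d e r s t L : R) (f g h u v : R -> R).

(** Continuity relative to the closed interval, one-sided at its ends; in this form restriction to
    subintervals and reflection are elementary. *)
Definition cont_on a b f := forall x e, a <= x -> x <= b -> 0 < e ->
  exists2 d, 0 < d & forall y, a <= y -> y <= b -> `|y - x| < d -> `|f y - f x| <= e.

Lemma cont_on_within a b f : cont_on a b f -> {within `[a, b], continuous f}.
Proof.
move=> cf.
apply/subspace_continuousP => x /=; rewrite in_itv/= => /andP[ax xb].
apply/cvgrPdist_le => e e0; have [d d0 H] := cf x e ax xb e0.
rewrite /prop_near1 /within/= ; apply/nbhs_ballP; exists d => //= y.
by rewrite /ball/= distrC => yx /=; rewrite in_itv/= => /andP[ay yb]; rewrite distrC; exact: H.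
Qed.

Lemma cont_on_sub a b c d f : a <= c -> d <= b -> cont_on a b f -> cont_on c d f.
Proof.
move=> ac db cf x e cx xd e0.
have [r r0 H] := cf x e (le_trans ac cx) (le_trans xd db) e0.
by exists r => // y cy yd; apply: H; [exact: le_trans cy|exact: le_trans db].
Qed.

Lemma cont_onN a b f : cont_on a b f -> cont_on a b (fun x => - f x).
Proof.
move=> cf x e ax xb e0; have [d d0 H] := cf x e ax xb e0; exists d => // y ay yb yx.
by rewrite -opprD normrN; exact: H.
Qed.

Lemma cont_onD a b f g : cont_on a b f -> cont_on a b g -> cont_on a b (fun x => f x + g x).
Proof.
move=> cf cg x e ax xb e0; have e2 : 0 < e / 2 by rewrite divr_gt0.
have [d1 d10 H1] := cf x _ ax xb e2; have [d2 d20 H2] := cg x _ ax xb e2.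
exists (Num.min d1 d2); first by rewrite lt_min d10.
move=> y ay yb; rewrite lt_min => /andP[y1 y2].
rewrite (_ : _ - _ = (f y - f x) + (g y - g x)); last by ring.
by apply: le_trans (ler_normD _ _) _; have := H1 y ay yb y1; have := H2 y ay yb y2; lra.
Qed.

Lemma cont_on_lip a b f C :
  (forall x y, a <= x -> x <= y -> y <= b -> `|f y - f x| <= C * (y - x)) ->
  cont_on a b f.
Proof.
move=> H x e ax xb e0.
exists (e / (`|C| + 1)); first by rewrite divr_gt0// ltr_wpDl.
move=> y ay yb; rewrite ltr_pdivlMr ?ltr_wpDl// => /ltW h.
apply: le_trans h; wlog xy : x y ax xb ay yb / x <= y.
  move=> W; have [|/ltW] := leP x y; first exact: W.
  by rewrite distrC (distrC y); exact: W.
apply: le_trans (H x y ax xy yb) _.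
rewrite (ger0_norm (_ : 0 <= y - x)) ?subr_ge0// mulrC ler_wpM2l ?subr_ge0//.
by apply: le_trans (ler_norm C) _; rewrite lerDl.
Qed.

Lemma abs_continuous_cont_on a b f : abs_continuous a b f -> cont_on a b f.
Proof.
move=> acf x e ax xb e0; have [d d0 H] := acf e e0; exists d => // y ay yb.
wlog xy : x y ax xb ay yb / x <= y.
  move=> W; have [|/ltW] := leP x y; first exact: W.
  by rewrite distrC (distrC (f y)); exact: W.
rewrite (ger0_norm (_ : 0 <= y - x)) ?subr_ge0// => yx.
have := H 1%N (fun=> x) (fun=> y); rewrite !big_ord1 => h; apply/ltW/h => //.
by move=> i j _ _ _; rewrite !ord1.
Qed.

Lemma cont_on_max a b f : a <= b -> cont_on a b f ->
  exists c, [/\ a <= c, c <= b & forall x, a <= x -> x <= b -> f x <= f c].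
Proof.
move=> ab /cont_on_within cf; have [c] := EVT_max ab cf.
rewrite in_itv/= => /andP[ac cb] H; exists c; split => // x ax xb.
by apply: H; rewrite in_itv/= ax.
Qed.

Lemma cont_on_bounded a b f : a <= b -> cont_on a b f ->
  exists M, forall x, a <= x -> x <= b -> `|f x| <= M.
Proof.
move=> ab cf; have [c1 [_ _ H1]] := cont_on_max ab cf.
have [c2 [_ _ H2]] := cont_on_max ab (cont_onN cf).
exists (Num.max (f c1) (- f c2)) => x ax xb.
by rewrite ler_norml lerNl !le_max H1// H2// orbT.
Qed.

Lemma cont_on_ivt a b f y : a <= b -> cont_on a b f -> f a <= y -> y <= f b ->
  exists c, [/\ a <= c, c <= b & f c = y].
Proof.
move=> ab /cont_on_within cf ay yb; have [|c] := IVT ab cf (v := y).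
  by rewrite ge_min ay le_max yb orbT.
by rewrite in_itv/= => /andP[ac cb] fc; exists c.
Qed.

Lemma cont_on_measurable a b f : cont_on a b f -> measurable_fun (seg a b) f.
Proof.
move=> /cont_on_within cf; apply: measurable_leb_borel; first exact: measurable_itv.
apply: (measurable_funS (measurable_itv `[a, b])).
  by apply: subset_itv; rewrite bnd_simp.
exact: (subspace_continuous_measurable_fun (measurable_itv `[a, b]) cf).
Qed.

Lemma cont_on_itgbleM a b f g : a <= b -> cont_on a b f -> itgble a b g ->
  itgble a b (fun t => f t * g t).
Proof.
move=> ab cf gi; apply: itgbleM => //; first exact: cont_on_measurable.
have [M HM] := cont_on_bounded ab cf; exists M => t; rewrite /seg/= in_itv/=.
by move=> /andP[at' tb]; apply: HM => //; exact: ltW.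
Qed.

Lemma cont_on_itgble a b f : a <= b -> cont_on a b f -> itgble a b f.
Proof.
move=> ab cf; have := cont_on_itgbleM ab cf (itgble_cst a b 1).
by move=> /itgble_ae; apply; apply: ae_inW => t _; rewrite mulr1.
Qed.

Lemma itg_cont_on a b g : itgble a b g -> cont_on a b (fun x => itg a x g).
Proof.
move=> gi x e ax xb e0; have [d d0 H] := itg_cont gi e0; exists d => // y ay yb.
wlog xy : x y ax xb ay yb / x <= y.
  move=> W; have [|/ltW] := leP x y; first exact: W.
  by rewrite distrC (distrC (itg _ _ _)); exact: W.
rewrite (ger0_norm (_ : 0 <= y - x)) ?subr_ge0// => yx.
rewrite (@itg_cat _ a x y)//; last exact: itgbleS gi.
rewrite addrC addKr; apply: le_trans (norm_itg _) _; first exact: itgbleS gi.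
exact/ltW/H.
Qed.

Lemma first_zero a b f : a < b -> cont_on a b f -> 0 < f a -> f b <= 0 ->
  exists c, [/\ a < c, c <= b, f c = 0 & forall x, a <= x -> x < c -> 0 < f x].
Proof.
move=> ab cf fa fb.
pose S := [set x | [/\ a <= x, x <= b & forall y, a <= y -> y <= x -> 0 < f y]].
have Sa : S a by split => // [|y ay ya]; [exact: ltW|have <- : a = y by apply/le_anti/andP].
have supS : has_sup S by split; [exists a|exists b => x []].
pose c := sup S.
have ac : a <= c by apply: ub_le_sup => //; exact: supS.2.
have cb : c <= b by apply: ge_sup; [exists a|move=> x []].
have pos x : a <= x -> x < c -> 0 < f x.
  move=> ax xc; have cx0 : 0 < c - x by rewrite subr_gt0.
  have [y [ay yb Hy]] := sup_adherent cx0 supS.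
  by rewrite -/c opprB addrC subrK => xy; apply: Hy => //; exact: ltW.
have fc : f c = 0.
  have [fc0|fc0|//] := ltgtP (f c) 0.
    have [|d d0 H] := cf c (- f c / 2) ac cb; first by lra.
    have ac' : a < c by rewrite lt_neqAle ac andbT; apply/eqP => h; move: fc0; rewrite -h; lra.
    pose y := Num.max a (c - d / 2).
    have yc : y < c by rewrite /y gt_max ac'/=; lra.
    have ay : a <= y by rewrite /y le_max lexx.
    have yd : c - d / 2 <= y by rewrite /y le_max lexx orbT.
    have := H y ay (le_trans (ltW yc) cb); have := pos y ay yc => fy.
    rewrite distrC ger0_norm ?subr_ge0; last exact: ltW.
    by move=> /(_ ltac:(lra)); rewrite ler_norml => /andP[]; lra.
  have [|d d0 H] := cf c (f c / 2) ac cb; first by lra.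
  have cb' : c < b by rewrite lt_neqAle cb andbT; apply/eqP => h; move: fc0; rewrite h; lra.
  pose y := Num.min b (c + d / 2).
  have cy : c < y by rewrite /y lt_min cb'/=; lra.
  have yb : y <= b by rewrite /y ge_min lexx.
  have yd : y <= c + d / 2 by rewrite /y ge_min lexx orbT.
  have : S y.
    split => //; first by lra.
    move=> t at' ty; have [/pos|ct] := ltP t c; first exact.
    have := H t at' (le_trans ty yb); rewrite ger0_norm ?subr_ge0//.
    by move=> /(_ ltac:(lra)); rewrite ler_norml => /andP[]; lra.
  by move=> /(ub_le_sup supS.2); rewrite -/c leNgt cy.
exists c; split => //.
by rewrite lt_neqAle ac andbT; apply/eqP => h; move: fa; rewrite h fc ltxx.
Qed.

(** Over a division into [n] equal pieces the increments add up to at most [(b - a) / n] times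
    [Gam b - Gam a], which tends to 0. This replaces arguments with a.e. derivatives. *)
Lemma const_of_superlinear a b f Gam : a <= b ->
  (forall x y, a <= x -> x <= y -> y <= b -> `|f y - f x| <= (y - x) * (Gam y - Gam x)) ->
  f b = f a.
Proof.
move=> ab H; apply/eqP; rewrite -subr_eq0 -normr_le0; apply/ler_addgt0Pl => e e0.
rewrite addr0.
have Gab : 0 <= (b - a) * (Gam b - Gam a).
  by apply: le_trans (normr_ge0 _) (H a b _ _ _).
pose C := (b - a) * (Gam b - Gam a).
pose n := Num.bound (C / e).
have nC : C <= n.+1%:R * e.
  rewrite -ler_pdivrMr//; apply: (le_trans (ltW (archi_boundP (divr_ge0 Gab (ltW e0))))).
  by rewrite ler_nat.
pose h : R := (b - a) / n.+1%:R.
have h0 : 0 <= h by rewrite divr_ge0// subr_ge0.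
have hn : n.+1%:R * h = b - a by rewrite mulrC divfK.
have ind k : (k <= n.+1)%N -> `|f (a + k%:R * h) - f a| <= h * (Gam (a + k%:R * h) - Gam a).
  elim: k => [_|k IH kn]; first by rewrite mul0r addr0 !subrr normr0 mulr0.
  have e1 : a + k.+1%:R * h = a + k%:R * h + h by rewrite -natr1 mulrDl mul1r addrA.
  have h1 := IH (ltnW kn).
  have kb : a + k.+1%:R * h <= b.
    rewrite -lerBrDl -hn; apply: ler_wpM2r => //; by rewrite ler_nat.
  have := H (a + k%:R * h) (a + k.+1%:R * h) _ _ kb.
  rewrite lerDl mulr_ge0// e1 lerDl h0 => /(_ isT isT); rewrite [_ + h - _]addrC addKr.
  move=> h2; have := ler_normD (f (a + k%:R * h + h) - f (a + k%:R * h)) (f (a + k%:R * h) - f a).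
  rewrite addrA subrK.
  move: h1 h2; rewrite !mulrBr; lra.
have := ind n.+1 (leqnn _); rewrite hn (_ : a + (b - a) = b); last by ring.
move=> /le_trans; apply.
by rewrite /h mulrAC ler_pdivrMr// [X in _ <= X]mulrC.
Qed.

(** On a piece where [K] grows by at most 1/2, the maximum [M] of [p] satisfies
    [M <= p x + e + M / 2], so [p + 2 * e] at most doubles. Cutting [a, b] into [n + 1] such pieces
    gives the power of 2, without exponentials or derivatives of [K]. *)
Lemma gronwall (n : nat) a b (K p : R -> R) e : a <= b -> 0 <= e ->
  cont_on a b K -> cont_on a b p ->
  (forall x y, a <= x -> x <= y -> y <= b -> K x <= K y) ->
  (forall x, a <= x -> x <= b -> 0 <= p x) ->
  (forall x y M, a <= x -> x <= y -> y <= b ->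
     (forall t, x <= t -> t <= y -> p t <= M) -> p y <= p x + e + (K y - K x) * M) ->
  K b - K a <= n.+1%:R / 2 ->
  forall x, a <= x -> x <= b -> p x + 2 * e <= 2 ^+ n.+1 * (p a + 2 * e).
Proof.
move=> ab e0; elim: n b ab => [|n IH] b ab cK cp mK p0 H Kab.
- move=> x ax xb; have [c [ac cb Hc]] := cont_on_max ab cp.
  have := H a c (p c) (lexx _) ac cb
    (fun t (ta : a <= t) (tc : t <= c) => Hc t ta (le_trans tc cb)).
  have := Hc x ax xb; have := mK _ _ ac cb (lexx b); have := p0 c ac cb.
  have := mK _ _ (lexx a) ac cb.
  rewrite expr1 in Kab *; nra.
have step c : a <= c -> c <= b -> K b - K c <= 2^-1 ->
    forall x, c <= x -> x <= b -> p x + 2 * e <= 2 * (p c + 2 * e).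
  move=> ac cb Kbc x cx xb.
  have [m [cm mb Hm]] := cont_on_max cb (cont_on_sub ac (lexx b) cp).
  have am := le_trans ac cm.
  have := H c m (p m) ac cm mb (fun t (ta : c <= t) (tm : t <= m) => Hm t ta (le_trans tm mb)).
  have := Hm x cx xb; have := mK _ _ am mb (lexx b); have := p0 m am mb; have := mK _ _ ac cm mb.
  nra.
have pa0 := p0 a (lexx a) ab.
have [small|big] := leP (K b - K a) 2^-1.
  move=> x ax xb; apply: le_trans (step a _ _ small x ax xb) _ => //.
  rewrite ler_wpM2r//; first by lra.
  by rewrite exprS ler_peMr// exprn_ege1// ler1n.
(* Split off the last piece, on which [K] grows by exactly 1/2. *)
have [||c [ac cb Kc]] := @cont_on_ivt a b K (K b - 2^-1) ab cK; [by lra|by lra|].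
have IHc : forall x, a <= x -> x <= c -> p x + 2 * e <= 2 ^+ n.+1 * (p a + 2 * e).
  apply: IH => //.
  - exact: cont_on_sub cK.
  - exact: cont_on_sub cp.
  - by move=> x y ax xy yc; apply: mK => //; exact: le_trans cb.
  - by move=> x ax xc; apply: p0 => //; exact: le_trans cb.
  - by move=> x y M ax xy yc; apply: H => //; exact: le_trans cb.
  - by rewrite Kc; move: Kab; rewrite -natr1 mulrDl; lra.
move=> x ax xb; have [xc|/ltW cx] := leP x c.
  apply: le_trans (IHc x ax xc) _; rewrite ler_wpM2r//; first by lra.
  by rewrite [leRHS]exprS ler_peMl// ?ler1n// exprn_ge0.
have Kbc : K b - K c <= 2^-1 by rewrite Kc; lra.
apply: le_trans (step c ac cb Kbc x cx xb) _.
by rewrite exprS -mulrA ler_wpM2l// IHc.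
Qed.

(** Reflection: [- K (- t)] is again nondecreasing and [p (- t)] satisfies the forward
    inequality. *)
Lemma gronwall_back (n : nat) a b (K p : R -> R) e : a <= b -> 0 <= e ->
  cont_on a b K -> cont_on a b p ->
  (forall x y, a <= x -> x <= y -> y <= b -> K x <= K y) ->
  (forall x, a <= x -> x <= b -> 0 <= p x) ->
  (forall x y M, a <= x -> x <= y -> y <= b ->
     (forall t, x <= t -> t <= y -> p t <= M) -> p x <= p y + e + (K y - K x) * M) ->
  K b - K a <= n.+1%:R / 2 ->
  forall x, a <= x -> x <= b -> p x + 2 * e <= 2 ^+ n.+1 * (p b + 2 * e).
Proof.
move=> ab e0 cK cp mK p0 H Kab x ax xb.
have refl f : cont_on a b f -> cont_on (- b) (- a) (fun x => f (- x)).
  move=> cf y d yb ya d0; have [||r r0 Hr] := cf (- y) d _ _ d0; [by lra|by lra|].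
  exists r => // t tb ta ty; apply: Hr; [by lra|by lra|].
  by rewrite -opprD normrN.
have := @gronwall n (- b) (- a) (fun x => - K (- x)) (fun x => p (- x)) e.
rewrite !opprK; rewrite lerN2 => /(_ ab e0 (cont_onN (refl _ cK)) (refl _ cp)).
move=> G; have := G _ _ _ _ (- x); rewrite opprK; apply.
- by move=> s t sb st ta; rewrite lerN2; apply: mK; lra.
- by move=> s sb sa; apply: p0; lra.
- move=> s t M sb st ta HM; have := H (- t) (- s) M.
  rewrite (_ : - K (- t) - - K (- s) = K (- s) - K (- t)); last by ring.
  by apply; [lra|lra|lra|move=> r r1 r2; have := HM (- r); rewrite opprK; apply; lra].
- by rewrite addrC.
- by lra.
- by lra.
Qed.

End cont_on.

(** * Calculus for functions with integrable second derivative *)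

Section W21_theory.
Context {R : realType}.
Implicit Types (a b c d e r s t L : R) (f u v : R -> R).

Lemma W21S a b c d u v g : a <= c -> d <= b -> W21 a b u v g -> W21 c d u v g.
Proof.
move=> ac db [gi vg uv]; split; first exact: itgbleS gi.
  by move=> x y cx xy yd; apply: vg => //; [exact: le_trans cx|exact: le_trans db].
by move=> x y cx xy yd; apply: uv => //; [exact: le_trans cx|exact: le_trans db].
Qed.

Lemma W21_v_le a b u v g x y : W21 a b u v g -> a <= x -> x <= y -> y <= b ->
  `|v y - v x| <= itg x y (fun t => `|g t|).
Proof. by move=> [gi vg _] ax xy yb; rewrite vg//; apply: norm_itg; exact: itgbleS gi. Qed.

Lemma W21_v_cont a b u v g : W21 a b u v g -> cont_on a b v.
Proof.
move=> [gi vg uv] x e ax xb e0.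
have [d d0 H] := itg_cont_on gi ax xb e0; exists d => // y ay yb yx.
have := H y ay yb yx; rewrite -!vg//.
by rewrite (_ : v y - v a - _ = v y - v x)//; ring.
Qed.

Lemma W21_v_itgble a b u v g x y : W21 a b u v g -> a <= x -> x <= y -> y <= b ->
  itgble x y v.
Proof.
by move=> W ax xy yb; apply: cont_on_itgble => //; apply: cont_on_sub (W21_v_cont W).
Qed.

Lemma W21_bounded a b u v g : a <= b -> W21 a b u v g ->
  exists M, forall x, a <= x -> x <= b -> `|v x| <= M.
Proof. by move=> ab /W21_v_cont; exact: cont_on_bounded. Qed.

Lemma W21_u_lip a b u v g M : W21 a b u v g ->
  (forall x, a <= x -> x <= b -> `|v x| <= M) ->
  forall x y, a <= x -> x <= y -> y <= b -> `|u y - u x| <= M * (y - x).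
Proof.
move=> W vM x y ax xy yb; have vi := W21_v_itgble W ax xy yb.
case: W => _ _ ->//; apply: le_trans (norm_itg vi) _.
rewrite -itg_cst//; apply: le_itg; [exact: itgble_norm|exact: itgble_cst|].
apply: ae_inW => t; rewrite /seg/= in_itv/= => /andP[/ltW xt ty].
by apply: vM; [exact: le_trans xt|exact: le_trans yb].
Qed.

Lemma W21_u_cont a b u v g : a <= b -> W21 a b u v g -> cont_on a b u.
Proof.
move=> ab W; have [M HM] := W21_bounded ab W.
by apply: (@cont_on_lip _ _ _ _ M); exact: (W21_u_lip W HM).
Qed.

(** The integral tends to 0 with the length of the interval, so the remainder is [o(y - x)]; this
    yields both differentiability and the superlinear increments in [wronskian]. *)
Lemma W21_taylor a b u v g x y : W21 a b u v g -> a <= x -> x <= y -> y <= b ->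
  `|u y - u x - v x * (y - x)| <= (y - x) * itg x y (fun t => `|g t|).
Proof.
move=> W ax xy yb; have vi := W21_v_itgble W ax xy yb.
have cv := itgble_cst x y (v x).
have gi : itgble x y (fun t => `|g t|).
  by case: W => gi _ _; apply: itgble_norm; exact: itgbleS gi.
have [_ _ ->] := W => //; rewrite -itg_cst// -itgB//.
have i1 := itgbleB vi cv.
apply: le_trans (norm_itg i1) _; rewrite mulrC -itg_cst//; apply: le_itg.
- exact: itgble_norm.
- exact: itgble_cst.
- apply: ae_inW => t; rewrite /seg/= in_itv/= => /andP[/ltW xt ty].
  apply: le_trans (W21_v_le W ax xt (le_trans ty yb)) _.
  by apply: itg_mono => //; apply: ae_inW.
Qed.

Lemma W21_taylor_left a b u v g x y : W21 a b u v g -> a <= x -> x <= y -> y <= b ->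
  `|u x - u y - v y * (x - y)| <= (y - x) * itg x y (fun t => `|g t|).
Proof.
move=> W ax xy yb; have vi := W21_v_itgble W ax xy yb.
have cv := itgble_cst x y (v y).
have gi : itgble x y (fun t => `|g t|).
  by case: W => gi _ _; apply: itgble_norm; exact: itgbleS gi.
rewrite (_ : u x - u y - _ = v y * (y - x) - (u y - u x)); last by ring.
have [_ _ ->] := W => //; rewrite -itg_cst// -itgB//.
have i1 := itgbleB cv vi.
apply: le_trans (norm_itg i1) _; rewrite mulrC -itg_cst//; apply: le_itg.
- exact: itgble_norm.
- exact: itgble_cst.
- apply: ae_inW => t; rewrite /seg/= in_itv/= => /andP[/ltW xt ty].
  apply: le_trans (W21_v_le W (le_trans ax xt) ty yb) _.
  by apply: itg_mono => //; apply: ae_inW.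
Qed.

Lemma W21_is_derive a b u v g x : W21 a b u v g -> a < x -> x < b ->
  is_derive x 1 u (v x).
Proof.
move=> W ax xb; apply/is_derive_epsP => e e0.
have [gi _ _] := W; have [d d0 H] := itg_cont gi e0.
exists (Num.min d (Num.min (x - a) (b - x))).
  by rewrite !lt_min d0 !subr_gt0 ax.
move=> y; rewrite !lt_min => /andP[yd /andP[y1 y2]].
have [xy|yx] := leP x y.
  rewrite (ger0_norm (_ : 0 <= y - x)) ?subr_ge0// in yd y1 y2 *.
  apply: le_trans (W21_taylor W (ltW ax) xy _) _; first by lra.
  by rewrite mulrC ler_wpM2r ?subr_ge0//; apply/ltW/H => //; lra.
rewrite (distrC y) (ger0_norm (_ : 0 <= x - y)) ?subr_ge0// in yd y1 y2 *; try exact: ltW.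
apply: le_trans (W21_taylor_left W _ (ltW yx) (ltW xb)) _; first by lra.
by rewrite mulrC ler_wpM2r ?subr_ge0//; [exact: ltW|apply/ltW/H => //; lra].
Qed.

Lemma W21D a b u v g u' v' g' k : W21 a b u v g -> W21 a b u' v' g' ->
  W21 a b (fun x => u x + k * u' x) (fun x => v x + k * v' x) (fun x => g x + k * g' x).
Proof.
move=> W W'; have [gi vg uv] := W; have [gi' vg' uv'] := W'; split.
- by apply: itgbleD => //; exact: itgbleZ.
- move=> x y ax xy yb; rewrite itgD ?itgZ; [|exact: itgbleS gi'|
    exact: itgbleS gi|apply: itgbleZ; exact: itgbleS gi'].
  by rewrite -vg// -vg'//; ring.
- move=> x y ax xy yb.
  have i1 := W21_v_itgble W ax xy yb; have i2 := W21_v_itgble W' ax xy yb.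
  by rewrite itgD ?itgZ//; [rewrite -uv// -uv'//; ring|exact: itgbleZ].
Qed.

Lemma W21Z a b u v g k : W21 a b u v g ->
  W21 a b (fun x => k * u x) (fun x => k * v x) (fun x => k * g x).
Proof.
move=> W; have [gi vg uv] := W; split.
- exact: itgbleZ.
- by move=> x y ax xy yb; rewrite itgZ -?mulrBr ?vg//; exact: itgbleS gi.
- move=> x y ax xy yb; rewrite itgZ -?mulrBr ?uv//; exact: W21_v_itgble W ax xy yb.
Qed.

Lemma W21_exists a b g (u0 v0 : R) : a <= b -> itgble a b g ->
  exists u v, [/\ W21 a b u v g, u a = u0 & v a = v0].
Proof.
move=> ab gi; pose v x := v0 + itg a x g; pose u x := u0 + itg a x v.
have vg x y : a <= x -> x <= y -> y <= b -> v y - v x = itg x y g.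
  by move=> ax xy yb; rewrite /v (@itg_cat _ a x y)//; [ring|exact: itgbleS gi].
have cv : cont_on a b v.
  apply: cont_onD; last exact: itg_cont_on.
  by move=> x e _ _ e0; exists 1 => // y _ _ _; rewrite subrr normr0 ltW.
exists u, v; split => //.
- split => // x y ax xy yb; rewrite /u (@itg_cat _ a x y)//; first by ring.
  apply: cont_on_itgble; [exact: le_trans xy|exact: cont_on_sub cv].
- by rewrite /u itgg addr0.
- by rewrite /v itgg addr0.
Qed.

(* W = v z - u y has increments [(y' - x') * o(1)] apart from the integral, so it is
   its integral by [const_of_superlinear]; no product rule for a.e. derivatives is needed. *)
Lemma wronskian a b u v g z y h : a <= b -> W21 a b u v g -> W21 a b z y h ->
  itgble a b (fun t => g t * z t - u t * h t) /\
  (v b * z b - u b * y b) - (v a * z a - u a * y a) =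
    itg a b (fun t => g t * z t - u t * h t).
Proof.
move=> ab W Z; have [gi vg uv] := W; have [hi yh zy] := Z.
have cu := W21_u_cont ab W; have cz := W21_u_cont ab Z.
have ii p q : a <= p -> p <= q -> q <= b ->
    itgble p q (fun t => g t * z t) /\ itgble p q (fun t => u t * h t).
  move=> ap pq qb; split.
    have : itgble p q (fun t => z t * g t).
      apply: cont_on_itgbleM => //; [exact: cont_on_sub cz|exact: itgbleS gi].
    by move=> /itgble_ae; apply; apply: ae_inW => t _; rewrite mulrC.
  by apply: cont_on_itgbleM => //; [exact: cont_on_sub cu|exact: itgbleS hi].
have iw p q : a <= p -> p <= q -> q <= b -> itgble p q (fun t => g t * z t - u t * h t).
  by move=> ap pq qb; have [? ?] := ii p q ap pq qb; exact: itgbleB.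
split; first by apply: iw.
have [V HV] := W21_bounded ab W; have [Y HY] := W21_bounded ab Z.
have V0 : 0 <= V by apply: le_trans (HV a _ _).
have Y0 : 0 <= Y by apply: le_trans (HY a _ _).
pose D x := (v x * z x - u x * y x) - itg a x (fun t => g t * z t - u t * h t).
(* The factors 2: [|g|] is charged once for freezing [z] at [q] under the integral and once for the
   Taylor remainder of [u]; likewise [|h|] with the roles exchanged. *)
pose G x := 2 * Y * itg a x (fun t => `|g t|) + 2 * V * itg a x (fun t => `|h t|).
suff : D b = D a by rewrite /D itgg; lra.
apply: (@const_of_superlinear _ _ _ _ G) => // p q ap pq qb.
have pb := le_trans pq qb; have aq := le_trans ap pq.
have ng : itgble a b (fun t => `|g t|) by exact: itgble_norm.
have nh : itgble a b (fun t => `|h t|) by exact: itgble_norm.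
have GE : G q - G p = 2 * Y * itg p q (fun t => `|g t|) + 2 * V * itg p q (fun t => `|h t|).
  rewrite /G !(@itg_cat _ a p q)//; try by [exact: itgbleS ng|exact: itgbleS nh].
  by ring.
have gpq : itgble p q g by exact: itgbleS gi.
have hpq : itgble p q h by exact: itgbleS hi.
have [igz iuh] := ii p q ap pq qb.
have t1 := W21_taylor W ap pq qb; have t2 := W21_taylor Z ap pq qb.
have cst_r k (f : R -> R) : itgble p q f -> itg p q (fun t => f t * k) = itg p q f * k.
  by move=> fi; rewrite mulrC -itgZ//; apply: eq_itg => t _ _; rewrite mulrC.
have icst_r k (f : R -> R) : itgble p q f -> itgble p q (fun t => f t * k).
  by move=> fi; have := itgbleZ k fi; move=> /itgble_ae; apply; apply: ae_inW => t _; rewrite mulrC.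
have e1 : `|(v q - v p) * z q - itg p q (fun t => g t * z t)| <=
    Y * (q - p) * itg p q (fun t => `|g t|).
  rewrite vg// -cst_r// -itgB//; last exact: icst_r.
  apply: le_trans (norm_itg _) _; first by apply: itgbleB => //; exact: icst_r.
  rewrite -itgZ; last exact: itgbleS ng.
  apply: le_itg; [apply: itgble_norm; apply: itgbleB => //; exact: icst_r|
    apply: itgbleZ; exact: itgbleS ng|].
  apply: ae_inW => t; rewrite /seg/= in_itv/= => /andP[/ltW pt tq].
  rewrite -mulrBr normrM mulrC ler_wpM2r//.
  apply: le_trans (W21_u_lip Z HY (le_trans ap pt) tq qb) _.
  by rewrite ler_wpM2l//; lra.
have e2 : `|u q * (y q - y p) - itg p q (fun t => u t * h t)| <=
    V * (q - p) * itg p q (fun t => `|h t|).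
  rewrite yh// -itgZ// -itgB//; last exact: itgbleZ.
  apply: le_trans (norm_itg _) _; first by apply: itgbleB => //; exact: itgbleZ.
  rewrite -itgZ; last exact: itgbleS nh.
  apply: le_itg; [apply: itgble_norm; apply: itgbleB => //; exact: itgbleZ|
    apply: itgbleZ; exact: itgbleS nh|].
  apply: ae_inW => t; rewrite /seg/= in_itv/= => /andP[/ltW pt tq].
  rewrite -mulrBl normrM ler_wpM2r//.
  apply: le_trans (W21_u_lip W HV (le_trans ap pt) tq qb) _.
  by rewrite ler_wpM2l//; lra.
rewrite GE.
have DE : D q - D p = ((v q - v p) * z q - itg p q (fun t => g t * z t))
   - (u q * (y q - y p) - itg p q (fun t => u t * h t))
   + v p * (z q - z p - y p * (q - p)) - y p * (u q - u p - v p * (q - p)).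
  rewrite /D (@itg_cat _ a p q (fun t => g t * z t - u t * h t))//; last exact: iw.
  by rewrite (itgB igz iuh); ring.
rewrite DE.
set A1 := _ - itg p q (fun t => g t * z t) in e1 *.
set A2 := _ - itg p q (fun t => u t * h t) in e2 *.
set T1 := u q - _ - _ in t1 *; set T2 := z q - _ - _ in t2 *.
have f1 : `|v p * T2| <= V * ((q - p) * itg p q (fun t => `|h t|)).
  by rewrite normrM ler_pM// HV.
have f2 : `|y p * T1| <= Y * ((q - p) * itg p q (fun t => `|g t|)).
  by rewrite normrM ler_pM// HY.
have n1 := ler_normB (A1 - A2 + v p * T2) (y p * T1).
have n2 := ler_normD (A1 - A2) (v p * T2).
have n3 := ler_normB A1 A2.
apply: le_trans n1 _; apply: le_trans (lerD n2 (lexx _)) _.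
apply: le_trans (lerD (lerD n3 (lexx _)) (lexx _)) _.
apply: le_trans (lerD (lerD (lerD e1 e2) f1) f2) _.
by rewrite le_eqVlt; apply/orP; left; apply/eqP; ring.
Qed.

Lemma dirichlet_solution_W21 a b F (u : R -> R) : a <= b ->
  (forall u, cont_on a b u -> itgble a b (fun t => F t (u t))) ->
  dirichlet_solution a b F u ->
  exists v, [/\ W21 a b u v (fun t => - F t (u t)), u a = 0 & u b = 0].
Proof.
move=> ab Fi [acu [[v [acv du dv]] [ua ub]]].
have cu := abs_continuous_cont_on acu.
have gi := itgbleN (Fi u cu).
have vg : forall x y, a <= x -> x <= y -> y <= b -> v y - v x = itg x y (fun t => - F t (u t)).
  apply: abs_continuous_itg_deriv => //.
  have sub : `]a, b[%classic `<=` `[a, b]%classic by apply: subset_itv; rewrite bnd_simp.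
  apply: ae_in_sub dv => // x _ [w dw wF].
  by rewrite (_ : - F x (u x) = w)//; move: wF; lra.
exists v; split => //; split => // x y ax xy yb.
have cv := abs_continuous_cont_on acv.
have iv p q : a <= p -> p <= q -> q <= b -> itgble p q v.
  by move=> ap pq qb; apply: cont_on_itgble => //; exact: cont_on_sub cv.
(* On [p, q] the increment of [u] is [v xi * (q - p)] by the mean value theorem, and [v] oscillates
   there by at most [G q - G p]; so [D] has superlinear increments. *)
pose D z := u z - itg x z v; pose G z := itg x z (fun t => `|F t (u t)|).
suff : D y = D x by rewrite /D itgg; lra.
have nF p q : a <= p -> p <= q -> q <= b -> itgble p q (fun t => `|F t (u t)|).
  by move=> ap pq qb; apply: itgble_norm; exact: itgbleS (Fi u cu).
apply: (@const_of_superlinear _ _ _ _ G) => // p q xp pq qy.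
have ap := le_trans ax xp; have qb := le_trans qy yb.
rewrite /D /G !(@itg_cat _ x p q)//;
  try by [apply: iv => //; exact: le_trans pq|apply: nF => //; exact: le_trans pq].
rewrite [_ + _ - itg x p (fun t => `|_|)]addrC addKr.
rewrite (_ : _ - _ = (u q - u p) - itg p q v); last by ring.
have der z : z \in `]p, q[ -> is_derive z 1 u (v z).
  rewrite in_itv/= => /andP[pz zq]; apply: du; rewrite in_itv/=.
  by rewrite (le_lt_trans ap pz) (lt_le_trans zq qb).
have wcu : {within `[p, q], continuous u} by exact: cont_on_within (cont_on_sub ap qb cu).
have [xi] := MVT_segment pq der wcu.
rewrite in_itv/= => /andP[pxi xiq] ->.
have ci := itgble_cst p q (v xi); have vi := iv p q ap pq qb.
rewrite -itg_cst// -itgB//; apply: le_trans (norm_itg (itgbleB ci vi)) _.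
rewrite mulrC -itg_cst//; apply: le_itg; [exact/itgble_norm/itgbleB|exact: itgble_cst|].
apply: ae_inW => t; rewrite /seg/= in_itv/= => /andP[/ltW pt tq].
have bound s r : p <= s -> s <= r -> r <= q -> `|v r - v s| <= itg p q (fun t => `|F t (u t)|).
  move=> ps sr rq; rewrite vg//; [|exact: le_trans ps|exact: le_trans qb].
  have gsr : itgble s r (fun t => - F t (u t)).
    by apply: itgbleS gi; [exact: le_trans ps|exact: le_trans qb].
  apply: le_trans (norm_itg gsr) _.
  rewrite (@eq_itg _ _ _ _ (fun t => `|F t (u t)|)); last by move=> *; rewrite normrN.
  by apply: itg_mono => //; [exact: nF|apply: ae_inW].
by have [h|/ltW h] := leP t xi; [|rewrite distrC]; exact: bound.
Qed.

Lemma W21_dirichlet_solution a b F (u v : R -> R) : a <= b ->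
  W21 a b u v (fun t => - F t (u t)) -> u a = 0 -> u b = 0 -> dirichlet_solution a b F u.
Proof.
move=> ab W ua ub; have [gi vg uv] := W.
split; first exact: (abs_continuous_itg (W21_v_itgble W (lexx a) ab (lexx b)) uv).
split => //; exists v; split.
- exact: abs_continuous_itg gi vg.
- by move=> x; rewrite in_itv/= => /andP[ax xb]; exact: W21_is_derive W ax xb.
have [N [mN N0 HN]] := itg_derivable gi.
(* The end points join the null set: nothing is known about [v] outside [a, b], hence no two-sided
   derivative there. *)
have mab : measurable ([set a; b] : set (lebesgueType R)).
  by apply: borel_leb; apply: measurableU; exact: measurable_set1.
exists (N `|` [set a; b]); split.
- exact: measurableU.
- apply: (@measure_negligible _ _ _ (leb R)); first exact: measurableU.
  apply: negligibleU; first by exists N; split.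
  apply: negligibleU.
    by exists [set a]; split => //;
      [apply: borel_leb; exact: measurable_set1|exact: lebesgue_measure_set1].
  by exists [set b]; split => //;
      [apply: borel_leb; exact: measurable_set1|exact: lebesgue_measure_set1].
move=> x /= /not_implyP[]; rewrite in_itv/= => /andP[ax xb] nd.
apply: contrapT => /not_orP[Nx /not_orP[xa' xb']]; apply: nd.
have ax' : a < x by rewrite lt_neqAle ax andbT; apply/eqP => h; apply: xa'; rewrite /= h.
have xb1 : x < b by rewrite lt_neqAle xb andbT; apply/eqP => h; apply: xb'; rewrite /= h.
exists (- F x (u x)); last by rewrite addNr.
have D : is_derive x 1 (fun z => itg a z (fun t => - F t (u t))) (- F x (u x)).
  apply: contrapT => h; apply: Nx; apply: HN => /= K; apply: h; apply: K.
  by rewrite in_itv/= ax'.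
apply/is_derive_epsP => e e0.
have [r r0 Hr] := (is_derive_epsP _ _ _).1 D e e0.
exists (Num.min r (Num.min (x - a) (b - x))); first by rewrite !lt_min r0 !subr_gt0 ax'.
move=> y; rewrite !lt_min => /andP[yr /andP[y1 y2]].
have := Hr y yr; rewrite -!vg//.
- by rewrite (_ : v y - v a - _ = v y - v x)//; ring.
- by move: y1; rewrite ltr_norml => /andP[]; lra.
- by move: y2; rewrite ltr_norml => /andP[]; lra.
Qed.

End W21_theory.

(** * The linear eigenvalue problem *)

Section linear.
Context {R : realType}.
Implicit Types (a b c d e r s t L mu nu : R) (f u v q : R -> R).

Lemma seg_sub_itv a b : seg a b `<=` `[a, b]%classic.
Proof. by move=> t; rewrite /seg/= !in_itv/= => /andP[/ltW -> ->]. Qed.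

Lemma L1_nonneg_itgble a b q : L1_nonneg `[a, b] q -> itgble a b q.
Proof.
move=> [qi _]; apply: (integrableS _ _ (@seg_sub_itv a b) qi) => //.
by apply: borel_leb; exact: measurable_itv.
Qed.

Lemma L1_nonneg_ge0 a b q t : L1_nonneg `[a, b] q -> a <= t -> t <= b -> 0 <= q t.
Proof. by move=> [_ q0] at' tb; apply: q0; rewrite /= in_itv/= at'. Qed.

Lemma W21_eq a b u v g h : (forall t, a < t -> t <= b -> g t = h t) -> W21 a b u v g ->
  W21 a b u v h.
Proof.
move=> gh [gi vg uv]; split => //.
  by apply: itgble_ae gi _; apply: ae_inW => t; rewrite /seg/= in_itv/= => /andP[? ?]; exact: gh.
move=> x y ax xy yb; rewrite vg//; apply: eq_itg => t xt ty; apply: gh.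
  exact: le_lt_trans xt.
exact: le_trans yb.
Qed.

Lemma W21_eq_ae a b u v g h : ae_in (seg a b) (fun t => g t = h t) -> W21 a b u v g ->
  W21 a b u v h.
Proof.
move=> gh [gi vg uv]; have hi := itgble_ae gi gh; split => //.
move=> x y ax xy yb; rewrite vg//; apply: eq_itg_ae; [exact: itgbleS gi|exact: itgbleS hi|].
apply: ae_in_sub gh => // t; rewrite /seg/= !in_itv/= => /andP[xt ty].
by rewrite (le_lt_trans ax xt) (le_trans ty).
Qed.

Lemma seg_ae_sub a b c d (P : R -> Prop) : a <= c -> d <= b -> ae_in (seg a b) P ->
  ae_in (seg c d) P.
Proof.
move=> ac db; apply: ae_in_sub => // t; rewrite /seg/= !in_itv/= => /andP[ct td].
by rewrite (le_lt_trans ac ct) (le_trans td).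
Qed.

Lemma concave_v a b u v g x y : W21 a b u v g -> ae_in (seg a b) (fun t => g t <= 0) ->
  a <= x -> x <= y -> y <= b -> v y <= v x.
Proof.
move=> [gi vg _] g0 ax xy yb; rewrite -subr_le0 vg// -oppr_ge0 -itgN; last exact: itgbleS gi.
apply: itg_ge0; first by apply: itgbleN; exact: itgbleS gi.
by apply: ae_inS (seg_ae_sub ax yb g0) => t _; rewrite oppr_ge0.
Qed.

Lemma concave_u a b u v g x y : W21 a b u v g -> ae_in (seg a b) (fun t => g t <= 0) ->
  a <= x -> x <= y -> y <= b ->
  v y * (y - x) <= u y - u x /\ u y - u x <= v x * (y - x).
Proof.
move=> W g0 ax xy yb; have vi := W21_v_itgble W ax xy yb.
have [_ _ ->//] := W; rewrite -!itg_cst//; split; apply: le_itg => //; try exact: itgble_cst;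
  apply: ae_inW => t; rewrite /seg/= in_itv/= => /andP[/ltW xt ty];
  apply: (concave_v W g0) => //; [exact: le_trans xt|exact: le_trans yb].
Qed.

Lemma concave_chord a b u v g x : W21 a b u v g -> ae_in (seg a b) (fun t => g t <= 0) ->
  a <= x -> x <= b -> (b - x) * u a + (x - a) * u b <= (b - a) * u x.
Proof.
move=> W g0 ax xb; have [h1 _] := concave_u W g0 (lexx a) ax xb.
have [_ h2] := concave_u W g0 ax xb (lexx b).
have xa0 : 0 <= x - a by lra.
have bx0 : 0 <= b - x by lra.
by nra.
Qed.

Lemma pos_slope a b u v g : a < b -> W21 a b u v g -> 0 <= u a -> 0 < v a ->
  exists2 r, 0 < r & a + r <= b /\ forall x, a < x -> x <= a + r -> 0 < u x.
Proof.
move=> ab W ua va; have [gi _ _] := W; have [d d0 H] := itg_cont gi va.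
pose r := Num.min (d / 2) (b - a).
have r0 : 0 < r by rewrite /r lt_min divr_gt0//= subr_gt0.
have r1 : r <= d / 2 by rewrite /r ge_min lexx.
have r2 : r <= b - a by rewrite /r ge_min lexx orbT.
exists r => //; split; first by lra.
move=> x ax xr; have xb : x <= b by lra.
have := W21_taylor W (lexx a) (ltW ax) xb; have := H a x (lexx a) (ltW ax) xb.
set G := itg _ _ _; rewrite ler_norml => h1 /andP[h2 _].
have Gv : G < v a by apply: h1; lra.
have xa0 : 0 < x - a by lra.
by nra.
Qed.

(** Composition with it freezes a nonlinearity above height [m] and, if it vanishes at 0, extends it
    by 0 to negative arguments. *)
Definition clamp (m s : R) := Num.max 0 (Num.min s m).

Lemma clamp_ge0 m s : 0 <= clamp m s. Proof. by rewrite /clamp le_max lexx. Qed.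

Lemma clamp_le m s : 0 <= m -> clamp m s <= m.
Proof. by move=> m0; rewrite /clamp ge_max m0 ge_min lexx orbT. Qed.

Lemma clamp_id m s : 0 <= s -> s <= m -> clamp m s = s.
Proof. by move=> s0 sm; rewrite /clamp min_l// max_r. Qed.

Lemma clamp_neg m s : s <= 0 -> clamp m s = 0.
Proof. by move=> s0; rewrite /clamp max_l// ge_min s0. Qed.

Lemma clamp_le_id m s : 0 <= s -> clamp m s <= s.
Proof. by move=> s0; rewrite /clamp ge_max s0 ge_min lexx. Qed.

Lemma clamp_lip m s t : 0 <= m -> `|clamp m s - clamp m t| <= `|s - t|.
Proof.
move=> m0; wlog st : s t / s <= t.
  by move=> W; have [|/ltW] := leP s t; [|rewrite distrC (distrC s)]; exact: W.
rewrite distrC (distrC s) (ger0_norm (_ : 0 <= t - s)) ?subr_ge0// /clamp.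
have [sm|ms] := leP s m; have [tm|mt] := leP t m;
  have [s0|s0] := leP 0 s; have [t0|t0] := leP 0 t;
  rewrite ?(max_l m0) ?(max_r m0) ?(max_r s0) ?(max_l (ltW s0));
  rewrite ?subrr ?normr0 ?subr_ge0//; try lra; rewrite ger0_norm; lra.
Qed.

Lemma clamp_cvg m (s : nat -> R) s' : 0 <= m -> s @ \oo --> s' ->
  clamp m (s n) @[n --> \oo] --> clamp m s'.
Proof.
move=> m0 ss; apply: cvgn_dist => e e0; have [N HN] := dist_cvgn ss e0.
by exists N => n Nn; apply: le_trans (clamp_lip _ _ m0) _; exact: HN.
Qed.

(* Shooting in the parameter [nu] of u'' + nu q u^+ = 0. *)
Lemma no_eigenvalue_pos_sol L q : 0 < L -> L1_nonneg `[0, L] q ->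
  (forall nu, nu <= 1 -> ~ dirichlet_eigenvalue 0 L q nu) ->
  exists w w', W21 0 L w w' (fun t => - (q t * w t)) /\
    (0 < w L /\ forall x, 0 <= x -> x <= L -> x * w L <= L * w x /\ w x <= x).
Proof.
move=> L0 Lq neig; have qi := L1_nonneg_itgble Lq.
have q0 t : seg 0 L t -> 0 <= q t.
  by move=> /seg_sub_itv; rewrite /= in_itv/= => /andP[? ?]; exact: L1_nonneg_ge0 Lq _ _.
(* The truncations give [0 <= F <= q * L], the bound needed for [kneser]. They are harmless for
   [0 <= nu <= 1] and [u >= 0]: concavity and initial slope 1 give [u x <= x <= L]. *)
pose F nu t s := clamp 1 nu * (q t * clamp L s).
have Fle nu t s : seg 0 L t -> 0 <= F nu t s /\ F nu t s <= q t * L.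
  move=> /q0 qt; have c0 := clamp_ge0 1 nu; have c1 := clamp_le nu (@ler01 R).
  have s0 := clamp_ge0 L s; have s1 := clamp_le s (ltW L0).
  have p0 : 0 <= q t * clamp L s by rewrite mulr_ge0.
  split; first by rewrite mulr_ge0.
  apply: (@le_trans _ _ (1 * (q t * clamp L s))); first by rewrite ler_wpM2r.
  by rewrite mul1r ler_wpM2l.
pose sol := kneser_sol L F (fun=> 1).
have concave nu u v : sol nu u v -> ae_in (seg 0 L) (fun t => - F nu t (u t) <= 0).
  by move=> _; apply: ae_inW => t st; rewrite oppr_le0; case: (Fle nu t (u t) st).
have upper nu u v x : sol nu u v -> 0 <= x -> x <= L -> u x <= x.
  move=> S x0 xL; have [W u0 v0] := S.
  have [_] := concave_u W (concave _ _ _ S) (lexx 0) x0 xL.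
  by rewrite u0 v0 !subr0 mul1r.
have pos nu u v x : sol nu u v -> 0 <= u L -> 0 <= x -> x <= L -> x * u L <= L * u x.
  move=> S uL x0 xL; have [W u0 v0] := S.
  have := concave_chord W (concave _ _ _ S) x0 xL.
  by rewrite u0 mulr0 add0r !subr0.
have pos' nu u v x : sol nu u v -> 0 <= u L -> 0 <= x -> x <= L -> 0 <= u x.
  move=> S uL x0 xL; rewrite -(pmulr_rge0 _ L0); apply: le_trans (pos _ _ _ _ S uL x0 xL).
  by rewrite mulr_ge0.
have lin nu u v : 0 <= nu <= 1 -> sol nu u v -> 0 <= u L ->
    W21 0 L u v (fun t => - (nu * q t * u t)).
  move=> /andP[nu0 nu1] S uL; have [W _ _] := S; apply: W21_eq W => t t0 tL.
  rewrite /F clamp_id// [clamp L _]clamp_id ?mulrA//.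
    by apply: pos' S uL _ _ => //; exact: ltW.
  by apply: le_trans (upper _ _ _ _ S _ _) _ => //; exact: ltW.
have noeig nu u v : 0 <= nu <= 1 -> sol nu u v -> u L <> 0.
  move=> nu01 S uL; apply: (neig nu); first by case/andP: nu01.
  have uL0 : 0 <= u L by rewrite uL.
  have W := lin _ _ _ nu01 S uL0; have [W' u0 v0] := S.
  exists u.
    exact: (@W21_dirichlet_solution _ 0 L (fun x s => nu * q x * s) u v (ltW L0) W u0 uL).
  have [||r r0 [rL Hr]] := pos_slope L0 W; [by rewrite u0|by rewrite v0|].
  exists r; first by rewrite in_itv/= ltW//=; lra.
  by apply: lt0r_neq0; apply: Hr; lra.
(* At [nu = 0] the solution is [u x = x], positive at [L]. If at [nu = 1] all solutions were
   negative at [L], shooting would produce an eigenvalue in [0, 1]. *)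
have [w [w' [S wL]]] : exists w w', sol 1 w w' /\ 0 <= w L.
  apply: contrapT => /forallNP nw.
  have [|||||||nu [u [v [nu01 S uL]]]] := @kneser R L F (fun t => q t * L) (fun=> 1) L0.
  - by have := itgbleZ L qi; move=> /itgble_ae; apply; apply: ae_inW => t _; rewrite mulrC.
  - move=> nu s; apply: (measurable_funM (measurable_cst _)).
    by apply: measurable_funM; [exact: itgble_measurable qi|exact: measurable_cst].
  - apply: ae_inW => t st nu s; have [h1 h2] := Fle nu t s st.
    by rewrite ger0_norm.
  - apply: ae_inW => t st las s la' s' lal sl; apply: cvgM; first exact: clamp_cvg.
    by apply: cvgMr; apply: clamp_cvg => //; exact: ltW.
  - by move=> x; exact: cvg_cst.
  - move=> u v S; have [W u0 v0] := S.
    have vE x : 0 <= x -> x <= L -> v x = 1.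
      move=> x0 xL; have [_ vg _] := W.
      apply/eqP; rewrite -subr_eq0 -v0 vg//; apply/eqP.
      rewrite (@eq_itg _ _ _ _ (fun=> 0)) ?itg_cst ?mul0r//.
      by move=> t _ _; rewrite /F clamp_neg// mul0r oppr0.
    have [_ _ uv] := W; have := uv 0 L (lexx _) (ltW L0) (lexx _).
    rewrite (@eq_itg _ _ _ _ (fun=> 1)) ?itg_cst ?(ltW L0)//; first by rewrite u0; lra.
    by move=> t t0 tL; rewrite vE// ltW.
  - move=> u v S; rewrite ltNge; apply/negP => uL; apply: (nw u); exists v; split => //.
  - exact: noeig nu01 S uL.
have one : 0 <= (1 : R) <= 1 by rewrite ler01 lexx.
have wL0 : 0 < w L by rewrite lt_neqAle wL andbT eq_sym; apply/eqP; exact: noeig one S.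
exists w, w'; split; first by apply: W21_eq (lin _ _ _ one S wL) => t _ _; rewrite mul1r.
split => // x x0 xL; split; [exact: pos S _ _ _|exact: upper S _ _].
Qed.

(** The solution [w] without eigenvalues vanishes at 0 and leaves no room for [e]. Adding [k * y]
    with y'' = -(q + 1), y(0) = 1, y'(0) = 0 makes the value at 0 positive. Since [y <= 1], -z'' = q
    w + k (q + 1) >= q z + k, and [k >= e * z] for [e = k / Z], where [Z] bounds [z]. *)
Lemma supersolution L q : 0 < L -> L1_nonneg `[0, L] q ->
  (forall nu, nu <= 1 -> ~ dirichlet_eigenvalue 0 L q nu) ->
  exists e z z' h, [/\ 0 < e, W21 0 L z z' (fun t => - h t),
    forall x, 0 <= x -> x <= L -> 0 < z x &
    forall t, 0 < t -> t <= L -> (q t + e) * z t <= h t].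
Proof.
move=> L0 Lq neig; have qi := L1_nonneg_itgble Lq.
have [w [w' [Ww [wL Hw]]]] := no_eigenvalue_pos_sol L0 Lq neig.
have q1i : itgble 0 L (fun t => - (q t + 1)).
  by apply: itgbleN; apply: itgbleD => //; exact: itgble_cst.
have [y [y' [Wy y0 y'0]]] := W21_exists 1 0 (ltW L0) q1i.
have y1 x : 0 <= x -> x <= L -> y x <= 1.
  move=> x0 xL.
  have yc : ae_in (seg 0 L) (fun t => - (q t + 1) <= 0).
    apply: ae_inW => t /seg_sub_itv; rewrite /= in_itv/= => /andP[t0 tL].
    by have := L1_nonneg_ge0 Lq t0 tL; lra.
  by have [_] := concave_u Wy yc (lexx 0) x0 xL; rewrite y0 y'0; lra.
have [Y HY] := cont_on_bounded (ltW L0) (W21_u_cont (ltW L0) Wy).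
have Y0 : 0 <= Y by apply: le_trans (HY 0 _ (ltW L0)).
have [|r r0 Hr] := W21_u_cont (ltW L0) Wy (e := 2^-1) (lexx 0) (ltW L0); first by rewrite invr_gt0.
pose r' := Num.min r L / 2.
have rm0 : 0 < Num.min r L by rewrite lt_min r0.
have r'0 : 0 < r' by rewrite divr_gt0.
have mr : Num.min r L <= r by rewrite ge_min lexx.
have mL : Num.min r L <= L by rewrite ge_min lexx orbT.
have r'r : r' < r by rewrite /r'; lra.
have r'L : r' < L by rewrite /r'; lra.
(* The height at [r'] of the chord of [w] from 0 to [L], hence a lower bound for [w] beyond [r'];
   there [k * y] can cancel at most half of it, and up to [r'] one has [y >= 1/2]. *)
pose m := r' * w L / L.
have m0 : 0 < m by rewrite divr_gt0// mulr_gt0.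
pose k := m / (2 * (Y + 1)).
have Yp : 0 < 2 * (Y + 1) by lra.
have k0 : 0 < k by rewrite divr_gt0.
have kY : k * Y <= m / 2.
  have : k * (2 * (Y + 1)) = m by rewrite /k divfK//; exact: lt0r_neq0.
  by nra.
pose z x := w x + k * y x.
have zpos x : 0 <= x -> x <= L -> 0 < z x.
  move=> x0 xL; rewrite /z; have [h1 h2] := Hw x x0 xL.
  have wx0 : 0 <= w x by rewrite -(pmulr_rge0 _ L0); apply: le_trans h1; rewrite mulr_ge0// ltW.
  have [xr|rx] := leP x r'.
    have := Hr x x0 xL; rewrite subr0 ger0_norm// => /(_ (le_lt_trans xr r'r)).
    rewrite y0 ler_norml => /andP[h3 _].
    have y2 : 2^-1 <= y x by lra.
    by nra.
  have mw : m <= w x.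
    rewrite /m ler_pdivrMr// mulrC [X in _ <= X]mulrC; apply: le_trans h1.
    by rewrite mulrC ler_wpM2r// ltW.
  by have := HY x x0 xL; rewrite ler_norml => /andP[h3 h4]; nra.
have Wz := W21D k Ww Wy; rewrite -/z in Wz.
have [Z HZ] := cont_on_bounded (ltW L0) (W21_u_cont (ltW L0) Wz).
have Z0 : 0 < Z.
  by apply: lt_le_trans (zpos 0 (lexx 0) (ltW L0)) (le_trans (ler_norm _) (HZ 0 (lexx 0) (ltW L0))).
exists (k / Z), z, (fun x => w' x + k * y' x), (fun t => q t * w t + k * (q t + 1)).
split => //; first by rewrite divr_gt0.
  by apply: W21_eq Wz => t _ _; ring.
move=> t t0 tL; have qt := L1_nonneg_ge0 Lq (ltW t0) tL.
have yt := y1 t (ltW t0) tL.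
have kz : k / Z * z t <= k.
  rewrite mulrAC ler_pdivrMr// ler_wpM2l ?(ltW k0)//.
  exact: le_trans (ler_norm _) (HZ t (ltW t0) tL).
have : k * (q t * y t) <= k * q t by rewrite ler_wpM2l ?(ltW k0)// ler_piMr.
rewrite mulrDl {1}/z; lra.
Qed.

Lemma last_zero a b f : a < b -> cont_on a b f -> f a <= 0 -> 0 < f b ->
  exists c, [/\ a <= c, c < b, f c = 0 & forall x, c < x -> x <= b -> 0 < f x].
Proof.
move=> ab cf fa fb.
have cf' : cont_on (- b) (- a) (fun x => f (- x)).
  move=> y e yb ya e0; have [||r r0 Hr] := cf (- y) e _ _ e0; [by lra|by lra|].
  exists r => // t tb ta ty; apply: Hr; [by lra|by lra|].
  by rewrite -opprD normrN.
have [|||c [bc ca fc Hc]] := @first_zero _ (- b) (- a) (fun x => f (- x)) _ cf'.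
- by rewrite ltrN2.
- by rewrite opprK.
- by rewrite opprK.
exists (- c); split => //; [by lra|by lra|].
by move=> x cx xb; have := Hc (- x); rewrite opprK; apply; lra.
Qed.

(** Positivity of a first eigenfunction is not invoked: up to sign, any eigenfunction is positive
    between two neighbouring zeros around a point where it does not vanish, and this is enough for
    testing. *)
Lemma nodal_interval c d q mu : c <= d -> L1_nonneg `[c, d] q ->
  dirichlet_eigenvalue c d q mu ->
  exists c' d' phi psi, [/\ [/\ c <= c', c' < d' & d' <= d],
    W21 c' d' phi psi (fun t => - (mu * q t * phi t)), phi c' = 0, phi d' = 0 &
    forall x, c' < x -> x < d' -> 0 < phi x].
Proof.
move=> cd Lq [phi0 sol [x0 x0cd phix0]]; have qi := L1_nonneg_itgble Lq.
have Fi u : cont_on c d u -> itgble c d (fun t => mu * q t * u t).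
  move=> cu; have := itgbleZ mu (cont_on_itgbleM cd cu qi); move=> /itgble_ae; apply.
  by apply: ae_inW => t _; ring.
have [psi0 [W0 pc pd]] := @dirichlet_solution_W21 _ c d _ phi0 cd Fi sol.
have [phi [psi [W phic phid phix]]] : exists phi psi,
    [/\ W21 c d phi psi (fun t => - (mu * q t * phi t)), phi c = 0, phi d = 0 & 0 < phi x0].
  move: phix0; rewrite neq_lt => /orP[lt0|gt0]; last by exists phi0, psi0.
  exists (fun x => -1 * phi0 x), (fun x => -1 * psi0 x); split.
  - by apply: W21_eq (W21Z (-1) W0) => t _ _; ring.
  - by rewrite pc mulr0.
  - by rewrite pd mulr0.
  - by lra.
move: x0cd; rewrite in_itv/= => /andP[cx xd].
have cx' : c < x0 by rewrite lt_neqAle cx andbT; apply/eqP => h; move: phix; rewrite -h phic ltxx.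
have xd' : x0 < d by rewrite lt_neqAle xd andbT; apply/eqP => h; move: phix; rewrite h phid ltxx.
have cphi := W21_u_cont cd W.
have [||d' [d'1 d'2 d'3 d'4]] := first_zero xd' (cont_on_sub cx (lexx d) cphi) => //.
  by rewrite phid.
have [||c' [c'1 c'2 c'3 c'4]] := last_zero cx' (cont_on_sub (lexx c) xd cphi) => //.
  by rewrite phic.
exists c', d', phi, psi; split => //; first by split => //; exact: lt_trans d'1.
  exact: W21S W.
move=> x c'x xd''; have [h|/ltW h] := leP x x0; first exact: c'4.
exact: d'4.
Qed.

Lemma itg_eq0 a b g : itgble a b g -> (forall t, a < t -> t <= b -> 0 <= g t) ->
  itg a b g = 0 -> ae_in (seg a b) (fun t => g t = 0).
Proof.
move=> gi g0 i0.
have : (\int[leb R]_(x in seg a b) `|(EFin \o g) x|)%E = 0%E.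
  rewrite -[RHS]/(0%:E) -i0 EFin_itg//; apply: eq_integral => t /set_mem.
  rewrite /seg/= in_itv/= => /andP[h1 h2]; congr EFin; rewrite ger0_norm//; exact: g0.
have mg : measurable_fun (seg a b) (EFin \o g) by exact: measurable_int gi.
move=> /(ae_eq_integral_abs _ (measurable_seg a b) mg); apply: filterS => t + st.
by move=> /(_ st) [].
Qed.

(** The parabola in [m] is the lower bound for concave functions from [concave_ge_parabola]. If the
    integral were 0, [q * phi] would vanish a.e., so [phi] would be affine with two zeros, hence
    0. *)
Lemma eigenfunction_mass c d q mu c' d' phi psi : L1_nonneg `[c, d] q ->
  c <= c' -> c' < d' -> d' <= d ->
  W21 c' d' phi psi (fun t => - (mu * q t * phi t)) -> phi c' = 0 -> phi d' = 0 ->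
  (forall x, c' < x -> x < d' -> 0 < phi x) ->
  let m t := q t * phi t * ((t - c) * (d - t)) in
  itgble c' d' m /\ 0 < itg c' d' m.
Proof.
move=> Lq cc' cd' d'd W pc pd pp m.
have qi : itgble c' d' q by apply: itgbleS (L1_nonneg_itgble Lq).
have cphi := W21_u_cont (ltW cd') W.
have mi : itgble c' d' m.
  have cw : cont_on c' d' (fun t => (t - c) * (d - t)).
    apply: (@cont_on_lip _ _ _ _ (2 * (d - c))) => x y c'x xy yd'.
    rewrite (_ : _ - _ = (d + c - y - x) * (y - x)); last by ring.
    rewrite normrM (ger0_norm (_ : 0 <= y - x)) ?subr_ge0// ler_wpM2r ?subr_ge0//.
    by rewrite ler_norml; apply/andP; split; lra.
  have := cont_on_itgbleM (ltW cd') cw (cont_on_itgbleM (ltW cd') cphi qi).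
  by move=> /itgble_ae; apply; apply: ae_inW => t _; rewrite /m; ring.
split => //.
have phi0 t : c' < t -> t <= d' -> 0 <= phi t.
  move=> ct; rewrite le_eqVlt => /predU1P[->|td]; first by rewrite pd.
  by apply/ltW/pp.
have m0 t : c' < t -> t <= d' -> 0 <= m t.
  move=> ct td; rewrite /m !mulr_ge0//; [|exact: phi0|lra|lra].
  by apply: L1_nonneg_ge0 Lq _ _; lra.
rewrite lt_neqAle eq_sym itg_ge0// ?andbT; last first.
  by apply: ae_inW => t; rewrite /seg/= in_itv/= => /andP[? ?]; exact: m0.
apply/eqP => i0; have mz := itg_eq0 mi m0 i0.
have gz : ae_in (seg c' d') (fun t => - (mu * q t * phi t) = 0).
  apply: ae_inS mz => t; rewrite /seg/= in_itv/= => /andP[ct td].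
  rewrite /m => /eqP; rewrite mulf_eq0 => /orP[/eqP qp|].
    by rewrite -mulrA qp mulr0 oppr0.
  rewrite mulf_eq0 => /orP[/eqP|/eqP h]; first by lra.
  have -> : t = d' by lra.
  by rewrite pd mulr0 oppr0.
have W' := W21_eq_ae gz W.
pose x := (c' + d') / 2.
have [h1 h2] : c' < x /\ x < d' by rewrite /x; split; lra.
have psiE y : c' <= y -> y <= d' -> psi y = psi c'.
  move=> cy yd; have [_ /(_ c' y (lexx _) cy yd) + _] := W'.
  by rewrite itg_cst// mul0r; lra.
have phiE y : c' <= y -> y <= d' -> phi y = psi c' * (y - c').
  move=> cy yd; have [_ _ /(_ c' y (lexx _) cy yd)] := W'.
  rewrite (@eq_itg _ _ _ _ (fun=> psi c')); last first.
    by move=> t ct ty; apply: psiE; [exact: ltW|exact: le_trans yd].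
  by rewrite itg_cst// pc subr0.
have := phiE d' (ltW cd') (lexx _); rewrite pd => /esym/eqP.
rewrite mulf_eq0 subr_eq0 (gt_eqF cd') orbF => /eqP p0.
by have := pp x h1 h2; rewrite phiE ?p0 ?mul0r ?ltxx// ltW.
Qed.

End linear.

(** * Estimates for the nonlinear equation *)

Section nonlinear.
Context {R : realType}.
Implicit Types (a b c d e r s t L x y al : R) (u v q k : R -> R) (f F : R -> R -> R).

Lemma cont_on_cst a b (k : R) : cont_on a b (fun=> k).
Proof. by move=> x e _ _ e0; exists 1 => // y _ _ _; rewrite subrr normr0 ltW. Qed.

Lemma cont_on_id a b : cont_on a b (fun x : R => x).
Proof. by move=> x e _ _ e0; exists e => // y _ _ /ltW. Qed.

Lemma cont_on_norm a b (f : R -> R) : cont_on a b f -> cont_on a b (fun x => `|f x|).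
Proof.
move=> cf x e ax xb e0; have [d d0 H] := cf x e ax xb e0; exists d => // y ay yb yx.
by apply: le_trans (H y ay yb yx); exact: ler_dist_dist.
Qed.

Lemma left_end_slope a b u v g : a < b -> W21 a b u v g -> u a = 0 ->
  (forall x, a <= x -> x <= b -> 0 <= u x) -> 0 <= v a.
Proof.
move=> ab W ua up; rewrite leNgt; apply/negP => va.
have [||r r0 [rb Hr]] := pos_slope ab (W21Z (-1) W).
- by rewrite ua mulr0.
- by lra.
- by have := Hr (a + r); have := up (a + r); lra.
Qed.

Lemma right_end_slope a b u v g : a < b -> W21 a b u v g -> u b = 0 ->
  (forall x, a <= x -> x <= b -> 0 <= u x) -> v b <= 0.
Proof.
move=> ab W ub up; rewrite leNgt; apply/negP => vb.
have v2 : 0 < v b / 2 by rewrite divr_gt0.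
have [r r0 Hr] := W21_v_cont W (ltW ab) (lexx b) v2.
pose y := Num.max a (b - r / 2).
have yb : y < b by rewrite /y gt_max ab /=; lra.
have ay : a <= y by rewrite /y le_max lexx.
have yr : b - r / 2 <= y by rewrite /y le_max lexx orbT.
have vi := W21_v_itgble W ay (ltW yb) (lexx b).
have : v b / 2 * (b - y) <= u b - u y.
  have [_ _ ->//] := W; last exact: ltW.
  rewrite -itg_cst; last exact: ltW.
  apply: le_itg => //; first exact: itgble_cst.
  apply: ae_inW => t; rewrite /seg/= in_itv/= => /andP[yt tb].
  have := Hr t (le_trans ay (ltW yt)) tb; rewrite distrC ger0_norm ?subr_ge0//.
  by move=> /(_ ltac:(lra)); rewrite ler_norml => /andP[]; lra.
have := up y ay (ltW yb); rewrite ub.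
have : 0 < v b / 2 * (b - y) by rewrite mulr_gt0// subr_gt0.
by lra.
Qed.

Lemma linear_where_nonpos a b F u v : a <= b ->
  ae_in (seg a b) (fun t => forall s, s <= 0 -> F t s = 0) ->
  W21 a b u v (fun t => - F t (u t)) -> (forall x, a < x -> x <= b -> u x <= 0) ->
  u b = u a + v a * (b - a).
Proof.
move=> ab F0 W un.
have W0 : W21 a b u v (fun=> 0).
  apply: W21_eq_ae W; apply: ae_inS F0 => t; rewrite /seg/= in_itv/= => /andP[h1 h2] ->.
    by rewrite oppr0.
  exact: un.
have c0 : ae_in (seg a b) (fun t => (fun=> 0 : R) t <= 0) by exact: ae_inW.
have vE x : a <= x -> x <= b -> v x = v a.
  by move=> ax xb; have [_ /(_ a x (lexx _) ax xb) + _] := W0; rewrite itg_cst// mul0r; lra.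
have [h1 h2] := concave_u W0 c0 (lexx a) ab (lexx b).
by rewrite (vE b) // in h1; lra.
Qed.

(** Where [u <= 0] the equation reads u'' = 0. Returning to a nonnegative value would make [u]
    affine between two zeros around [x], hence 0 at [x]. *)
Lemma negative_stays L F u v x : 
  ae_in (seg 0 L) (fun t => forall s, s <= 0 -> F t s = 0) ->
  W21 0 L u v (fun t => - F t (u t)) -> u 0 = 0 -> 0 <= x -> x <= L -> u x < 0 -> u L < 0.
Proof.
move=> F0 W u0 x0 xL ux; rewrite ltNge; apply/negP => uL.
have L0 := le_trans x0 xL.
have x0' : 0 < x by rewrite lt_neqAle x0 andbT; apply/eqP => h; move: ux; rewrite -h u0 ltxx.
have xL' : x < L by rewrite lt_neqAle xL andbT; apply/eqP => h; move: ux; rewrite h ltNge uL.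
have cu := cont_onN (W21_u_cont L0 W).
have [||y [y1 y2 y3 y4]] := last_zero x0' (cont_on_sub (lexx _) xL cu).
- by rewrite u0 oppr0.
- by rewrite oppr_gt0.
have [||z [z1 z2 z3 z4]] := first_zero xL' (cont_on_sub x0 (lexx _) cu).
- by rewrite oppr_gt0.
- by rewrite oppr_le0.
have un t : y < t -> t < z -> u t < 0.
  move=> yt tz; rewrite -oppr_gt0; have [h|/ltW h] := leP t x; first exact: y4.
  exact: z4.
have lin b : y <= b -> b <= z -> u b = u y + v y * (b - y).
  move=> yb bz; apply: (@linear_where_nonpos _ _ F).
  - by [].
  - by apply: seg_ae_sub F0 => //; exact: le_trans z2.
  - by apply: W21S W => //; exact: le_trans z2.
  - move=> t yt tb; have [tz|zt] := ltP t z; first exact/ltW/un.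
    have -> : t = z by apply/le_anti; rewrite zt andbT; exact: le_trans bz.
    by lra.
have yz : y <= z by lra.
have := lin x (ltW y2) (ltW z1); have := lin z yz (lexx z).
have : u y = 0 by lra.
have : u z = 0 by lra.
move=> -> ->; rewrite !add0r => /esym/eqP; rewrite mulf_eq0 => /orP[/eqP ->|/eqP]; last by lra.
by rewrite mul0r => ux0; move: ux; rewrite ux0 ltxx.
Qed.

Lemma nat_ge_half (A : R) : exists n : nat, A <= n.+1%:R / 2.
Proof.
exists (Num.bound (`|A| * 2)); rewrite ler_pdivlMr//.
apply: le_trans (_ : `|A| * 2 <= _); first by rewrite ler_wpM2r// ler_norm.
apply: (le_trans (ltW (archi_boundP _))); first by rewrite mulr_ge0.
by rewrite ler_nat.
Qed.

Lemma itg_incr a b g x y : itgble a b g -> (forall t, a < t -> t <= b -> 0 <= g t) ->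
  a <= x -> x <= y -> y <= b -> itg a x g <= itg a y g.
Proof.
move=> gi g0 ax xy yb; have ay := le_trans ax xy.
apply: itg_mono => //; first exact: itgbleS gi.
apply: ae_inW => t; rewrite /seg/= in_itv/= => /andP[h1 h2]; apply: g0 => //.
exact: le_trans yb.
Qed.

(** With a bound on [g] from above only, [|v|] cannot be estimated: the slope may fall without
    control on [J]. Instead [v] is replaced by its nondecreasing majorant [P], and Gronwall is
    applied to [u + P]. [C] depends only on [L] and [k]; [x1] is free, so that the bound can be used
    while smallness of [u] is still being propagated. *)
Lemma apriori_upper L (e1 k : R -> R) : 0 <= L -> itgble 0 L e1 -> itgble 0 L k ->
  (forall t, 0 < t -> t <= L -> 0 <= e1 t) -> (forall t, 0 < t -> t <= L -> 0 <= k t) ->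
  exists2 C, 0 < C & forall x1 al u v g, 0 <= x1 -> x1 <= L -> 0 <= al ->
    W21 0 x1 u v g -> u 0 = 0 -> v 0 = al -> (forall x, 0 <= x -> x <= x1 -> 0 <= u x) ->
    ae_in (seg 0 x1) (fun t => g t <= e1 t + u t * k t) ->
    forall x, 0 <= x -> x <= x1 -> u x <= C * (al + 2 * itg 0 L e1).
Proof.
move=> L0 e1i ki e10 k0.
pose K x := x + itg 0 x k.
have [n Hn] := nat_ge_half (K L - K 0).
exists (2 ^+ n.+1); first by rewrite exprn_gt0.
move=> x1 al u v g x10 x1L al0 W u0 v0 up gle x x0 xx1.
have [gi vg uv] := W.
have e1i1 : itgble 0 x1 e1 by exact: itgbleS e1i.
have ki1 : itgble 0 x1 k by exact: itgbleS ki.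
pose m t := e1 t + u t * k t.
have cu := W21_u_cont x10 W.
have uki : itgble 0 x1 (fun t => u t * k t) by exact: cont_on_itgbleM.
have mi : itgble 0 x1 m by exact: itgbleD.
have m0 t : 0 < t -> t <= x1 -> 0 <= m t.
  move=> t0 tx1; have tL := le_trans tx1 x1L.
  by rewrite addr_ge0 ?e10// mulr_ge0 ?k0// up// ltW.
pose P x := al + itg 0 x m.
have P0 y : 0 <= y -> y <= x1 -> 0 <= P y.
  move=> y0 yx; rewrite addr_ge0//; have := itg_incr mi m0 (lexx 0) y0 yx.
  by rewrite itgg.
have Pmono y z : 0 <= y -> y <= z -> z <= x1 -> P y <= P z.
  by move=> y0 yz zx; rewrite lerD2l; exact: itg_incr mi m0 y0 yz zx.
have vP y : 0 <= y -> y <= x1 -> v y <= P y.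
  move=> y0 yx; have := vg 0 y (lexx _) y0 yx.
  have : itg 0 y g <= itg 0 y m.
    by apply: le_itg; [exact: itgbleS gi|exact: itgbleS mi|exact: seg_ae_sub gle].
  by rewrite /P v0; lra.
set E := itg 0 L e1.
have E0 : 0 <= E.
  apply: itg_ge0 => //; apply: ae_inW => t; rewrite /seg/= in_itv/= => /andP[? ?]; exact: e10.
pose p y := u y + P y.
have p0 y : 0 <= y -> y <= x1 -> 0 <= p y by move=> y0 yx; rewrite addr_ge0 ?up ?P0.
have Kmono a b : 0 <= a -> a <= b -> b <= L -> K a <= K b.
  by move=> a0 ab bL; rewrite lerD//; exact: itg_incr ki k0 a0 ab bL.
have H : p x + 2 * E <= 2 ^+ n.+1 * (p 0 + 2 * E).
  apply: (@gronwall _ n 0 x1 K p E) => //.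
  - by apply: cont_onD; [exact: cont_on_id|exact: itg_cont_on].
  - apply: cont_onD => //; apply: cont_onD; [exact: cont_on_cst|exact: itg_cont_on].
  - by move=> a b a0 ab bx; apply: Kmono => //; exact: le_trans x1L.
  - move=> a b M a0 ab bx HM.
    have b0 := le_trans a0 ab.
    have M0 : 0 <= M by apply: le_trans (p0 b b0 bx) (HM b ab (lexx b)).
    have ub : u b - u a <= (b - a) * M.
      rewrite uv// mulrC -itg_cst//; apply: le_itg.
      - exact: W21_v_itgble W _ _ _.
      - exact: itgble_cst.
      - apply: ae_inW => t; rewrite /seg/= in_itv/= => /andP[/ltW at' tb].
        have t0 := le_trans a0 at'; have tx := le_trans tb bx.
        apply: le_trans (vP t t0 tx) _; apply: le_trans (HM t at' tb).
        by rewrite /p lerDr up.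
    have Pb : P b - P a <= E + itg a b k * M.
      rewrite /P (@itg_cat _ 0 a b m)//; last exact: itgbleS mi.
      have -> : al + (itg 0 a m + itg a b m) - (al + itg 0 a m) = itg a b m by ring.
      have e1ab : itgble a b e1 by exact: itgbleS e1i1.
      have kab : itgble a b k by exact: itgbleS ki1.
      have ukab : itgble a b (fun t => u t * k t) by exact: itgbleS uki.
      rewrite /m itgD// lerD//.
        apply: itg_mono => //; first exact: le_trans x1L.
        by apply: ae_inW => t; rewrite /seg/= in_itv/= => /andP[? ?]; exact: e10.
      rewrite mulrC -itgZ//; apply: le_itg => //; first exact: itgbleZ.
      apply: ae_inW => t; rewrite /seg/= in_itv/= => /andP[at' tb].
      have t0 := le_lt_trans a0 at'; have tx := le_trans tb bx.
      apply: ler_wpM2r; first by apply: k0 => //; exact: le_trans x1L.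
      apply: le_trans (HM t (ltW at') tb); rewrite /p lerDl; apply: P0 => //; exact: ltW.
    have Kab : K b - K a = (b - a) + itg a b k.
      by rewrite /K (@itg_cat _ 0 a b k)//; [ring|exact: itgbleS ki1].
    by rewrite Kab /p; lra.
  - apply: le_trans Hn; rewrite lerD2r; exact: Kmono.
have : p 0 = al by rewrite /p u0 /P itgg; lra.
move=> pE; rewrite pE in H; have := P0 x x0 xx1; move: H; rewrite /p; lra.
Qed.

(** With [g] bounded on both sides, [u + |v|] itself obeys the inequality of [gronwall_back]. *)
Lemma apriori_back c (e1 k : R -> R) : 0 <= c -> itgble 0 c e1 -> itgble 0 c k ->
  (forall t, 0 < t -> t <= c -> 0 <= e1 t) -> (forall t, 0 < t -> t <= c -> 0 <= k t) ->
  exists2 C, 0 < C & forall u v g, W21 0 c u v g ->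
    (forall x, 0 <= x -> x <= c -> 0 <= u x) ->
    ae_in (seg 0 c) (fun t => `|g t| <= e1 t + u t * k t) ->
    v 0 <= C * (u c + `|v c| + 2 * itg 0 c e1).
Proof.
move=> c0 e1i ki e10 k0.
pose K x := x + itg 0 x k.
have [n Hn] := nat_ge_half (K c - K 0).
exists (2 ^+ n.+1); first by rewrite exprn_gt0.
move=> u v g W up gle; have [gi vg uv] := W.
have cu := W21_u_cont c0 W.
set E := itg 0 c e1.
have E0 : 0 <= E.
  apply: itg_ge0 => //; apply: ae_inW => t; rewrite /seg/= in_itv/= => /andP[? ?]; exact: e10.
pose p y := u y + `|v y|.
have p0 y : 0 <= y -> y <= c -> 0 <= p y by move=> y0 yx; rewrite addr_ge0 ?up.
have H : p 0 + 2 * E <= 2 ^+ n.+1 * (p c + 2 * E).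
  apply: (@gronwall_back _ n 0 c K p E) => //.
  - by apply: cont_onD; [exact: cont_on_id|exact: itg_cont_on].
  - by apply: cont_onD => //; apply: cont_on_norm; exact: W21_v_cont W.
  - move=> a b a0 ab bx; rewrite lerD//; exact: itg_incr ki k0 a0 ab bx.
  - move=> a b M a0 ab bx HM.
    have b0 := le_trans a0 ab.
    have M0 : 0 <= M by apply: le_trans (p0 b b0 bx) (HM b ab (lexx b)).
    have vi := W21_v_itgble W a0 ab bx.
    have ub : u a - u b <= (b - a) * M.
      have -> : u a - u b = itg a b (fun t => - v t) by rewrite itgN// -uv//; ring.
      rewrite mulrC -itg_cst//; apply: le_itg; [exact: itgbleN|exact: itgble_cst|].
      apply: ae_inW => t; rewrite /seg/= in_itv/= => /andP[/ltW at' tb].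
      apply: le_trans (HM t at' tb); rewrite /p.
      have := up t (le_trans a0 at') (le_trans tb bx).
      by have := ler_norm (- v t); rewrite normrN; lra.
    have vb : `|v a| - `|v b| <= E + itg a b k * M.
      apply: le_trans (lerB_dist _ _) _; rewrite distrC.
      apply: le_trans (W21_v_le W a0 ab bx) _.
      have e1ab : itgble a b e1 by exact: itgbleS e1i.
      have kab : itgble a b k by exact: itgbleS ki.
      have ukab : itgble a b (fun t => u t * k t).
        by apply: cont_on_itgbleM => //; exact: cont_on_sub cu.
      apply: (@le_trans _ _ (itg a b (fun t => e1 t + u t * k t))).
        apply: le_itg; [apply: itgble_norm; exact: itgbleS gi|exact: itgbleD|].
        exact: seg_ae_sub gle.
      rewrite itgD// lerD//.
        apply: itg_mono => //.
        by apply: ae_inW => t; rewrite /seg/= in_itv/= => /andP[? ?]; exact: e10.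
      rewrite mulrC -itgZ//; apply: le_itg => //; first exact: itgbleZ.
      apply: ae_inW => t; rewrite /seg/= in_itv/= => /andP[at' tb].
      have t0 := le_lt_trans a0 at'; have tx := le_trans tb bx.
      apply: ler_wpM2r; first exact: k0.
      by apply: le_trans (HM t (ltW at') tb); rewrite /p lerDl.
    have Kab : K b - K a = (b - a) + itg a b k.
      by rewrite /K (@itg_cat _ 0 a b k)//; [ring|exact: itgbleS ki].
    by rewrite Kab /p; lra.
have := ler_norm (v 0); have := up 0 (lexx 0) c0; move: H; rewrite /p; lra.
Qed.

Lemma at_right0_bound (U : set R) : (0 : R)^'+ U ->
  exists2 r, 0 < r & forall s, 0 < s -> s <= r -> U s.
Proof.
move=> /nbhs_ballP[r /= r0 H]; exists (r / 2); first by rewrite divr_gt0.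
move=> s s0 sr; apply: H => //; rewrite /ball/= sub0r normrN gtr0_norm//; lra.
Qed.

Lemma ae_seg_itv a b (P : R -> Prop) : ae_in `[a, b] P -> ae_in (seg a b) P.
Proof. by apply: ae_in_sub => //; exact: seg_sub_itv. Qed.

Lemma lower_near0 L f qm : L1_nonneg `[0, L] qm ->
  ae_in `[0, L] (fun x => f x 0 = 0) -> unif_liminf_ge 0^'+ `[0, L] f (fun x => - qm x) ->
  exists2 r, 0 < r & ae_in (seg 0 L) (fun t => forall s, 0 <= s -> s <= r ->
    - f t s <= s * (qm t + 1)).
Proof.
move=> Lq f0 /(_ 1 ltr01)[U /at_right0_bound[r r0 Hr] HU]; exists r => //.
apply: (@ae_in2 _ _ _ _ _ _ (ae_seg_itv f0) (ae_seg_itv HU)) => t _ ft0 Ht s s0 sr.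
move: s0; rewrite le_eqVlt => /predU1P[<-|s0]; first by rewrite ft0 mul0r oppr0.
have := Ht s s0 (Hr s s0 sr); rewrite ler_pdivlMr//; lra.
Qed.

Lemma upper_near0 L f q e : 0 < e ->
  ae_in `[0, L] (fun x => f x 0 = 0) -> unif_limsup_le 0^'+ `[0, L] f q ->
  exists2 r, 0 < r & ae_in (seg 0 L) (fun t => forall s, 0 <= s -> s <= r ->
    f t s <= s * (q t + e)).
Proof.
move=> e0 f0 /(_ e e0)[U /at_right0_bound[r r0 Hr] HU]; exists r => //.
apply: (@ae_in2 _ _ _ _ _ _ (ae_seg_itv f0) (ae_seg_itv HU)) => t _ ft0 Ht s s0 sr.
move: s0; rewrite le_eqVlt => /predU1P[<-|s0]; first by rewrite ft0 mul0r.
by have := Ht s s0 (Hr s s0 sr); rewrite ler_pdivrMr// mulrC.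
Qed.

(** If [u L <= 0], let [x1] be the first zero after 0. For the supersolution [z], the Wronskian
    [v z - u z'] starts at [al * z 0 > 0] and ends at [v x1 * z x1 <= 0], while its derivative
    [u h - F z] is nonnegative as long as [u <= r]. [F] agrees with [f] only on [0, r], so that
    truncated nonlinearities are covered. *)
Lemma small_slope L f q qm : 0 < L -> L1_nonneg `[0, L] q -> L1_nonneg `[0, L] qm ->
  (forall nu, nu <= 1 -> ~ dirichlet_eigenvalue 0 L q nu) ->
  ae_in `[0, L] (fun x => f x 0 = 0) -> unif_liminf_ge 0^'+ `[0, L] f (fun x => - qm x) ->
  unif_limsup_le 0^'+ `[0, L] f q ->
  exists al r, [/\ 0 < al, 0 < r & forall F u v,
    (forall t s, 0 <= s -> s <= r -> F t s = f t s) ->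
    W21 0 L u v (fun t => - F t (u t)) -> u 0 = 0 -> v 0 = al -> 0 < u L].
Proof.
move=> L0 Lq Lqm neig f0 fm fp.
have [e [z [z' [h [e0 Wz zpos Hh]]]]] := supersolution L0 Lq neig.
have [r1 r10 H1] := lower_near0 Lqm f0 fm.
have [r2 r20 H2] := upper_near0 e0 f0 fp.
pose r := Num.min r1 r2.
have r0 : 0 < r by rewrite lt_min r10.
have rr1 : r <= r1 by rewrite ge_min lexx.
have rr2 : r <= r2 by rewrite ge_min lexx orbT.
have qmi := L1_nonneg_itgble Lqm.
have ki : itgble 0 L (fun t => qm t + 1) by apply: itgbleD => //; exact: itgble_cst.
have k0 t : 0 < t -> t <= L -> 0 <= qm t + 1.
  by move=> t0 tL; have := L1_nonneg_ge0 Lqm (ltW t0) tL; lra.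
have [C C0 HC] := apriori_upper (ltW L0) (itgble_cst 0 L 0) ki (fun _ _ _ => lexx 0) k0.
exists (r / (2 * C)), r; split => //; first by rewrite divr_gt0// mulr_gt0.
set al := r / _; have al0 : 0 < al by rewrite divr_gt0// mulr_gt0.
have Cal : C * al = r / 2 by rewrite /al; field; exact: lt0r_neq0.
move=> F u v FE W u0 v0; rewrite ltNge; apply/negP => uL.
have v0p : 0 < v 0 by rewrite v0.
have u00 : 0 <= u 0 by rewrite u0.
have [d d0 []] := pos_slope L0 W u00 v0p; rewrite add0r => dL Hd.
have cu := W21_u_cont (ltW L0) W.
have ud : 0 < u d by apply: Hd.
have dL' : d < L by rewrite lt_neqAle dL andbT; apply/eqP => dE; move: ud; rewrite dE ltNge uL.
have [x1 [x1d x1L ux1 Hx1]] := first_zero dL' (cont_on_sub (ltW d0) (lexx L) cu) ud uL.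
have x10 : 0 < x1 by exact: lt_trans x1d.
have up x : 0 <= x -> x <= x1 -> 0 <= u x.
  move=> x0 xx1; move: x0; rewrite le_eqVlt => /predU1P[<-//|x0].
  have [xd|/ltW dx] := leP x d; first exact/ltW/Hd.
  by move: xx1; rewrite le_eqVlt => /predU1P[->|xx1]; [rewrite ux1|exact/ltW/Hx1].
(* Continuation: up to the first point [y] with [u y = r] the linear bound holds, and it yields
   [u y <= C * al = r / 2]. *)
have ur x : 0 <= x -> x <= x1 -> u x < r.
  move=> x0 xx1; rewrite ltNge; apply/negP => rx.
  have xL := le_trans xx1 x1L.
  have x0' : 0 < x by rewrite lt_neqAle x0 andbT; apply/eqP => xE; move: rx; rewrite -xE u0; lra.
  have cru : cont_on 0 x (fun y => r - u y).
    by apply: cont_onD; [exact: cont_on_cst|apply: cont_onN; exact: cont_on_sub cu].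
  have [||y [y0 yx uy Hy]] := first_zero x0' cru; [by rewrite u0; lra|by lra|].
  have yL := le_trans yx xL.
  have := HC y al u v _ (ltW y0) yL (ltW al0) (W21S (lexx 0) yL W) u0 v0.
  rewrite itg_cst ?(ltW L0)// mul0r mulr0 addr0 Cal.
  move=> /(_ _ _ y (ltW y0) (lexx y)) HH.
  have : u y <= r / 2.
    apply: HH; first by move=> t t0 ty; apply: up => //; exact: le_trans (le_trans ty yx) xx1.
    apply: ae_inS (seg_ae_sub (lexx 0) yL H1) => t; rewrite /seg/= in_itv/= => /andP[t0 ty] Ht.
    have ut : u t <= r.
      move: ty; rewrite le_eqVlt => /predU1P[->|ty]; first by lra.
      by have := Hy t (ltW t0) ty; lra.
    have ut0 : 0 <= u t by apply: up; [exact: ltW|exact: le_trans (le_trans ty yx) xx1].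
    by rewrite add0r FE//; apply: Ht => //; exact: le_trans rr1.
  by lra.
have W1 := W21S (lexx 0) x1L W; have Wz1 := W21S (lexx 0) x1L Wz.
have vx1 : v x1 <= 0 by apply: right_end_slope x10 W1 ux1 up.
have [wi wE] := wronskian (ltW x10) W1 Wz1.
have : 0 <= itg 0 x1 (fun t => - F t (u t) * z t - u t * - h t).
  apply: itg_ge0 => //.
  apply: ae_inS (seg_ae_sub (lexx 0) x1L H2) => t; rewrite /seg/= in_itv/= => /andP[t0 tx] Ht.
  have tL := le_trans tx x1L.
  have ut0 := up t (ltW t0) tx; have utr := ltW (ur t (ltW t0) tx).
  have zt := ltW (zpos t (ltW t0) tL).
  have Ft : F t (u t) <= u t * (q t + e) by rewrite FE//; apply: Ht => //; exact: le_trans rr2.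
  have h1 : F t (u t) * z t <= u t * (q t + e) * z t by rewrite ler_wpM2r.
  have h2 : u t * ((q t + e) * z t) <= u t * h t by rewrite ler_wpM2l// Hh.
  rewrite mulrN opprK mulNr; move: h1 h2; rewrite mulrA; lra.
rewrite -wE ux1 u0 v0 !mul0r !subr0.
have : 0 < al * z 0 by rewrite mulr_gt0// zpos// ltW.
have : v x1 * z x1 <= 0 by rewrite mulr_le0_ge0// ltW// zpos// ltW.
lra.
Qed.

(** At an interior zero [x1] also [v x1 = 0]. Just to the left, [- v] is at most an integral of
    [(qm + 1) * u], hence at most [max u / (2 L)]; one more integration gives
    [max u <= max u / 2]. *)
Lemma positive_solution L f qm u v : 0 < L -> L1_nonneg `[0, L] qm ->
  ae_in `[0, L] (fun x => f x 0 = 0) -> unif_liminf_ge 0^'+ `[0, L] f (fun x => - qm x) ->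
  W21 0 L u v (fun t => - f t (u t)) -> u 0 = 0 -> 0 < v 0 ->
  (forall x, 0 <= x -> x <= L -> 0 <= u x) ->
  forall x, 0 < x -> x < L -> 0 < u x.
Proof.
move=> L0 Lqm f0 fm W u0 v0 up x x0 xL; rewrite ltNge; apply/negP => ux.
have [r r0 H] := lower_near0 Lqm f0 fm.
have u00 : 0 <= u 0 by rewrite u0.
have [d d0 []] := pos_slope L0 W u00 v0; rewrite add0r => dL Hd.
have cu := W21_u_cont (ltW L0) W.
have dx : d < x by rewrite ltNge; apply/negP => xd; move: (Hd x x0 xd); rewrite ltNge ux.
have [x1 [x1d x1x ux1 Hx1]] :=
  first_zero dx (cont_on_sub (ltW d0) (ltW xL) cu) (Hd d d0 (lexx d)) ux.
have x10 : 0 < x1 by exact: lt_trans x1d.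
have x1L : x1 < L by exact: le_lt_trans xL.
have vx1 : v x1 = 0.
  apply/le_anti/andP; split.
    apply: right_end_slope x10 (W21S (lexx 0) (ltW x1L) W) ux1 _ => t t0 tx.
    by apply: up => //; exact: le_trans (ltW x1L).
  apply: left_end_slope x1L (W21S (ltW x10) (lexx L) W) ux1 _ => t t0 tx.
  by apply: up => //; apply: le_trans t0; exact: ltW.
have qmi := L1_nonneg_itgble Lqm.
have ki : itgble 0 L (fun t => qm t + 1) by apply: itgbleD => //; exact: itgble_cst.
have k0 t : 0 < t -> t <= L -> 0 <= qm t + 1.
  by move=> t0 tL; have := L1_nonneg_ge0 Lqm (ltW t0) tL; lra.
have eL : 0 < (2 * L)^-1 by rewrite invr_gt0 mulr_gt0.
have [d1 d10 Hd1] := itg_cont ki eL.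
have [d2 d20 Hd2] := cu x1 r (ltW x10) (ltW x1L) r0.
(* [d1] keeps the integral of [qm + 1] below [1 / (2 L)], [d2] keeps [u <= r], and [x1 - d] keeps
   [y] where [u > 0], so that the maximum of [u] on [y, x1] is positive. *)
pose m := Num.min (Num.min d1 d2 / 2) (x1 - d).
have m0 : 0 < m by rewrite lt_min divr_gt0 ?lt_min ?d10//= subr_gt0.
have mm : m <= Num.min d1 d2 / 2 by rewrite ge_min lexx.
have m3 : m <= x1 - d by rewrite ge_min lexx orbT.
have m1 : m < d1 by have : Num.min d1 d2 <= d1; [rewrite ge_min lexx|lra].
have m2 : m < d2 by have : Num.min d1 d2 <= d2; [rewrite ge_min lexx orbT|lra].
pose y := x1 - m.
have yx1 : y < x1 by rewrite /y; lra.
have y0 : 0 < y by rewrite /y; lra.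
have [p [yp px1 Hp]] := cont_on_max (ltW yx1) (cont_on_sub (ltW y0) (ltW x1L) cu).
have up0 : 0 < u p.
  apply: lt_le_trans (Hp y (lexx y) (ltW yx1)); apply: Hx1 => //.
  by rewrite /y; lra.
have kb t : y <= t -> t <= x1 -> itg t x1 (fun t => qm t + 1) <= (2 * L)^-1.
  move=> yt tx; have t0 : 0 <= t by exact: le_trans (ltW y0) yt.
  apply: le_trans (ltW (Hd1 t x1 t0 tx (ltW x1L) _)); last by rewrite /y in yt; lra.
  have kt : itgble t x1 (fun t => qm t + 1) by apply: itgbleS ki => //; exact: ltW.
  by apply: le_itg => //; [exact: itgble_norm|apply: ae_inW => s _; exact: ler_norm].
have vlow t : y <= t -> t <= x1 -> - v t <= u p * (2 * L)^-1.
  move=> yt tx; have t0 : 0 <= t by exact: le_trans (ltW y0) yt.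
  have [gi vg _] := W; have := vg t x1 t0 tx (ltW x1L); rewrite vx1 sub0r => ->.
  apply: (@le_trans _ _ (u p * itg t x1 (fun t => qm t + 1))); last first.
    by rewrite ler_wpM2l ?(ltW up0)// kb.
  have kt : itgble t x1 (fun t => qm t + 1) by apply: itgbleS ki => //; exact: ltW.
  rewrite -itgZ//; apply: le_itg; [exact: itgbleS t0 (ltW x1L) gi|exact: itgbleZ|].
  apply: ae_inS (seg_ae_sub t0 (ltW x1L) H) => s; rewrite /seg/= in_itv/= => /andP[ts sx] Hs.
  have s0 : 0 < s by exact: le_lt_trans ts.
  have sL : s <= L by exact: le_trans (ltW x1L).
  have us0 := up s (ltW s0) sL.
  have usr : u s <= r.
    have := Hd2 s (ltW s0) sL; rewrite distrC ger0_norm ?subr_ge0// ux1 subr0.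
    move=> /(_ ltac:(rewrite /y in yt; lra)); exact: le_trans (ler_norm _).
  apply: le_trans (Hs (u s) us0 usr) _; rewrite ler_wpM2r ?k0//.
  by apply: Hp => //; exact: le_trans yt (ltW ts).
have p0 : 0 <= p by exact: le_trans (ltW y0) yp.
have vi := W21_v_itgble W p0 px1 (ltW x1L).
have : u p <= u p * (2 * L)^-1 * (x1 - p).
  have [_ _ uv] := W; have := uv p x1 p0 px1 (ltW x1L); rewrite ux1 sub0r => upE.
  rewrite -[leLHS]opprK upE -itgN// -itg_cst//; apply: le_itg; [exact: itgbleN|exact: itgble_cst|].
  apply: ae_inW => t; rewrite /seg/= in_itv/= => /andP[/ltW pt tx].
  by apply: vlow => //; exact: le_trans yp pt.
have : (2 * L)^-1 * (x1 - p) <= 2^-1.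
  rewrite invfM -mulrA ler_piMr ?invr_ge0// mulrC ler_pdivrMr// mul1r; lra.
by rewrite -mulrA; nra.
Qed.

(* Compare with the tent through (c, 0), (p, u p), (d, 0). *)
Lemma concave_ge_parabola c d u v g : W21 c d u v g ->
  ae_in (seg c d) (fun t => g t <= 0) -> (forall x, c <= x -> x <= d -> 0 <= u x) ->
  forall p t, c <= p -> p <= d -> c <= t -> t <= d ->
    u p * ((t - c) * (d - t)) <= (d - c) ^+ 2 * u t.
Proof.
move=> W gle0 up p t cp pd' ct td.
have cd : c <= d by exact: le_trans pd'.
have uc := up c (lexx c) cd; have ud := up d cd (lexx d).
set D := (d - c) ^+ 2; have ut := up t ct td.
have tc0 : 0 <= t - c by lra.
have dt0 : 0 <= d - t by lra.
have dc0 : 0 <= d - c by lra.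
have Dt : (d - c) * (t - c) * u t <= D * u t.
  by rewrite /D expr2 ler_wpM2r// ler_wpM2l//; lra.
have Dt' : (d - c) * (d - t) * u t <= D * u t.
  by rewrite /D expr2 ler_wpM2r// ler_wpM2l//; lra.
have [tp|/ltW pt] := leP t p.
  have := concave_chord (W21S (lexx c) pd' W) (seg_ae_sub (lexx c) pd' gle0) ct tp.
  have h1 : 0 <= (p - t) * u c by rewrite mulr_ge0// subr_ge0.
  move=> h2; have h3 : (t - c) * u p <= (d - c) * u t.
    apply: (@le_trans _ _ ((p - c) * u t)); first by lra.
    by rewrite ler_wpM2r//; lra.
  have h4 : (d - t) * ((t - c) * u p) <= (d - t) * ((d - c) * u t) by rewrite ler_wpM2l.
  move: h4 Dt'; rewrite !mulrA; lra.
have := concave_chord (W21S cp (lexx d) W) (seg_ae_sub cp (lexx d) gle0) pt td.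
have h1 : 0 <= (t - p) * u d by rewrite mulr_ge0// subr_ge0.
move=> h2; have h3 : (d - t) * u p <= (d - c) * u t.
  apply: (@le_trans _ _ ((d - p) * u t)); first by lra.
  by rewrite ler_wpM2r//; lra.
have h4 : (t - c) * ((d - t) * u p) <= (t - c) * ((d - c) * u t) by rewrite ler_wpM2l.
move: h4 Dt; rewrite !mulrA; lra.
Qed.

(* Testing the equation with the eigenfunction on a nodal interval bounds
   \int q phi u; concavity of u on [c, d] turns this into a bound for max u. *)
Lemma superlinear_bound c d f q mu : c <= d -> L1_nonneg `[c, d] q ->
  dirichlet_eigenvalue c d q mu -> mu < 1 ->
  ae_in `[c, d] (fun x => forall s, 0 <= s -> 0 <= f x s) ->
  unif_liminf_ge (pinfty_nbhs R) `[c, d] f q ->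
  (forall rho, 0 < rho -> exists2 gam, itgble c d gam &
    ae_in (seg c d) (fun t => forall s, 0 <= s -> s <= rho -> `|f t s| <= gam t)) ->
  exists M, forall u v, W21 c d u v (fun t => - f t (u t)) ->
    (forall x, c <= x -> x <= d -> 0 <= u x) -> u c + `|v c| <= M.
Proof.
move=> cd Lq eig mu1 fpos finf fb.
have [c' [d' [phi [psi [[cc' c'd' d'd] Wphi pc pd pp]]]]] := nodal_interval cd Lq eig.
have [mi kap0] := eigenfunction_mass Lq cc' c'd' d'd Wphi pc pd pp.
set m := (fun t => q t * phi t * _) in mi kap0; set kap := itg c' d' m in kap0.
have cd' : c < d by exact: le_lt_trans cc' (lt_le_trans c'd' d'd).
have cphi := W21_u_cont (ltW c'd') Wphi.
have qi : itgble c' d' q by apply: itgbleS (L1_nonneg_itgble Lq).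
have phi0 t : c' <= t -> t <= d' -> 0 <= phi t.
  rewrite le_eqVlt => /predU1P[<-|ct]; first by rewrite pc.
  by rewrite le_eqVlt => /predU1P[->|td]; [rewrite pd|exact/ltW/pp].
have psic : 0 <= psi c' by apply: left_end_slope c'd' Wphi pc phi0.
have psid : psi d' <= 0 by apply: right_end_slope c'd' Wphi pd phi0.
have phii : itgble c' d' phi by apply: cont_on_itgble => //; exact: ltW.
have qphii : itgble c' d' (fun t => phi t * q t).
  by apply: cont_on_itgbleM => //; exact: ltW.
have q0 t : c' < t -> t <= d' -> 0 <= q t.
  by move=> ct td; apply: L1_nonneg_ge0 Lq _ _; lra.
set Phi := itg c' d' phi; set Q := itg c' d' (fun t => phi t * q t).
have Phi0 : 0 <= Phi.
  apply: itg_ge0 => //; apply: ae_inW => t; rewrite /seg/= in_itv/= => /andP[/ltW ? ?].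
  exact: phi0.
have Q0 : 0 <= Q.
  apply: itg_ge0 => //; apply: ae_inW => t; rewrite /seg/= in_itv/= => /andP[ct td].
  by rewrite mulr_ge0 ?q0// phi0// ltW.
pose D := (d - c) ^+ 2.
have D0 : 0 < D by rewrite exprn_gt0// subr_gt0.
(* [th * max u] is what the spectral gap gains in the tested inequality. The error term
   [e * Phi * max u] consumes at most half of it, and [N] results from dividing the remaining
   constant [S1 * Q] by [th / 2]. *)
pose th := (1 - mu) * kap / D.
have th0 : 0 < th by rewrite divr_gt0// mulr_gt0// subr_gt0.
pose e := th / (2 * (Phi + 1)).
have e0 : 0 < e by rewrite divr_gt0//; lra.
have ePhi : e * Phi <= th / 2.
  have : e * (2 * (Phi + 1)) = th by rewrite /e divfK//; apply: lt0r_neq0; lra.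
  by nra.
have [U [S [_ HS]] HU] := finf e e0.
pose S1 := `|S| + 1.
have S10 : 0 < S1 by rewrite ltr_wpDl.
have US s : S1 <= s -> U s.
  by move=> Ss; apply: HS; have := ler_norm S; rewrite /S1 in Ss; lra.
pose N := 2 * S1 * Q / th.
have N0 : 0 <= N by rewrite divr_ge0 ?(ltW th0)// !mulr_ge0// ltW.
(* [N + 1] because [N] may be 0. *)
have [gam gami Hgam] := fb (N + 1) (ltr_wpDl N0 ltr01).
exists (N + (N / (d - c) + itg c d gam)) => u v W up.
have cu := W21_u_cont cd W.
have gle0 : ae_in (seg c d) (fun t => - f t (u t) <= 0).
  apply: ae_inS (ae_seg_itv fpos) => t; rewrite /seg/= in_itv/= => /andP[/ltW ct td] Ht.
  by rewrite oppr_le0 Ht// up.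
have uN x : c <= x -> x <= d -> u x <= N.
  have [p [cp pd' Hp]] := cont_on_max cd cu.
  move=> cx xd; apply: le_trans (Hp x cx xd) _.
  have up0 := up p cp pd'.
  have shape t (ct : c <= t) (td : t <= d) : u p * ((t - c) * (d - t)) <= D * u t.
    exact: (concave_ge_parabola W gle0 up cp pd' ct td).
  have [wi wE] := wronskian (ltW c'd') (W21S cc' d'd W) Wphi.
  (* Majorant of the Wronskian integrand: the terms in [q * phi * u] combine to the factor
     [-(1 - mu)], after which [u] is bounded below by its maximum times the parabola. *)
  pose B t := - ((1 - mu) * u p / D) * m t + e * u p * phi t + S1 * (phi t * q t).
  have Bi1 : itgble c' d' (fun t => - ((1 - mu) * u p / D) * m t + e * u p * phi t).
    by apply: itgbleD; exact: itgbleZ.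
  have Bi : itgble c' d' B by apply: itgbleD => //; exact: itgbleZ.
  have : itg c' d' (fun t => - f t (u t) * phi t - u t * - (mu * q t * phi t)) <= itg c' d' B.
    apply: le_itg => //.
    apply: (@ae_in2 _ _ _ _ _ _ (seg_ae_sub cc' d'd (ae_seg_itv fpos))
      (seg_ae_sub cc' d'd (ae_seg_itv HU))).
    move=> t; rewrite /seg/= in_itv/= => /andP[ct td] f1 f2.
    have ct' : c <= t by lra.
    have td' : t <= d by lra.
    have ut := up t ct' td'; have upt := Hp t ct' td'.
    have qt := q0 t ct td; have pt := phi0 t (ltW ct) td.
    (* Above [S1] this is the condition at infinity. Below, the left side is at most 0, and
       [f >= 0]. *)
    have fl : q t * u t - e * u t - S1 * q t <= f t (u t).
      have eu : 0 <= e * u t by rewrite mulr_ge0// ltW.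
      have Sq : 0 <= S1 * q t by rewrite mulr_ge0// ltW.
      have [us|su] := leP (u t) S1.
        apply: le_trans (f1 _ ut).
        have : q t * u t <= S1 * q t by rewrite mulrC ler_wpM2r.
        lra.
      have ut0 : 0 < u t by exact: lt_trans su.
      have := f2 (u t) ut0 (US _ (ltW su)); rewrite ler_pdivlMr//; lra.
    have h1 : (q t * u t - e * u t - S1 * q t) * phi t <= f t (u t) * phi t by rewrite ler_wpM2r.
    have h2 : e * u t * phi t <= e * u p * phi t by rewrite ler_wpM2r// ler_wpM2l// ltW.
    have h3 : (1 - mu) * u p / D * m t <= (1 - mu) * (q t * phi t * u t).
      have -> : (1 - mu) * u p / D * m t =
          (1 - mu) * (q t * phi t * (u p * ((t - c) * (d - t)) / D)) by rewrite /m; ring.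
      rewrite ler_wpM2l ?subr_ge0 ?(ltW mu1)// ler_wpM2l ?mulr_ge0// ler_pdivrMr//.
      by rewrite [leRHS]mulrC; exact: shape.
    have -> : B t = - ((1 - mu) * u p / D * m t) + e * u p * phi t + S1 * (phi t * q t).
      by rewrite /B; ring.
    move: h3; set X := (1 - mu) * u p / D * m t => h3.
    by move: h1 h2 h3; lra.
  have BE : itg c' d' B = - ((1 - mu) * u p / D) * kap + e * u p * Phi + S1 * Q.
    by rewrite itgD ?itgD ?itgZ//; exact: itgbleZ.
  rewrite BE -wE pc pd !mulr0 !sub0r opprK => main.
  have uc' : 0 <= u c' by apply: up => //; exact: le_trans (ltW c'd') d'd.
  have ud' : 0 <= u d' by apply: up => //; exact: le_trans cc' (ltW c'd').
  have : 0 <= - (u d' * psi d') + u c' * psi c'.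
    by rewrite addr_ge0 ?mulr_ge0// oppr_ge0 mulr_ge0_le0.
  have thE : (1 - mu) * u p / D * kap = th * u p by rewrite /th; ring.
  rewrite mulNr thE in main.
  move=> lhs; have h : e * Phi * u p <= th / 2 * u p by rewrite ler_wpM2r.
  rewrite /N ler_pdivlMr//; move: main lhs h; lra.
(* By concavity the mean slope, at most [N / (d - c)] in absolute value, bounds [v c] from below and
   [v d] from above; integrating [f] over [c, d] passes from [v d] to an upper bound for [v c]. *)
have dc0 : 0 < d - c by rewrite subr_gt0.
have [h1 h2] := concave_u W gle0 (lexx c) cd (lexx d).
have uc := up c (lexx c) cd; have ud := up d cd (lexx d).
have uc1 := uN c (lexx c) cd; have ud1 := uN d cd (lexx d).
have fi : itgble c d (fun t => f t (u t)).
  have [gi _ _] := W; have := itgbleN gi; move=> /itgble_ae; apply.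
  by apply: ae_inW => t _; rewrite opprK.
have vE : v c = v d + itg c d (fun t => f t (u t)).
  by have [_ vg _] := W; have := vg c d (lexx c) cd (lexx d); rewrite itgN//; lra.
have fg : itg c d (fun t => f t (u t)) <= itg c d gam.
  apply: le_itg => //; apply: ae_inS Hgam => t; rewrite /seg/= in_itv/= => /andP[/ltW ct td] Ht.
  apply: le_trans (ler_norm _) (Ht _ (up t ct td) _).
  by apply: le_trans (uN t ct td) _; rewrite lerDl.
have g0 : 0 <= itg c d gam.
  by apply: itg_ge0 => //; apply: ae_inS Hgam => t _ Ht;
     apply: le_trans (normr_ge0 _) (Ht 0 (lexx 0) _); exact: addr_ge0.
apply: lerD => //.
have vd : v d <= N / (d - c) by rewrite ler_pdivlMr//; lra.
have vc : - (N / (d - c)) <= v c by rewrite -mulNr ler_pdivrMr//; lra.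
rewrite ler_norml; apply/andP; split; lra.
Qed.

End nonlinear.

(** * From the hypotheses on [f] to global growth bounds *)

Section caratheodory.
Context {R : realType}.
Implicit Types (a b c d e r s t L x y al : R) (u v q k : R -> R) (f F : R -> R -> R).

Lemma within_ge0_seq (g : R -> R) (s : nat -> R) s' :
  {within `[0, +oo[, continuous g} -> (forall n, 0 <= s n) -> 0 <= s' ->
  s @ \oo --> s' -> g (s n) @[n --> \oo] --> g s'.
Proof.
move=> /subspace_continuousP gc s0 s'0 ss.
have := gc s'; rewrite /= in_itv/= s'0 => /(_ isT) h.
apply: cvg_comp h => B /ss [N _ HN]; exists N => // n /= Nn.
by apply: (HN n Nn); rewrite /= in_itv/= s0.
Qed.

Lemma ae_ne c : ae_in [set: R] (fun t => t <> c).
Proof.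
exists [set c]; split.
- by apply: borel_leb; exact: measurable_set1.
- exact: lebesgue_measure_set1.
- by move=> t /= /not_implyP[_ /contrapT].
Qed.

Lemma L1_nonneg_patch a b (A : set R) q : measurable A -> A `<=` `[a, b]%classic ->
  L1_nonneg A q -> itgble a b (q \_ A) /\ forall t, 0 <= (q \_ A) t.
Proof.
move=> mA Aab [qi q0]; have mA' := borel_leb mA; split.
  have h := (@integrable_mkcond _ _ _ (leb R) A (EFin \o q) mA').1 qi.
  rewrite restrict_EFin in h; exact: (integrableS _ _ _ h).
move=> t; rewrite patchE; case: ifPn => // /set_mem; exact: q0.
Qed.

(** On [c, d] the sign of [f] makes 0 a bound for [-f]; elsewhere [gC] covers [s1 <= C] and (G) the
    rest. The second variable [s >= s1] makes room for truncation. The two-sided bound is kept for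
    [t < c], where the backward estimate uses it. *)
Lemma linear_growth c d L f (a b : R -> R) (C : R) : 0 <= c -> c <= d -> d <= L ->
  L1_caratheodory `[0, L] f ->
  ae_in `[c, d] (fun x => forall s, 0 <= s -> 0 <= f x s) ->
  L1_nonneg (`[0, L] `\` `[c, d]) a -> L1_nonneg (`[0, L] `\` `[c, d]) b -> 0 < C ->
  ae_in (`[0, L] `\` `[c, d]) (fun x => forall s, C <= s -> `|f x s| <= a x + b x * s) ->
  exists e1 k : R -> R, [/\ itgble 0 L e1, itgble 0 L k, forall t, 0 <= e1 t,
    forall t, 0 <= k t &
    ae_in (seg 0 L) (fun t => forall s1 s, 0 <= s1 -> s1 <= s ->
      - f t s1 <= e1 t + s * k t /\ (t < c -> `|f t s1| <= e1 t + s * k t))].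
Proof.
move=> c0 cd dL fcar fpos La Lb C0 G.
have [gC LgC HgC] := caratheodory_bounded fcar C0.
set A := `[0, L] `\` `[c, d] in La Lb G.
have mA : measurable A by apply: measurableD; exact: measurable_itv.
have A0L : A `<=` `[0, L]%classic by exact: subDsetl.
have LgCA : L1_nonneg A gC.
  have [gi g0] := LgC; split; last by move=> t /A0L; exact: g0.
  apply: integrableS gi => //; apply: borel_leb => //; exact: measurable_itv.
have [ai a0] := L1_nonneg_patch mA A0L La.
have [bi b0] := L1_nonneg_patch mA A0L Lb.
have [gi g0] := L1_nonneg_patch mA A0L LgCA.
exists (fun t => (gC \_ A) t + (a \_ A) t), (b \_ A); split => //.
- exact: itgbleD.
- by move=> t; rewrite addr_ge0.
apply: (@filterS3 _ _ (ae_filter_ringOfSetsType (leb R)) _ _ _ _ _ HgC fpos G).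
move=> t h1 h2 h3 /seg_sub_itv t0L s1 s s10 s1s.
have s0 := le_trans s10 s1s.
have [tcd|tcd] := pselect (`[c, d]%classic t).
  have ft := h2 tcd s1 s10.
  rewrite !patchE memNset; last by move=> [_].
  rewrite addr0 mulr0 addr0; split; first by rewrite oppr_le0.
  by move: tcd; rewrite /= in_itv/= => /andP[ct _]; rewrite ltNge ct.
have tA : A t by split.
have eb : `|f t s1| <= (gC \_ A) t + (a \_ A) t + s * (b \_ A) t.
  have a0t := a0 t; have b0t := b0 t; have g0t := g0 t.
  rewrite !patchE mem_set// in a0t b0t g0t *.
  have [sC|Cs] := leP s1 C.
    have h := h1 t0L s1; rewrite s10 sC in h; apply: le_trans (h isT) _.
    by rewrite -addrA lerDl addr_ge0// mulr_ge0.
  apply: le_trans (h3 tA s1 (ltW Cs)) _.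
  have : b t * s1 <= s * b t by rewrite mulrC ler_wpM2r.
  by lra.
split => //; apply: le_trans eb; rewrite -normrN; exact: ler_norm.
Qed.

End caratheodory.

(** * Choice of the constants and conclusion *)

Theorem theorem3p2 (R : realType) (L c d : R) (f : R -> R -> R)
  (L_gt0 : 0 < L)
  (f_car : L1_caratheodory `[0, L] f)
  (f_star : ae_in `[0, L] (fun x => f x 0 = 0))
  (f_0_minus : exists2 q, L1_nonneg `[0, L] q &
     unif_liminf_ge 0^'+ `[0, L] f (fun x => - q x))
  (f_0_plus : exists q, [/\ L1_nonneg `[0, L] q, not_null `[0, L] q,
     unif_limsup_le 0^'+ `[0, L] f q &
     exists2 mu, first_eigenvalue 0 L q mu & 1 < mu])
  (J_sub : 0 <= c /\ c <= d /\ d <= L)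
  (f_ge0_J : ae_in `[c, d] (fun x => forall s, 0 <= s -> 0 <= f x s))
  (f_infty_J : exists q, [/\ L1_nonneg `[c, d] q, not_null `[c, d] q,
     unif_liminf_ge (pinfty_nbhs R) `[c, d] f q &
     exists2 mu, first_eigenvalue c d q mu & mu < 1])
  (G : exists a b : R -> R, exists C : R,
     [/\ L1_nonneg (`[0, L] `\` `[c, d]) a,
         L1_nonneg (`[0, L] `\` `[c, d]) b,
         0 < C &
         ae_in (`[0, L] `\` `[c, d])
           (fun x => forall s, C <= s -> `|f x s| <= a x + b x * s)]) :
  exists2 u : R -> R,
    dirichlet_solution 0 L f u /\ (forall x, x \in `[0, L] -> 0 <= u x) &
    forall x, x \in `]0, L[ -> 0 < u x.
Proof.
have [c0 [cd dL]] := J_sub; have cL := le_trans cd dL.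
have [qm Lqm fm] := f_0_minus.
have [q0 [Lq0 _ fp [mu0 [_ mu0min] mu01]]] := f_0_plus.
have [qi [Lqi _ finf [mui [eigi _] mui1]]] := f_infty_J.
have [a [b [C [La Lb C0 HG]]]] := G.
have neig nu : nu <= 1 -> ~ dirichlet_eigenvalue 0 L q0 nu.
  by move=> nu1 /mu0min h; move: (lt_le_trans mu01 (le_trans h nu1)); rewrite ltxx.
have [al0 [r [al00 r0 Hsmall]]] := small_slope L_gt0 Lq0 Lqm neig f_star fm fp.
have [e1 [k [e1i ki e10 k0 Hgrowth]]] := linear_growth c0 cd dL f_car f_ge0_J La Lb C0 HG.
have [||C1 C10 Hup] := @apriori_upper R L e1 k (ltW L_gt0) e1i ki; [by move=> *|by move=> *|].
have [||C2 C20 Hback] := @apriori_back R c e1 k c0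
  (itgbleS (lexx 0) cL e1i) (itgbleS (lexx 0) cL ki); [by move=> *|by move=> *|].
have fb rho : 0 < rho -> exists2 gam, itgble 0 L gam &
    ae_in (seg 0 L) (fun t => forall s, 0 <= s -> s <= rho -> `|f t s| <= gam t).
  move=> /(caratheodory_bounded f_car)[gam Lgam Hgam]; exists gam; first exact: L1_nonneg_itgble.
  by apply: ae_inS (ae_seg_itv Hgam) => t _ Ht s s0 sr; apply: Ht; rewrite s0.
have [|M HM] := @superlinear_bound R c d f qi mui cd Lqi eigi mui1 f_ge0_J finf.
  move=> rho /fb[gam gi Hg]; exists gam; first exact: itgbleS gi.
  exact: seg_ae_sub Hg.
pose E := itg 0 L e1; pose Ec := itg 0 c e1.
(* A nonnegative solution has initial slope at most [C2 * (M + 2 * Ec)] by the backward estimate, so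
   adding 1 excludes slope [al1]. *)
pose al1 := Num.max al0 (C2 * (M + 2 * Ec) + 1).
have al01 : al0 <= al1 by rewrite le_max lexx.
have al1M : C2 * (M + 2 * Ec) + 1 <= al1 by rewrite le_max lexx orbT.
(* Nonnegative solutions with slope at most [al1] stay below [rho], and [r <= rho] makes the
   truncation agree with [f] where [Hsmall] needs it. *)
pose rho := Num.max r (C1 * (al1 + 2 * E)).
have rrho : r <= rho by rewrite le_max lexx.
have Crho : C1 * (al1 + 2 * E) <= rho by rewrite le_max lexx orbT.
have rho0 : 0 < rho by exact: lt_le_trans rrho.
pose F t s := f t (clamp rho s).
have F0 : ae_in (seg 0 L) (fun t => forall s, s <= 0 -> F t s = 0).
  by apply: ae_inS (ae_seg_itv f_star) => t _ ft0 s s0; rewrite /F clamp_neg.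
have nonneg u v : W21 0 L u v (fun t => - F t (u t)) -> u 0 = 0 -> 0 <= u L ->
    forall x, 0 <= x -> x <= L -> 0 <= u x.
  move=> W u0 uL x x0 xL; rewrite leNgt; apply/negP => ux.
  by move: (negative_stays F0 W u0 x0 xL ux); rewrite ltNge uL.
have solution al u v : 0 <= al -> al <= al1 -> W21 0 L u v (fun t => - F t (u t)) ->
    u 0 = 0 -> v 0 = al -> 0 <= u L -> W21 0 L u v (fun t => - f t (u t)).
  move=> al_ge0 al_le W u0 v0 uL; have up := nonneg u v W u0 uL.
  have ule x : 0 <= x -> x <= L -> u x <= rho.
    move=> x0 xL.
    apply: le_trans (Hup L al u v _ (ltW L_gt0) (lexx L) al_ge0 W u0 v0 up _ x x0 xL) _.
      apply: ae_inS Hgrowth => t; rewrite /seg/= in_itv/= => /andP[/ltW t0 tL] Ht.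
      have ut := up t t0 tL.
      (* The growth bound applies with the truncated value as [s1] and [u t] itself as [s]. *)
      by have [] := Ht (clamp rho (u t)) (u t) (clamp_ge0 _ _) (clamp_le_id _ ut).
    by apply: le_trans Crho; rewrite ler_pM2l// lerD2r.
  apply: W21_eq W => t /ltW t0 tL; rewrite /F clamp_id//; [exact: up|exact: ule].
have [gam gami Hgam] := fb rho rho0.
have [||||||la [u [v [/andP[la0 la1] [W u0 v0] uL]]]] :=
    @kneser R L (fun=> F) gam (fun la => (1 - la) * al0 + la * al1) L_gt0 gami.
- move=> _ s; rewrite /F.
  apply: measurable_funS (Defs.caratheodory_measurable f_car (clamp_ge0 rho s)).
  + by apply: borel_leb; exact: measurable_itv.
  + exact: seg_sub_itv.
- apply: ae_inS Hgam => t _ Ht _ s; apply: Ht; [exact: clamp_ge0|exact/clamp_le/ltW].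
- apply: ae_inS (ae_seg_itv (Defs.caratheodory_continuous f_car)) => t _ Ht _ s _ s' _ ss.
  apply: (within_ge0_seq Ht (fun n => clamp_ge0 rho (s n)) (clamp_ge0 rho s')).
  by apply: clamp_cvg => //; exact: ltW.
- move=> x; apply: cvgD; apply: cvgMl; last exact: cvg_id.
  by apply: cvgB; [exact: cvg_cst|exact: cvg_id].
- move=> u v [W u0 v0]; apply: (Hsmall F u v) => //.
    by move=> t s s0 sr; rewrite /F clamp_id//; exact: le_trans rrho.
  by rewrite v0 subr0 mul1r mul0r addr0.
- move=> u v [W u0 v0]; rewrite ltNge; apply/negP => uL.
  rewrite subrr mul0r add0r mul1r in v0.
  have al1_ge0 : 0 <= al1 by exact: le_trans (ltW al00) al01.
  have Wf := solution al1 u v al1_ge0 (lexx _) W u0 v0 uL.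
  have up := nonneg u v W u0 uL.
  have uvc : u c + `|v c| <= M.
    apply: HM; first exact: W21S Wf.
    by move=> x cx xd; apply: up; [exact: le_trans cx|exact: le_trans dL].
  have : v 0 <= C2 * (u c + `|v c| + 2 * Ec).
    apply: (Hback u v _ (W21S (lexx 0) cL Wf)).
      by move=> x x0 xc; apply: up => //; exact: le_trans cL.
    (* The two-sided bound holds only for [t < c], while [seg 0 c] contains [c]. *)
    have tc : ae_in (seg 0 c) (fun t => t <> c) by apply: ae_in_sub (ae_ne c).
    apply: (@ae_in2 _ _ _ _ _ _ tc (seg_ae_sub (lexx 0) cL Hgrowth)) => t.
    rewrite /seg/= in_itv/= => /andP[/ltW t0 tc'] tnc Ht.
    have ut := up t t0 (le_trans tc' cL).
    have [_ h] := Ht (u t) (u t) ut (lexx _); rewrite normrN; apply: h.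
    by rewrite lt_neqAle tc' andbT; apply/eqP.
  have : C2 * (u c + `|v c| + 2 * Ec) <= C2 * (M + 2 * Ec) by rewrite ler_pM2l// lerD2r.
  by rewrite v0; lra.
have al_gt0 : 0 < (1 - la) * al0 + la * al1 by nra.
have al_le : (1 - la) * al0 + la * al1 <= al1 by nra.
have uL0 : 0 <= u L by rewrite uL.
have Wf := solution _ u v (ltW al_gt0) al_le W u0 v0 uL0.
have up := nonneg u v W u0 uL0.
exists u; first split.
- exact: W21_dirichlet_solution (ltW L_gt0) Wf u0 uL.
- by move=> x; rewrite in_itv/= => /andP[x0 xL]; exact: up.
move=> x; rewrite in_itv/= => /andP[x0 xL].
by apply: (positive_solution L_gt0 Lqm f_star fm Wf u0 _ up) => //; rewrite v0.
Qed.
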